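(* Let $p\in(1,\infty)$ and let $\varphi$ be a nonnegative function in $L^1_{\rm loc}(0,\infty)$. Then $H_\varphi$ is bounded on $L^p(\mathbb R)$ if and only if $$\int_0^\infty t^{1/p-1}\varphi(t)\,dt<\infty .$$ Moreover, in that case, $$\|H_\varphi\|_{L^p(\mathbb R)\to L^p(\mathbb R)}=\int_0^\infty t^{1/p-1}\varphi(t)\,dt$$ and $H_\varphi$ commutes with the Hilbert transform $H$ on $L^p(\mathbb R)$, i.e. $H_\varphi(H(f))=H(H_\varphi(f))$ for all $f\in L^p(\mathbb R)$.
   Context: The Hausdorff operator is $H_\varphi f(x)=\int_0^\infty f\left(\frac xt\right)\frac{\varphi(t)}{t}\,dt$, $x\in\mathbb R$. ''$H_\varphi$ is bounded on $L^p(\mathbb R)$'' means that for every $f\in L^p(\mathbb R)$ this integral exists for a.e. $x$ and $H_\varphi$ is a bounded linear operator from $L^p(\mathbb R)$ to itself. The Hilbert transform is $H(f)(x)=\frac1\pi\,\mathrm{p.v.}\int_{-\infty}^\infty\frac{f(y)}{x-y}\,dy$. *)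

(* Defs.v *)
(* MathComp-Analysis, over an arbitrary [R : realType]; complex numbers are
   [R[i]] from mathcomp-real-closed. *)
Set Warnings "-notation-overridden,-notation-incompatible-prefix,-ambiguous-paths".
From HB Require Import structures.
From mathcomp Require Import all_boot all_order all_algebra.
From mathcomp Require Import complex.
From mathcomp Require Import all_classical all_reals all_analysis.

Set Implicit Arguments.
Unset Strict Implicit.
Unset Printing Implicit Defensive.

Import Order.TTheory GRing.Theory Num.Theory.
Import numFieldNormedType.Exports.

Local Open Scope classical_set_scope.
Local Open Scope ring_scope.
Local Open Scope complex_scope.

Section ComplexIntegral.
Context {R : realType}.
Local Notation mu := (@lebesgue_measure R).
Implicit Types (D : set R) (f : R -> R[i]).

Definition Cmodulus (z : R[i]) : R := ComplexField.Normc.normc z.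

Definition Cmeasurable f : Prop :=
  measurable_fun [set: R] (fun x => complex.Re (f x)) /\
  measurable_fun [set: R] (fun x => complex.Im (f x)).

Definition Cintegrable D f : Prop :=
  mu.-integrable D (fun x => (complex.Re (f x))%:E) /\
  mu.-integrable D (fun x => (complex.Im (f x))%:E).

(* Total; meaningful when [Cintegrable D f]. *)
Definition Cintegral D f : R[i] :=
  (\int[mu]_(x in D) complex.Re (f x)) +i*
  (\int[mu]_(x in D) complex.Im (f x)).

(* Complex-valued L^p(R), by (Borel) representatives: its elements are
   identified when they are equal almost everywhere. *)
Definition LpNorm (p : R) f : \bar R :=
  ('N[mu]_(p%:E)[EFin \o (Cmodulus \o f)])%E.

Definition Lp (p : R) : set (R -> R[i]) :=
  [set f | Cmeasurable f /\ (LpNorm p f < +oo)%E].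

End ComplexIntegral.

Section Operators.
Context {R : realType}.
Local Notation mu := (@lebesgue_measure R).
Implicit Types (p : R) (phi : R -> R) (f : R -> R[i]).
Implicit Types (T : (R -> R[i]) -> (R -> R[i])).

Definition bounded_linear_Lp p T : Prop :=
  [/\ forall f, Lp p f -> Lp p (T f),
      forall (a : R[i]) f g, Lp p f -> Lp p g ->
        T (fun x => a * f x + g x) = (fun x => a * T f x + T g x) %[ae mu] &
      exists C : R, forall f, Lp p f -> (LpNorm p (T f) <= C%:E * LpNorm p f)%E].

Definition opnorm_Lp p T : \bar R :=
  ereal_sup [set LpNorm p (T f) | f in [set f | Lp p f /\ (LpNorm p f <= 1)%E]].

Definition hausdorff_integrand phi f (x t : R) : R[i] :=
  f (x / t) * (phi t / t)%:C.

Definition hausdorff phi f (x : R) : R[i] :=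
  Cintegral `]0, +oo[ (hausdorff_integrand phi f x).

Definition hausdorff_exists phi f : Prop :=
  {ae mu, forall x, Cintegrable `]0, +oo[ (hausdorff_integrand phi f x)}.

Definition hausdorff_bounded p phi : Prop :=
  (forall f, Lp p f -> hausdorff_exists phi f) /\
  bounded_linear_Lp p (hausdorff phi).

Definition hilbert_integrand f (x y : R) : R[i] := f y / (x - y)%:C.

(* The principal value only excises the singularity [y = x]: for [f] in L^p with
   [1 < p < +oo] the integral converges absolutely at infinity. *)
Definition hilbert_trunc f (x e : R) : R[i]^o :=
  Cintegral [set y | e < `|x - y|] (hilbert_integrand f x).

(* Total: [lim] is a default value where the principal value does not exist. *)
Definition hilbert f (x : R) : R[i] :=
  (pi^-1)%:C * lim (hilbert_trunc f x e @[e --> 0^'+]).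

Definition hilbert_exists f : Prop :=
  {ae mu, forall x,
    (forall e : R, 0 < e ->
       Cintegrable [set y | e < `|x - y|] (hilbert_integrand f x)) /\
    cvg (hilbert_trunc f x e @[e --> 0^'+])}.

(* The four existence clauses say that both compositions are defined on L^p, so
   that the default values of the integrals and of the limit play no role in the
   last clause. *)
Definition hausdorff_hilbert_commute p phi : Prop :=
  forall f, Lp p f ->
  [/\ hilbert_exists f /\ Lp p (hilbert f),
      hausdorff_exists phi (hilbert f),
      hausdorff_exists phi f /\ Lp p (hausdorff phi f),
      hilbert_exists (hausdorff phi f) &
      hausdorff phi (hilbert f) = hilbert (hausdorff phi f) %[ae mu]].

End Operators.

(* Main.v *)
Require Import Defs.
Set Warnings "-notation-overridden,-notation-incompatible-prefix,-ambiguous-paths".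
From HB Require Import structures.
From mathcomp Require Import all_boot all_order all_algebra.
From mathcomp Require Import complex.
From mathcomp Require Import all_classical all_reals all_analysis.
From mathcomp Require Import measurable_realfun.
From mathcomp Require Import ring lra.

Import Order.TTheory GRing.Theory Num.Theory.
Import numFieldNormedType.Exports.

Local Open Scope classical_set_scope.
Local Open Scope ring_scope.
Unset Printing Implicit Defensive.

(** Put [w t = phi t / t] for [t > 0] and [w t = 0] elsewhere. The Hausdorff operator
    is then the average of dilations [T f x = \int f (x / t) * w t dt], the integral
    of the theorem is [I = \int t `^ p^-1 * w t dt], and [t `^ p^-1] is the norm of
    the dilation [f |-> f (./t)] of L^p. So [T] is bounded with constant [I]: this is
    Minkowski's inequality, obtained here from Hoelder's inequality for the measure
    [t `^ p^-1 * w t dt] and from Tonelli's theorem ([dil_strong]). Conversely, the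
    functions [(d * p) `^ p^-1 * x `^ (- p^-1 - d)] on [1, +oo[ have norm 1 and are
    almost eigenfunctions of the dilations when [d] is small. On [N, +oo[, [T]
    multiplies them by at least [N `^ (- d)] times the part of [I] that comes from
    [1/N <= t <= N]; with [d] tending to 0 and then [N] to infinity, no bound of [T]
    is smaller than [I] ([moment_le]).

    For the commutation, a truncated Hilbert transform is an absolutely convergent
    integral, and truncating the dilate of [f] by [t] at radius [e] is the same as
    truncating [f] at radius [e / t]. By Fubini's theorem the truncation of [T f] at
    [x] is therefore [\int H_(e/t) f (x / t) * w t dt] ([trunc_dil]). When [e] tends to
    0 the integrand tends to [pi * H f (x / t) * w t], and dominated convergence gives
    [H (T f) = T (H f)] almost everywhere ([dil_commute]), provided that the maximal
    function [sup_e |H_e f|] is in L^p and that the principal value exists almost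
    everywhere. The rest of the proof establishes these two facts
    ([maximal_truncation], [trunc_cvg_memLp]).

    The starting point is Boole's identity. Let [E] be a union of disjoint intervals
    [[a_i, b_i]], put [Pa = \prod_i ('X - a_i)] and [Pb = \prod_i ('X - b_i)]. At
    [z = x + i e] the conjugate Poisson integral of the indicator of [E] is
    [ln |Pa z / Pb z|]. If it is at least [l], put [m = exp l]: the polynomials
    [Pa + m Pb] and [Pa - m Pb] have real roots [d_i < c_i] that interlace, the total
    length of the intervals [[d_i, c_i]] is [2 m / (m^2 - 1)] times that of [E], and
    their Poisson integral at [z] is at least [pi / 2] ([boole_roots]). So all such
    [x], whatever [e], lie where the Hardy-Littlewood maximal function of the
    intervals [[d_i, c_i]] exceeds a constant, and the maximal inequality bounds the
    measure of that set by a multiple of [m / (m^2 - 1) * |E|] ([boole_weak]). As the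
    truncated kernel differs from the conjugate Poisson kernel by at most the Poisson
    kernel, the same kind of bound holds for the truncations; it extends from unions
    of intervals to measurable sets of finite measure ([weak_set]).

    This bound is [O(1 / l)] for small [l] and decays exponentially for large [l]; it
    thus controls every power [a > 1] of the maximal truncation of an indicator by the
    measure of the set ([strong_set]). For [f >= 0], the maximal truncation of [f] is
    at most the integral over [s > 0] of those of the level sets [f >= s], and a
    Hardy inequality ([hardy_two_exponents]) bounds the [p]-th power of such an
    integral by two powers of its integrand, one below and one above [p]; this gives
    the L^p bound ([interpolation], [maxtrunc_strong]). Finally, the truncations
    converge off the endpoints for the indicator of an interval, and the maximal bound
    makes almost everywhere convergence pass to limits in L^p ([trunc_cvg_closed]). *)

(** * Preliminaries on Lebesgue integrals *)

Section RealTools.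
Context {R : realType}.
Local Notation mu := (@lebesgue_measure R).
Implicit Types (f g : R -> \bar R).

Lemma ae_imply (P Q : R -> Prop) : (forall x, P x -> Q x) ->
  {ae mu, forall x, P x} -> {ae mu, forall x, Q x}.
Proof. exact: (@filterS _ _ (ae_filter_ringOfSetsType mu)). Qed.

Lemma ae_imply2 (P1 P2 Q : R -> Prop) : (forall x, P1 x -> P2 x -> Q x) ->
  {ae mu, forall x, P1 x} -> {ae mu, forall x, P2 x} -> {ae mu, forall x, Q x}.
Proof. exact: (@filterS2 _ _ (ae_filter_ringOfSetsType mu)). Qed.

Lemma measurable_inv : measurable_fun [set: R] (fun x : R => x^-1)%R.
Proof.
have -> : (fun x : R => x^-1)%R =
    (fun x => (Num.max x 0) `^ (-1) - (Num.max (- x) 0) `^ (-1))%R.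
  apply/funext => x; rewrite !powR_inv1 ?le_max ?lexx ?orbT//.
  have [x0|x0] := leP 0%R x.
    by rewrite max_r ?oppr_le0// invr0 subr0.
  by rewrite max_l ?oppr_ge0 ?ltW// invr0 sub0r invrN opprK.
pose pw := fun y : R => y `^ (-1).
have mpw : measurable_fun [set: R] pw by exact: measurable_powR.
apply: (@measurable_funB _ _ _ _ (pw \o (fun x => Num.max x 0))
  (pw \o (fun x => Num.max (- x) 0))); apply: measurableT_comp => //.
  exact: measurable_maxr.
apply: measurable_maxr => //.
Qed.

Lemma measurable_funV d (T : measurableType d) (D : set T) (h : T -> R) :
  measurable_fun D h -> measurable_fun D (fun x => (h x)^-1)%R.
Proof. exact: measurableT_comp measurable_inv. Qed.

Lemma powR_le_root (p a r : R) : (0 < p)%R -> (0 <= a)%R -> (0 <= r)%R ->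
  (a `^ p <= r)%R = (a <= r `^ p^-1)%R.
Proof.
move=> p0 a0 r0; apply/idP/idP => h.
  have -> : a = ((a `^ p) `^ p^-1)%R by rewrite -powRrM mulfV ?gt_eqF// powRr1.
  by apply: ge0_ler_powR; rewrite ?nnegrE ?powR_ge0 ?invr_ge0 ?(ltW p0).
have -> : r = ((r `^ p^-1) `^ p)%R by rewrite -powRrM mulVf ?gt_eqF// powRr1.
by apply: ge0_ler_powR; rewrite ?nnegrE ?powR_ge0 ?(ltW p0).
Qed.

Lemma cvg_powRN_pinfty (g : R) : (0 < g)%R ->
  (x : R) `^ (- g) @[x --> +oo%R] --> (0 : R)%R.
Proof.
move=> g0; apply/cvgrPdist_le => /= e e0.
near=> x.
rewrite sub0r normrN ger0_norm ?powR_ge0// powRN.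
rewrite -[leRHS]invrK lef_pV2 ?posrE ?invr_gt0 ?powR_gt0//.
have x0 : (0 <= e^-1 `^ g^-1)%R by exact: powR_ge0.
have : (e^-1 `^ g^-1 <= x)%R by near: x; apply: nbhs_pinfty_ge; rewrite num_real.
move=> h.
have := ge0_ler_powR (ltW g0) x0 (le_trans x0 h) h.
by rewrite -powRrM mulVf ?gt_eqF// powRr1// invr_ge0 ltW.
Unshelve. all: by end_near. Qed.

Local Open Scope ereal_scope.

(** Lebesgue measure is determined by the half-open intervals, so it equals
    [c^-1] times its own image under [h]. *)
Lemma ge0_integral_transport (h : R -> R) (c : R) f : (0 < c)%R ->
  measurable_fun setT h ->
  (forall a b : R, mu (h @^-1` `]a, b]) = c%:E * mu `]a, b]) ->
  measurable_fun setT f -> (forall x, 0 <= f x) ->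
  \int[mu]_x f (h x) = c%:E * \int[mu]_x f x.
Proof.
move=> c0 mh hE mf f0; have ci : (0 <= c^-1)%R by rewrite invr_ge0 ltW.
pose ph : R -> measurableTypeR R := h.
have mph : measurable_fun setT ph by exact: mh.
have := @ge0_integral_pushforward _ _ (measurableTypeR R) (measurableTypeR R) R
  ph mph mu setT f measurableT mf.
rewrite preimage_setT => /(_ (fun y _ => f0 y)) <-.
pose nu0 : {measure set (measurableTypeR R) -> \bar R} :=
  mscale (NngNum ci) (pushforward mu ph).
pose nu := nu0 mph.
have nuE A : measurable A -> mu A = nu A.
  move=> mA; apply: lebesgue_measure_unique => // _ [[a b]] _ <-.
  transitivity ((c^-1)%:E * mu (h @^-1` `]a, b])); last by [].
  by rewrite hE muleA -EFinM mulVf ?mul1e// gt_eqF.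
have -> : \int[mu]_x f x = \int[nu]_x f x.
  by apply: eq_measure_integral => A mA _; exact: nuE.
by rewrite ge0_integral_mscale//= muleA -EFinM mulfV ?mul1e// gt_eqF.
Qed.

(** Here [+oo - +oo] is [-oo], and a positive factor fixes it. *)
Lemma gt0_muleBr (c : R) (a b : \bar R) : (0 < c)%R -> 0 <= a -> 0 <= b ->
  c%:E * (a - b) = c%:E * a - c%:E * b.
Proof.
move=> c0; case: a => [a| |] //; case: b => [b| |] // _ _.
- by rewrite -EFinB -!EFinM -EFinB mulrBr.
- by rewrite gt0_muley ?lte_fin// -EFinM /= gt0_muleNy ?lte_fin.
- by rewrite gt0_muley ?lte_fin// -EFinM /= gt0_muley ?lte_fin.
- by rewrite gt0_muley ?lte_fin//= gt0_muleNy ?lte_fin.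
Qed.

Lemma integral_transport (h : R -> R) (c : R) f : (0 < c)%R ->
  measurable_fun setT h ->
  (forall a b : R, mu (h @^-1` `]a, b]) = c%:E * mu `]a, b]) ->
  measurable_fun setT f -> \int[mu]_x f (h x) = c%:E * \int[mu]_x f x.
Proof.
move=> c0 mh hE mf; rewrite [LHS]integralE [in RHS]integralE gt0_muleBr//.
- have mp : measurable_fun setT (f^\+) by exact: measurable_funepos.
  have mn : measurable_fun setT (f^\-) by exact: measurable_funeneg.
  rewrite -(ge0_integral_transport h c _ c0 mh hE mp (funepos_ge0 f)).
  rewrite -(ge0_integral_transport h c _ c0 mh hE mn (funeneg_ge0 f)).
  by congr (_ - _); apply: eq_integral => x _; rewrite ?funeposE ?funenegE.
- by apply: integral_ge0 => x _; exact: funepos_ge0.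
- by apply: integral_ge0 => x _; exact: funeneg_ge0.
Qed.

Lemma integral_dilate f (t : R) : (0 < t)%R -> measurable_fun setT f ->
  \int[mu]_x f (x / t)%R = t%:E * \int[mu]_x f x.
Proof.
move=> t0; apply: integral_transport => //; first exact: mulrr_measurable.
move=> a b; rewrite (_ : _ @^-1` _ = `](a * t)%R, (b * t)%R]%classic).
  rewrite !lebesgue_measure_itv/= !lte_fin ltr_pM2r//.
  by case: ifPn => _; rewrite ?mule0// -!EFinB -EFinM -mulrBl mulrC.
by apply/seteqP; split => x /=; rewrite !in_itv/= ltr_pdivlMr// ler_pdivrMr.
Qed.

Lemma integral_reflect f (x : R) : measurable_fun setT f ->
  \int[mu]_y f (x - y)%R = \int[mu]_y f y.
Proof.
move=> mf; rewrite -[RHS]mul1e; apply: integral_transport => //.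
  exact: measurable_funB.
move=> a b; rewrite (_ : _ @^-1` _ = `[(x - b)%R, (x - a)%R[%classic).
  rewrite !lebesgue_measure_itv/= !lte_fin ltrD2l ltrN2 mul1e.
  by case: ifPn => _ //; rewrite -!EFinD; congr (_%:E); ring.
by apply/seteqP; split => y /=; rewrite !in_itv/= => /andP[h1 h2];
  apply/andP; split; lra.
Qed.

Lemma integral_powR_tail (a g : R) : (0 < a)%R -> (0 < g)%R ->
  \int[mu]_(x in `[a, +oo[) (x `^ (- g - 1))%:E = (a `^ (- g) / g)%:E.
Proof.
move=> a0 g0.
rewrite (@ge0_continuous_FTC2y R _ (fun x => - (x `^ (- g) / g))%R a 0%R).
- by rewrite sub0e -EFinN opprK.
- by move=> x _; exact: powR_ge0.
- have dc : {in `[a, +oo[, forall x : R, {for x, continuous (fun x : R => x `^ (- g - 1))%R}}.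
    move=> x; rewrite in_itv/= andbT => ax.
    apply/differentiable_continuous/derivable1_diffP/derivable_powR.
    by rewrite in_itv/= andbT (lt_le_trans a0).
  by apply: continuous_in_subspaceT => x /set_mem; exact: dc.
- rewrite -[X in _ --> X]oppr0 -[in X in _ --> X](@mul0r R (g^-1)%R).
  apply: cvgN; apply: cvgM; last exact: cvg_cst.
  exact: cvg_powRN_pinfty.
- move=> x ax; apply: derivableN; apply: derivableM => //.
  by apply/derivable_powR; rewrite in_itv/= andbT (lt_trans a0).
- apply: cvg_at_right_filter.
  apply: cvgN; apply: cvgM; last exact: cvg_cst.
  have : {for a, continuous (fun x : R => x `^ (- g))%R}.
    apply/differentiable_continuous/derivable1_diffP/derivable_powR.
    by rewrite in_itv/= andbT.
  by [].
- move=> x; rewrite in_itv/= andbT => ax.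
  have x0 : (0 < x)%R := lt_trans a0 ax.
  have dx : derivable (fun x : R => x `^ (- g))%R x 1.
    by apply/derivable_powR; rewrite in_itv/= andbT.
  have D := is_derive1_powR (- g) x0.
  have -> : (fun x : R => - (x `^ (- g) / g))%R = (- g^-1) *: (fun x : R => x `^ (- g))%R.
    by apply/funext => y; rewrite [RHS]mulNr mulrC.
  rewrite derive1E; have /@derive_val -> := is_deriveZ (- g^-1) D.
  rewrite /GRing.scale/=; field; exact: lt0r_neq0.
Qed.

(** The integrand may be unbounded at 0, so the primitive is applied between
    [a / n.+1] and [a], and [n] tends to infinity. *)
Lemma integral_powR_head (a g : R) : (0 < a)%R -> (0 < g)%R ->
  \int[mu]_(x in `]0%R, a]) (x `^ (g - 1))%:E = (a `^ g / g)%:E.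
Proof.
move=> a0 g0.
pose F (n : nat) := `[(a / n.+1%:R)%R, a]%classic : set R.
have an n : (0 < a / n.+1%:R)%R by rewrite divr_gt0.
have an_le n : (a / n.+1%:R <= a)%R by rewrite ler_pdivrMr// ler_peMr// ?ler1n// ltW.
have FE : `]0%R, a]%classic = \bigcup_n F n.
  apply/seteqP; split => [x|x [n _]]; rewrite /F /= !in_itv/=.
    move=> /andP[x0 xa]; pose N := Num.truncn (a / x); exists N => //=; rewrite in_itv/= xa andbT.
    rewrite ler_pdivrMr// mulrC -ler_pdivrMr//.
    by rewrite ltW// truncnS_gt.
  by move=> /andP[ax ->]; rewrite andbT (lt_le_trans (an n)).
rewrite FE.
have : \int[mu]_(x in F n) (x `^ (g - 1))%:E @[n --> \oo] -->
    \int[mu]_(x in \bigcup_n F n) (x `^ (g - 1))%:E.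
  apply: ge0_nondecreasing_set_cvg_integral => //.
  - apply/nondecreasing_seqP => n; apply/subsetPset => x; rewrite /F/= !in_itv/=.
    move=> /andP[h ->]; rewrite andbT; apply: le_trans h.
    by rewrite ler_pM2l// lef_pV2 ?posrE// ler_nat.
  - move=> n; exact: measurable_itv.
  - move=> n; apply/measurable_EFinP; apply: measurable_funTS; exact: measurable_powR.
  - by move=> n x _; rewrite lee_fin powR_ge0.
have Fint n : (\int[mu]_(x in F n) (x `^ (g - 1))%:E =
    (a `^ g / g)%:E - ((a / n.+1%:R) `^ g / g)%:E).
  have := an_le n; rewrite le_eqVlt => /predU1P[ea|lta].
    rewrite /F ea set_itv1 integral_set1 subee//.
  have dx (x : R) : (0 < x)%R -> derivable (fun x : R => x `^ g / g)%R x 1.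
    move=> x0; apply: derivableM => //.
    by apply/derivable_powR; rewrite in_itv/= andbT.
  have dc (x : R) : (0 < x)%R -> {for x, continuous (fun x : R => x `^ g / g)%R}.
    by move=> x0; apply/differentiable_continuous/derivable1_diffP/dx.
  rewrite (@continuous_FTC2 R _ (fun x => x `^ g / g)%R)//.
  - have dc' : {in F n, forall x : R, {for x, continuous (fun x : R => x `^ (g - 1))%R}}.
      move=> x; rewrite inE /F/= in_itv/= => /andP[ax _].
      apply/differentiable_continuous/derivable1_diffP/derivable_powR.
      by rewrite in_itv/= andbT (lt_le_trans (an n)).
    by apply: continuous_in_subspaceT => x; exact: dc'.
  - split.
    + by move=> x; rewrite in_itv/= => /andP[ax _]; apply: dx; exact: lt_trans ax.
    + by apply: cvg_at_right_filter; exact: dc.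
    + by apply: cvg_at_left_filter; exact: dc.
  - move=> x; rewrite in_itv/= => /andP[ax _].
    have x0 : (0 < x)%R := lt_trans (an n) ax.
    have dx' : derivable (fun x : R => x `^ g)%R x 1.
      by apply/derivable_powR; rewrite in_itv/= andbT.
    have D := is_derive1_powR g x0.
    have -> : (fun x : R => x `^ g / g)%R = (g^-1) *: (fun x : R => x `^ g)%R.
      by apply/funext => y; rewrite [RHS]mulrC.
    rewrite derive1E; have /@derive_val -> := is_deriveZ (g^-1) D.
    rewrite /GRing.scale/=; field; exact: lt0r_neq0.
move=> h1; have h2 : (fun n : nat => (a `^ g / g)%:E - ((a / n.+1%:R) `^ g / g)%:E)
    @ \oo --> (a `^ g / g)%:E.
  rewrite -[X in _ --> X]sube0; under eq_fun do rewrite -EFinB.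
  rewrite -EFinB; apply: cvg_EFin; first exact: nearW.
  apply: cvgB; first exact: cvg_cst.
  rewrite -[X in _ --> X](@mul0r R (g^-1)%R); apply: cvgM; last exact: cvg_cst.
  have := @powR_cvg0 R g g0.
  move=> /cvg_at_rightP; apply; split => //.
  rewrite -[X in _ --> X](mulr0 a); apply: cvgM; first exact: cvg_cst.
  exact: cvg_harmonic.
by move: h1; under eq_fun do rewrite Fint; move=> /(cvg_unique (@ereal_hausdorff R) h2) ->.
Qed.

End RealTools.

(** * Layer cake formula and weak-type bounds *)

Section LayerCake.
Context {R : realType}.
Local Notation mu := (@lebesgue_measure R).
Local Open Scope ereal_scope.

Lemma measurable_ler d (T : measurableType d) (g h : T -> R) :
  measurable_fun setT g -> measurable_fun setT h ->
  measurable [set z | (g z <= h z)%R].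
Proof.
move=> mg mh; have /(_ measurableT [set true]) := measurable_fun_ler mg mh.
by rewrite setTI; apply.
Qed.

Lemma measurable_level_ge (f : R -> R) : measurable_fun setT f ->
  measurable [set z : R * R | (z.2 <= f z.1)%R].
Proof.
move=> mf; apply: measurable_ler => //.
by apply: (measurableT_comp mf).
Qed.

Lemma measurable_fun_powR d (T : measurableType d) (D : set T) (h : T -> R) (a : R) :
  measurable_fun D h -> measurable_fun D (fun x => h x `^ a)%R.
Proof. by move=> mh; apply: (measurableT_comp (f := fun y : R => (y `^ a)%R)). Qed.

Lemma measurable_fun_normr d (T : measurableType d) (D : set T) (h : T -> R) :
  measurable_fun D h -> measurable_fun D (fun x => `|h x|)%R.
Proof. exact: measurableT_comp. Qed.

Lemma measurable_fun_indic d (T : measurableType d) (D : set T) (h : T -> R) (A : set R) :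
  measurable A -> measurable_fun D h -> measurable_fun D (fun x => \1_A (h x) : R).
Proof.
move=> mA mh; by apply: (measurableT_comp (f := \1_A : R -> R)).
Qed.

Lemma measurable_natr_bool d (T : measurableType d) (b : T -> bool) :
  measurable [set x | b x] -> measurable_fun setT (fun x => (b x)%:R : R).
Proof.
move=> mb; have := @measurable_indic _ _ R setT _ mb.
by congr measurable_fun; apply/funext => z; rewrite indicE mem_setE.
Qed.

Lemma measurable_ge (f : R -> R) (s : R) : measurable_fun setT f ->
  measurable [set x | (s <= f x)%R].
Proof.
move=> mf; rewrite -[X in measurable X]setTI.
by rewrite -preimage_itvcy; apply: mf => //; exact: measurable_itv.
Qed.

Lemma tonelli_real (F : R * R -> R) : measurable_fun setT F -> (forall z, 0 <= F z)%R ->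
  \int[mu]_x \int[mu]_y (F (x, y))%:E = \int[mu]_y \int[mu]_x (F (x, y))%:E.
Proof.
move=> mF F0; apply: (@fubini_tonelli _ _ (measurableTypeR R) (measurableTypeR R) R mu mu (EFin \o F)).
  exact/measurable_EFinP.
by move=> z; rewrite lee_fin.
Qed.

Lemma measurable_ge0_integral (F : R * R -> R) : measurable_fun setT F ->
  (forall z, 0 <= F z)%R -> measurable_fun setT (fun x => \int[mu]_y (F (x, y))%:E).
Proof.
move=> mF F0.
apply: (@measurable_fun_fubini_tonelli_F _ _ (measurableTypeR R) (measurableTypeR R) R mu (EFin \o F)).
  exact/measurable_EFinP.
by move=> z; rewrite lee_fin.
Qed.

Lemma integral_head_indic (p a : R) : (0 < p)%R -> (0 <= a)%R ->
  \int[mu]_(s in `]0%R, +oo[) (p * s `^ (p - 1) * (s <= a)%R%:R)%:E = (a `^ p)%:E.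
Proof.
move=> p0 a0.
have -> : \int[mu]_(s in `]0%R, +oo[) (p * s `^ (p - 1) * (s <= a)%R%:R)%:E =
  \int[mu]_(s in `]0%R, a]) (p * s `^ (p - 1))%:E.
  rewrite integral_mkcond [RHS]integral_mkcond; apply: eq_integral => s _.
  rewrite /patch !mem_setE/= !in_itv/= andbT.
  by case: (0 < s)%R => //=; case: (s <= a)%R => /=; rewrite ?mulr1 ?mulr0.
under eq_integral do rewrite EFinM.
rewrite ge0_integralZl_EFin//; last 3 first.
- by move=> s _; rewrite lee_fin powR_ge0.
- by apply/measurable_EFinP; apply: measurable_funTS; exact: measurable_powR.
- exact: ltW.
move: a0; rewrite le_eqVlt => /predU1P[<-|a0].
  by rewrite set_itvoc0 integral_set0 mule0 powR0// gt_eqF.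
by rewrite integral_powR_head// -EFinM; congr (_%:E); field; exact: lt0r_neq0.
Qed.

Lemma measurable_level_mu (f : R -> R) : measurable_fun setT f ->
  measurable_fun setT (fun s : R => mu [set x | (s <= f x)%R]).
Proof.
move=> mf; have mA := measurable_level_ge _ mf.
have := @measurable_fun_ysection _ _ (measurableTypeR R) (measurableTypeR R) R mu _ mA.
congr measurable_fun; apply/funext => s /=; congr (mu _).
by apply/seteqP; split => x; rewrite /ysection/= inE.
Qed.

Lemma layer_cake (p : R) (f : R -> R) : (0 < p)%R -> measurable_fun setT f ->
  (forall x, 0 <= f x)%R ->
  \int[mu]_x (f x `^ p)%:E =
  \int[mu]_(s in `]0%R, +oo[) ((p * s `^ (p - 1))%:E * mu [set x | (s <= f x)%R]).
Proof.
move=> p0 mf f0.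
pose H (z : R * R) : \bar R :=
  ((p * z.2 `^ (p - 1) * (z.2 <= f z.1)%R%:R)%:E) * (\1_(`]0%R, +oo[%classic) z.2)%:E.
have mH : measurable_fun setT H.
  apply: emeasurable_funM; apply/measurable_EFinP; last first.
    have h : measurable_fun setT ((\1_(`]0%R, +oo[%classic) : R -> R) \o (snd : R * R -> R)).
      by apply: measurableT_comp => //; exact: measurable_indic.
    exact: h.
  apply: measurable_funM.
    apply: measurable_funM => //.
    have h : measurable_fun setT ((fun s : R => s `^ (p - 1))%R \o (snd : R * R -> R)).
      by apply: measurableT_comp => //; exact: measurable_powR.
    exact: h.
  by apply: measurable_natr_bool; exact: measurable_level_ge.
have H0 z : 0 <= H z.
  by rewrite mule_ge0// lee_fin ?indicE// !mulr_ge0 ?powR_ge0// ltW.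
transitivity (\int[mu]_x \int[mu]_s H (x, s)).
  apply: eq_integral => x _; rewrite -integral_head_indic//.
  rewrite integral_mkcond; apply: eq_integral => s _.
  by rewrite /H/= indicE /patch; case: ifP => sI; rewrite ?mule1 ?mule0.
rewrite fubini_tonelli// [RHS]integral_mkcond; apply: eq_integral => s _.
rewrite /patch; case: ifPn => sI; last first.
  by rewrite integral0_eq// => x _; rewrite /H/= indicE (negbTE sI) mule0.
rewrite /H/= indicE sI.
under eq_integral do rewrite mule1 EFinM.
rewrite ge0_integralZl_EFin//.
- congr (_ * _); transitivity (\int[mu]_x (\1_[set x | (s <= f x)%R] x)%:E).
    by apply: eq_integral => x _; rewrite indicE mem_setE.
  by rewrite integral_indic ?setIT//; exact: measurable_ge.
- apply/measurable_EFinP; apply: measurable_natr_bool; exact: measurable_ge.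
- by rewrite mulr_ge0 ?powR_ge0// ltW.
Qed.

(** The layer cake integral of [v `^ a] is cut at height 1: below, the weak bound
    with the smaller exponent [q0] makes it converge at 0; above, the one with
    [q1] makes it converge at infinity. *)
Lemma strong_of_weak (v : R -> R) (m : \bar R) (C a q0 q1 : R) :
  measurable_fun setT v -> (forall x, 0 <= v x)%R -> 0 <= m -> (0 <= C)%R ->
  (0 < a)%R -> (q0 < a < q1)%R ->
  (forall l : R, (0 < l <= 1)%R ->
     mu [set x | (l <= v x)%R] <= (C * l `^ (- q0))%:E * m) ->
  (forall l : R, (1 <= l)%R ->
     mu [set x | (l <= v x)%R] <= (C * l `^ (- q1))%:E * m) ->
  \int[mu]_x (v x `^ a)%:E <= (a * C * ((a - q0)^-1 + (q1 - a)^-1))%:E * m.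
Proof.
move=> mv v0 m0 C0 a0 /andP[q0a aq1] h0 h1.
rewrite layer_cake//.
have -> : `]0%R, +oo[%classic = `]0%R, 1%R]%classic `|` `]1%R, +oo[%classic :> set R.
  by rewrite -itv_bndbnd_setU// bnd_simp.
rewrite ge0_integral_setU//=; last 3 first.
- apply: emeasurable_funM.
    apply/measurable_EFinP; apply: measurable_funM => //.
    by apply: measurable_funTS; exact: measurable_powR.
  by apply: measurable_funTS; exact: measurable_level_mu.
- by move=> s _; rewrite mule_ge0// lee_fin mulr_ge0 ?powR_ge0// ltW.
- apply: lt_disjoint => x y; rewrite !in_itv/= => /andP[_ x1]; rewrite andbT.
  exact: le_lt_trans.
have mW (D : set R) (q : R) : measurable D -> measurable_fun D (fun s : R => (a * C * s `^ (a - q - 1))%:E * m).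
  move=> mD; apply: emeasurable_funM => //; apply/measurable_EFinP.
  apply: measurable_funM => //; apply: measurable_funTS; exact: measurable_powR.
have mL (D : set R) : measurable D -> measurable_fun D
   (fun s : R => (a * s `^ (a - 1))%:E * mu [set x | (s <= v x)%R]).
  move=> mD; apply: emeasurable_funM.
    apply/measurable_EFinP; apply: measurable_funM => //.
    by apply: measurable_funTS; exact: measurable_powR.
  by apply: measurable_funTS; exact: measurable_level_mu.
have wl0 (D : set R) (s : R) : D s -> 0 <= (a * s `^ (a - 1))%:E * mu [set x | (s <= v x)%R].
  by move=> _; rewrite mule_ge0// lee_fin mulr_ge0 ?powR_ge0// ltW.
have W0 (D : set R) (q s : R) : D s -> 0 <= (a * C * s `^ (a - q - 1))%:E * m.
  by move=> _; rewrite mule_ge0// lee_fin !mulr_ge0 ?powR_ge0// ltW.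
have stp (q s : R) : (0 < s)%R -> mu [set x | (s <= v x)%R] <= (C * s `^ (- q))%:E * m ->
   (a * s `^ (a - 1))%:E * mu [set x | (s <= v x)%R] <= (a * C * s `^ (a - q - 1))%:E * m.
  move=> s0 hs; apply: le_trans.
    apply: lee_wpmul2l; last exact: hs.
    by rewrite lee_fin mulr_ge0 ?powR_ge0// ltW.
  rewrite muleA -EFinM.
  have -> : (a * s `^ (a - 1) * (C * s `^ (- q)) = a * C * s `^ (a - q - 1))%R.
    have -> : (a - q - 1 = (a - 1) + (- q))%R by ring.
    rewrite [(s `^ (_ + - q))%R]powRD; first by ring.
    by rewrite (gt_eqF s0) implybT.
  exact: lexx.
have fin (D : set R) (q k : R) : measurable D ->
   \int[mu]_(s in D) (s `^ (a - q - 1))%:E = k%:E ->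
   \int[mu]_(s in D) ((a * C * s `^ (a - q - 1))%:E * m) = (a * C * k)%:E * m.
  move=> mD hk; under eq_integral do rewrite muleC.
  rewrite ge0_integralZl//; last 2 first.
  - apply/measurable_EFinP; apply: measurable_funM => //; apply: measurable_funTS.
    exact: measurable_powR.
  - by move=> s _; rewrite lee_fin !mulr_ge0 ?powR_ge0// ltW.
  under eq_integral do rewrite EFinM.
  rewrite ge0_integralZl_EFin ?hk//.
  - by rewrite muleC -EFinM.
  - by move=> s _; rewrite lee_fin powR_ge0.
  - by apply/measurable_EFinP/measurable_funTS; exact: measurable_powR.
  - by rewrite mulr_ge0// ltW.
have -> : (a * C * ((a - q0)^-1 + (q1 - a)^-1))%:E * m =
    (a * C * (a - q0)^-1)%:E * m + (a * C * (q1 - a)^-1)%:E * m.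
  rewrite -ge0_muleDl -?EFinD -?mulrDr// lee_fin !mulr_ge0 ?invr_ge0 ?subr_ge0// ltW//.
apply: leeD.
- rewrite -(fin `]0%R, 1%R]%classic q0)//; last first.
    by rewrite integral_powR_head ?subr_gt0// powR1 div1r.
  apply: ge0_le_integral => //.
  - exact: wl0.
  - exact: mL.
  - exact: mW.
  - by move=> s /=; rewrite in_itv/= => s01; apply: stp; [case/andP: s01|exact: h0].
- rewrite -(fin `]1%R, +oo[%classic q1)//; last first.
    have -> : (a - q1 - 1 = - (q1 - a) - 1)%R by ring.
    rewrite integral_itv_obnd_cbnd; last first.
      by apply/measurable_EFinP/measurable_funTS; exact: measurable_powR.
    by rewrite integral_powR_tail ?subr_gt0// powR1 div1r.
  apply: ge0_le_integral => //.
  - exact: wl0.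
  - exact: mL.
  - exact: mW.
  - move=> s /=; rewrite in_itv/= andbT => s1; apply: stp; first exact: lt_trans s1.
    by apply: h1; exact: ltW.
Qed.

End LayerCake.

(** * From sets to functions: a Hardy inequality with two exponents *)

Section Interpolation.
Context {R : realType}.
Local Notation mu := (@lebesgue_measure R).
Local Open Scope ereal_scope.

Lemma powRV (s a : R) : (0 <= s)%R -> (s^-1 `^ a = (s `^ a)^-1)%R.
Proof. by move=> s0; rewrite -powR_inv1// -powRrM mulN1r powRN. Qed.

(** If [u] exceeds [(K / s) `^ g], then [(K / s) `^ (p - 1) <= u `^ ((p - 1) / g)],
    and multiplying [u] by the quotient of the two sides only increases it. *)
Lemma hardy_pointwise (p K s u g : R) : (1 < p)%R -> (0 < K)%R -> (0 < s)%R ->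
  (0 <= u)%R -> (0 < g)%R ->
  (u <= K `^ (1 - p) * (s `^ (p - 1) * u `^ (1 + (p - 1) / g)) + (K / s) `^ g)%R.
Proof.
move=> p1 K0 s0 u0 g0; have Ks : (0 < K / s)%R by rewrite divr_gt0.
have [ule|ult] := leP u ((K / s) `^ g)%R.
  by apply: le_trans ule _; rewrite lerDr !mulr_ge0 ?powR_ge0.
have u1 : (0 < u)%R by apply: le_lt_trans ult; exact: powR_ge0.
have p10 : (0 < p - 1)%R by rewrite subr_gt0.
have h : ((K / s) `^ (p - 1) <= u `^ ((p - 1) / g))%R.
  have -> : ((K / s) `^ (p - 1) = ((K / s) `^ g) `^ ((p - 1) / g))%R.
    by rewrite -powRrM; congr (_ `^ _)%R; field; exact: lt0r_neq0.
  apply: ge0_ler_powR; rewrite ?nnegrE ?powR_ge0 ?ltW//.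
  by rewrite divr_gt0.
apply: (@le_trans _ _ (K `^ (1 - p) * (s `^ (p - 1) * u `^ (1 + (p - 1) / g))))%R;
  last by rewrite lerDl powR_ge0.
rewrite [(u `^ (1 + _))%R]powRD; last by rewrite (gt_eqF u1) implybT.
rewrite powRr1 ?(ltW u1)//.
have -> : (K `^ (1 - p) * (s `^ (p - 1) * (u * u `^ ((p - 1) / g))) =
  u * (((K / s) `^ (p - 1))^-1 * u `^ ((p - 1) / g)))%R.
  have -> : (1 - p = - (p - 1))%R by rewrite opprB.
  rewrite (powRM (p - 1) (ltW K0)) ?invr_ge0 ?(ltW s0)//.
  rewrite powRN powRV ?(ltW s0)// invfM invrK; ring.
rewrite -{1}[u]mulr1 ler_pM2l// mulrC ler_pdivlMr ?mul1r// powR_gt0//.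
Qed.

(** The exponents [(p + 1) / 2] and [2 * p - 1] lie on both sides of [p]; they are
    those of [hardy_pointwise] for [g = 2] and [g = 2^-1]. *)
Definition hardy_weight (p : R) (u : R -> R) (s : R) : R :=
  (s `^ (p - 1) * (u s `^ ((p + 1) / 2) + u s `^ (2 * p - 1)))%R.

Lemma measurable_hardy_weight p (u : R -> R) : measurable_fun setT u ->
  measurable_fun setT (hardy_weight p u).
Proof.
move=> mu_; apply: measurable_funM; first exact: measurable_powR.
by apply: measurable_funD; exact: measurable_fun_powR.
Qed.

(** In [hardy_pointwise] the term [(K / s) `^ g] is integrable at 0 for [g = 2^-1]
    and at infinity for [g = 2]. With each choice on its side of [K], the total
    integral of that term is [3 * K]. *)
Lemma hardy_scale (p K : R) (u : R -> R) : (1 < p)%R -> (0 < K)%R ->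
  measurable_fun setT u -> (forall s, 0 <= u s)%R ->
  \int[mu]_(s in `]0%R, +oo[) (u s)%:E <=
  (K `^ (1 - p))%:E * \int[mu]_(s in `]0%R, +oo[) (hardy_weight p u s)%:E + (3 * K)%:E.
Proof.
move=> p1 K0 mu_ u0.
pose r (s : R) : R := (if s <= K then K `^ 2^-1 * s `^ (2^-1 - 1) else K ^+ 2 * s `^ (- 1 - 1))%R.
have mr : measurable_fun setT r.
  apply: measurable_fun_ifT.
  - exact: measurable_fun_ler.
  - by apply: measurable_funM => //; exact: measurable_powR.
  - by apply: measurable_funM => //; exact: measurable_powR.
have r0 s : (0 <= r s)%R.
  by rewrite /r; case: ifP => _; rewrite mulr_ge0 ?powR_ge0 ?exprn_ge0 ?ltW.
have W0 s : (0 <= hardy_weight p u s)%R by rewrite mulr_ge0 ?addr_ge0 ?powR_ge0.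
have mW := measurable_hardy_weight p u mu_.
have Dm : measurable (`]0%R, +oo[%classic : set R) by exact: measurable_itv.
have ri : \int[mu]_(s in `]0%R, +oo[) (r s)%:E = (3 * K)%:E.
  have -> : `]0%R, +oo[%classic = `]0%R, K]%classic `|` `]K, +oo[%classic :> set R.
    by rewrite -itv_bndbnd_setU// bnd_simp// ltW.
  rewrite ge0_integral_setU//=; last 3 first.
  - by apply: measurable_funTS; exact/measurable_EFinP.
  - by move=> s _; rewrite lee_fin.
  - apply: lt_disjoint => x y; rewrite !in_itv/= => /andP[_ x1]; rewrite andbT.
    exact: le_lt_trans.
  have -> : \int[mu]_(s in `]0%R, K]) (r s)%:E = (2 * K)%:E.
    transitivity (\int[mu]_(s in `]0%R, K]) ((K `^ 2^-1)%:E * (s `^ (2^-1 - 1))%:E)).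
      apply: eq_integral => s; rewrite inE/= in_itv/= => /andP[_ sK].
      by rewrite /r sK EFinM.
    rewrite ge0_integralZl_EFin//; last 3 first.
    - by move=> s _; rewrite lee_fin powR_ge0.
    - by apply/measurable_EFinP/measurable_funTS; exact: measurable_powR.
    - exact: powR_ge0.
    rewrite integral_powR_head ?invr_gt0// -EFinM mulrA -powRD; last by rewrite (gt_eqF K0) implybT.
    rewrite (_ : (2^-1 + 2^-1 = 1 :> R)%R); last by field.
    by rewrite powRr1 ?ltW// invrK mulrC.
  have -> : \int[mu]_(s in `]K, +oo[) (r s)%:E = K%:E.
    transitivity (\int[mu]_(s in `]K, +oo[) ((K ^+ 2)%:E * (s `^ (- 1 - 1))%:E)).
      apply: eq_integral => s; rewrite inE/= in_itv/= andbT => sK.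
      by rewrite /r leNgt sK/= EFinM.
    rewrite ge0_integralZl_EFin//; last 3 first.
    - by move=> s _; rewrite lee_fin powR_ge0.
    - by apply/measurable_EFinP/measurable_funTS; exact: measurable_powR.
    - by rewrite exprn_ge0// ltW.
    rewrite integral_itv_obnd_cbnd; last first.
      by apply/measurable_EFinP/measurable_funTS; exact: measurable_powR.
    rewrite integral_powR_tail// -EFinM powR_inv1 ?ltW//; congr (_%:E).
    by field; exact: lt0r_neq0.
  by rewrite -EFinD; congr (_%:E); ring.
have -> : (K `^ (1 - p))%:E * \int[mu]_(s in `]0%R, +oo[) (hardy_weight p u s)%:E + (3 * K)%:E =
   \int[mu]_(s in `]0%R, +oo[) ((K `^ (1 - p) * hardy_weight p u s)%:E + (r s)%:E).
  rewrite ge0_integralD//=; last 4 first.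
  - by move=> s _; rewrite lee_fin mulr_ge0 ?powR_ge0.
  - by apply/measurable_EFinP/measurable_funTS/measurable_funM.
  - by move=> s _; rewrite lee_fin.
  - by apply/measurable_EFinP/measurable_funTS.
  rewrite ri; congr (_ + _); under [RHS]eq_integral do rewrite EFinM.
  rewrite ge0_integralZl_EFin// ?powR_ge0//.
  - by move=> s _; rewrite lee_fin.
  - by apply/measurable_EFinP/measurable_funTS.
apply: ge0_le_integral => //.
- by move=> s _; rewrite lee_fin.
- by apply/measurable_EFinP/measurable_funTS.
- apply/measurable_EFinP/measurable_funTS; apply: measurable_funD => //.
  exact: measurable_funM.
move=> s /=; rewrite in_itv/= andbT => s0; rewrite -EFinD lee_fin.
have hr : (r s = (K / s) `^ (if s <= K then 2^-1 else 2))%R.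
  rewrite /r; case: ifP => _.
    rewrite (powRM _ (ltW K0)) ?invr_ge0 ?(ltW s0)//; congr (_ * _)%R.
    rewrite powRV ?(ltW s0)// -powRN; congr (_ `^ _)%R.
    by field.
  rewrite powR_mulrn ?divr_ge0 ?(ltW K0) ?(ltW s0)// expr_div_n; congr (_ * _)%R.
  have -> : (- 1 - 1 = - (2%:R) :> R)%R by ring.
  by rewrite powR_invn// ltW.
rewrite hr.
have h := hardy_pointwise p K s (u s) (if s <= K then 2^-1 else 2)%R p1 K0 s0 (u0 s).
apply: le_trans (h _) _; first by case: ifP.
rewrite lerD2r ler_wpM2l ?powR_ge0// /hardy_weight ler_wpM2l ?powR_ge0//.
case: ifP => _.
  have -> : (1 + (p - 1) / 2^-1 = 2 * p - 1)%R by field.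
  by rewrite lerDr powR_ge0.
have -> : (1 + (p - 1) / 2 = (p + 1) / 2)%R by field.
by rewrite lerDl powR_ge0.
Qed.

(** For [W] the integral on the right, [K = W `^ p^-1] balances the two terms of
    [hardy_scale]. *)
Lemma hardy_two_exponents (p : R) (u : R -> R) : (1 < p)%R ->
  measurable_fun setT u -> (forall s, 0 <= u s)%R ->
  (\int[mu]_(s in `]0%R, +oo[) (u s)%:E) `^ p <=
  (4 `^ p)%:E * \int[mu]_(s in `]0%R, +oo[) (hardy_weight p u s)%:E.
Proof.
move=> p1 mu_ u0.
have p0 : (0 < p)%R by apply: lt_trans p1.
have hs K := hardy_scale p K u p1 ^~ mu_.
move: hs; set F := integral _ _ _; set W := integral _ _ _ => hs.
have W0 : 0 <= W.
  by apply: integral_ge0 => s _; rewrite lee_fin mulr_ge0 ?addr_ge0 ?powR_ge0.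
have F0 : 0 <= F by apply: integral_ge0 => s _; rewrite lee_fin.
have c0 : (0 < 4 `^ p :> R)%R by rewrite powR_gt0.
have [->|Wy] := eqVneq W +oo; first by rewrite gt0_muley ?leey.
have Wf : W \is a fin_num by rewrite ge0_fin_numE// ltey.
rewrite -(fineK Wf) in hs *; set w := fine W in hs *.
have w0 : (0 <= w)%R by exact: fine_ge0.
have Ff : F \is a fin_num.
  rewrite ge0_fin_numE//; apply: le_lt_trans (hs 1%R ltr01 u0) _.
  by rewrite -EFinM -EFinD ltry.
rewrite -(fineK Ff) in hs *; set f := fine F in hs *.
have f0 : (0 <= f)%R by exact: fine_ge0.
have {}hs K : (0 < K)%R -> (f <= K `^ (1 - p) * w + 3 * K)%R.
  by move=> K0; have := hs K K0 u0; rewrite -EFinM -EFinD lee_fin.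
rewrite poweR_EFin -EFinM lee_fin.
move: w0; rewrite le_eqVlt => /predU1P[w0|w0].
  have -> : f = 0%R.
    apply/eqP; rewrite eq_le f0 andbT; apply/ler_addgt0Pr => e e0; rewrite add0r.
    have := hs (e / 3)%R; rewrite -w0 mulr0 add0r.
    by rewrite mulrCA mulfV// mulr1; apply; rewrite divr_gt0.
  by rewrite powR0 ?gt_eqF// -w0 mulr0.
have wp : (0 < w `^ p^-1)%R by rewrite powR_gt0.
have := hs _ wp.
rewrite -powRrM.
have -> : (w `^ (p^-1 * (1 - p)) * w = w `^ p^-1)%R.
  rewrite -{2}(powRr1 (ltW w0)) -powRD; last by rewrite (gt_eqF w0) implybT.
  by congr (_ `^ _)%R; field; exact: lt0r_neq0.
have -> : (w `^ p^-1 + 3 * w `^ p^-1 = 4 * w `^ p^-1)%R by ring.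
move=> h; have := ge0_ler_powR (ltW p0) f0 _ h.
rewrite nnegrE (powRM p) ?powR_ge0// -(powRrM w) mulVf ?gt_eqF// powRr1 ?(ltW w0)//.
by apply; rewrite mulr_ge0 ?powR_ge0.
Qed.

(** This takes the place of an interpolation theorem for an operator that is
    controlled on sets: [u s] stands for the operator applied to the level set
    [f >= s], and the level sets add up to [f]. The powers of [u s] are summed by
    [hardy_two_exponents], and the measures of the level sets by [layer_cake]. *)
Lemma interpolation (p C : R) (f G : R -> R) (u : R -> R -> R) : (1 < p)%R ->
  measurable_fun setT G -> (forall x, 0 <= G x)%R ->
  (forall x, (G x)%:E <= \int[mu]_(s in `]0%R, +oo[) (u s x)%:E) ->
  (0 <= C)%R -> measurable_fun setT f -> (forall x, 0 <= f x)%R ->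
  measurable_fun setT (fun z : R * R => u z.2 z.1) ->
  (forall s x, 0 <= u s x)%R ->
  (forall s a : R, (0 < s)%R -> (a = (p + 1) / 2 \/ a = 2 * p - 1)%R ->
    \int[mu]_x (u s x `^ a)%:E <= C%:E * mu [set x | (s <= f x)%R]) ->
  \int[mu]_x (G x `^ p)%:E <= (4 `^ p * (2 * C / p))%:E * \int[mu]_x (f x `^ p)%:E.
Proof.
move=> p1 mG G0 GF C0 mf f0 mu_ u0 hu.
have p0 : (0 < p)%R by apply: lt_trans p1.
have mux x : measurable_fun setT (fun s => u s x).
  have h : measurable_fun setT (pair x : R -> (R * R)%type) by exact: pair1_measurable.
  exact: (measurableT_comp mu_ h).
have mus s : measurable_fun setT (u s).
  have h : measurable_fun setT (pair^~ s : R -> (R * R)%type) by exact: pair2_measurable.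
  exact: (measurableT_comp mu_ h).
pose V (z : R * R) : R := (hardy_weight p (u ^~ z.1) z.2 * \1_(`]0%R, +oo[%classic) z.2)%R.
have mV : measurable_fun setT V.
  apply: measurable_funM; last first.
    by apply: measurable_fun_indic => //; exact: measurable_snd.
  apply: measurable_funM.
    by apply: measurable_fun_powR; exact: measurable_snd.
  apply: measurable_funD.
    exact: measurable_fun_powR.
  exact: measurable_fun_powR.
have w0 x s : (0 <= hardy_weight p (u ^~ x) s)%R.
  by rewrite mulr_ge0 ?addr_ge0 ?powR_ge0.
have V0 z : (0 <= V z)%R by rewrite mulr_ge0// indicE.
have VE x : \int[mu]_(s in `]0%R, +oo[) (hardy_weight p (u ^~ x) s)%:E = \int[mu]_s (V (x, s))%:E.
  rewrite integral_mkcond; apply: eq_integral => s _.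
  by rewrite /V/= indicE /patch; case: ifP => sI; rewrite ?mulr1 ?mulr0.
have mVE : measurable_fun setT (EFin \o V) by exact/measurable_EFinP.
have mVx := measurable_ge0_integral V mV V0.
apply: (@le_trans _ _ (\int[mu]_x ((4 `^ p)%:E * \int[mu]_s (V (x, s))%:E))).
  apply: ge0_le_integral => //.
  - by move=> x _; rewrite lee_fin powR_ge0.
  - by apply/measurable_EFinP; exact: measurable_fun_powR.
  - exact: emeasurable_funM.
  - move=> x _; rewrite -VE; apply: le_trans (hardy_two_exponents _ _ p1 (mux x) _) => //.
    rewrite -poweR_EFin; apply: gt0_ler_poweR (GF x); first exact: ltW.
    + by rewrite in_itv/= leey andbT lee_fin.
    + by rewrite in_itv/= leey andbT; apply: integral_ge0 => s _; rewrite lee_fin.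
rewrite ge0_integralZl_EFin ?powR_ge0//; last first.
  by move=> x _; apply: integral_ge0 => s _; rewrite lee_fin.
rewrite EFinM -muleA lee_wpmul2l ?lee_fin ?powR_ge0//.
rewrite (tonelli_real V mV V0).
have -> : (2 * C / p)%:E * \int[mu]_x (f x `^ p)%:E =
  \int[mu]_(s in `]0%R, +oo[) ((2 * C * s `^ (p - 1))%:E * mu [set x | (s <= f x)%R]).
  rewrite layer_cake// -ge0_integralZl_EFin//.
  - apply: eq_integral => s _; rewrite muleA -EFinM; congr (_%:E * _).
    by field; exact: lt0r_neq0.
  - by move=> s _; rewrite mule_ge0// lee_fin mulr_ge0 ?powR_ge0// ltW.
  - apply: emeasurable_funM; last by apply: measurable_funTS; exact: measurable_level_mu.
    apply/measurable_EFinP/measurable_funM => //; apply: measurable_funTS.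
    exact: measurable_powR.
  - by apply: divr_ge0; [exact: mulr_ge0|exact: ltW].
rewrite [leRHS]integral_mkcond; apply: ge0_le_integral => //.
- by move=> s _; apply: integral_ge0 => x _; rewrite lee_fin.
- exact: (@measurable_fun_fubini_tonelli_G _ _ (measurableTypeR R) (measurableTypeR R) R mu (EFin \o V)).
- apply/(measurable_restrictT _ _).1 => //; apply: measurable_funTS.
  apply: emeasurable_funM; last exact: measurable_level_mu.
  apply/measurable_EFinP/measurable_funM => //; exact: measurable_powR.
move=> s _; rewrite /patch; case: ifPn => sI; last first.
  by rewrite integral0_eq// => x _; rewrite /V/= indicE (negbTE sI) mulr0.
have s0 : (0 < s)%R by move: sI; rewrite inE/= in_itv/= andbT.
rewrite /V/= indicE sI /hardy_weight.
under eq_integral do rewrite mulr1 EFinM.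
have mua (a : R) : measurable_fun setT (fun x => (u s x `^ a)%:E).
  by apply/measurable_EFinP; exact: measurable_fun_powR.
rewrite ge0_integralZl_EFin ?powR_ge0//; last 2 first.
- by move=> x _; rewrite lee_fin addr_ge0 ?powR_ge0.
- have h : measurable_fun [set: R] (fun x => u s x `^ ((p + 1) / 2) + u s x `^ (2 * p - 1))%R.
    by apply: measurable_funD; apply: measurable_fun_powR; exact: mus.
  exact/measurable_EFinP.
under eq_integral do rewrite EFinD.
rewrite ge0_integralD//; try by move=> x _; rewrite lee_fin powR_ge0.
all: try exact: mua.
have -> : (2 * C * s `^ (p - 1))%:E * mu [set x | (s <= f x)%R] =
  (s `^ (p - 1))%:E * (C%:E * mu [set x | (s <= f x)%R] + C%:E * mu [set x | (s <= f x)%R]).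
  rewrite -ge0_muleDl ?lee_fin// muleA -EFinD -EFinM; congr (_%:E * _); ring.
rewrite lee_wpmul2l ?lee_fin ?powR_ge0// leeD//; apply: hu => //; [by left|by right].
Qed.

End Interpolation.

(** * The Poisson kernel and the maximal function *)

Section Poisson.
Context {R : realType}.
Local Notation mu := (@lebesgue_measure R).
Local Open Scope ereal_scope.

Definition poisson (e s : R) : R := (e / (s ^+ 2 + e ^+ 2))%R.

Lemma poisson_ge0 (e s : R) : (0 < e)%R -> (0 <= poisson e s)%R.
Proof. by move=> e0; rewrite divr_ge0 ?addr_ge0 ?sqr_ge0// ltW. Qed.

Lemma sqrD_gt0 (e s : R) : (0 < e)%R -> (0 < s ^+ 2 + e ^+ 2)%R.
Proof. by move=> e0; rewrite ltr_wpDl ?sqr_ge0 ?exprn_gt0. Qed.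

Lemma measurable_poisson (e : R) : measurable_fun setT (poisson e).
Proof.
by apply: measurable_funM => //; apply: measurable_funV; apply: measurable_funD.
Qed.

Lemma is_derive_atan_div (e s : R) : (0 < e)%R ->
  is_derive s 1%R (fun r => atan (r / e))%R (poisson e s).
Proof.
move=> e0.
pose g := (fun r : R => r / e)%R.
have h1 : is_derive (g s) 1%R (@atan R) ((1 + (s / e) ^+ 2)^-1)%R.
  exact: is_derive1_atan.
have h2 : is_derive s 1%R g (e^-1)%R.
  by apply: is_derive_eq; rewrite /GRing.scale/=; ring.
have h := is_derive1_comp h1 h2.
have <- : ((1 + (s / e) ^+ 2)^-1 * e^-1 = poisson e s)%R.
  rewrite /poisson; field; rewrite (gt_eqF e0)/= andbT.
  by rewrite gt_eqF// sqrD_gt0.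
exact: h.
Qed.

Lemma continuous_atan_div (e : R) : (0 < e)%R -> continuous (fun r : R => atan (r / e))%R.
Proof.
move=> e0 x; apply/differentiable_continuous/derivable1_diffP.
by have [] := is_derive_atan_div e x e0.
Qed.

Lemma continuous_poisson (e : R) : (0 < e)%R -> continuous (poisson e).
Proof.
move=> e0 x; apply: cvgM; first exact: cvg_cst.
apply: cvgV; first by rewrite gt_eqF// sqrD_gt0.
by apply: cvgD; [exact: exprn_continuous|exact: cvg_cst].
Qed.

Lemma integral_poisson_tail (e : R) : (0 < e)%R ->
  \int[mu]_(r in `[0%R, +oo[) (poisson e r)%:E = (pi / 2)%:E.
Proof.
move=> e0.
rewrite (@ge0_continuous_FTC2y R _ (fun r => atan (r / e))%R 0 (pi / 2)%R).
- by rewrite mul0r atan0 sube0.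
- by move=> x _; exact: poisson_ge0.
- by apply: continuous_subspaceT; exact: continuous_poisson.
- have h : (r / e)%R @[r --> +oo%R] --> +oo%R.
    by apply: gt0_cvgMly; [rewrite invr_gt0|exact: cvg_id].
  exact: (cvg_comp _ _ h (@cvgy_atan R)).
- by move=> x _; have [] := is_derive_atan_div e x e0.
- by apply: cvg_at_right_filter; exact: continuous_atan_div.
- move=> x _; rewrite derive1E; by have [_ ->] := is_derive_atan_div e x e0.
Qed.

(** Minus the derivative of the Poisson kernel. The kernel at [s] is the integral of
    this density over the radii [r >= `|s|], so it is an average of indicators of
    centred intervals. *)
Definition layer_density (e r : R) : R := (2 * r * e / (r ^+ 2 + e ^+ 2) ^+ 2)%R.

Lemma layer_density_ge0 (e r : R) : (0 < e)%R -> (0 <= r)%R -> (0 <= layer_density e r)%R.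
Proof.
by move=> e0 r0; rewrite divr_ge0 ?exprn_ge0 ?addr_ge0 ?sqr_ge0// !mulr_ge0// ltW.
Qed.

Lemma measurable_layer_density (e : R) : measurable_fun setT (layer_density e).
Proof.
apply: measurable_funM; first by do !apply: measurable_funM => //.
by apply: measurable_funV; apply: measurable_funX; apply: measurable_funD.
Qed.

Lemma is_derive_poisson (e s : R) : (0 < e)%R ->
  is_derive s 1%R (fun r => - poisson e r)%R (layer_density e s).
Proof.
move=> e0.
pose q := (fun r : R => r ^+ 2 + e ^+ 2)%R.
have h2 : is_derive s 1%R q (2 * s)%R.
  apply: is_derive_eq; rewrite /GRing.scale/=; ring.
have nz : (q s != 0)%R by rewrite gt_eqF// sqrD_gt0.
have h3 := is_deriveV nz h2.
have h4 := is_deriveZ (- e)%R h3.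
have -> : (fun r => - poisson e r)%R = (- e)%R *: (fun r : R => (q r)^-1)%R.
  by apply/funext => r; rewrite /poisson -mulNr.
apply: (is_derive_eq h4).
rewrite /layer_density /GRing.scale/=; move: nz; rewrite /q => nz; field.
exact: nz.
Qed.

Lemma integral_layer_density (e t : R) : (0 < e)%R -> (0 <= t)%R ->
  \int[mu]_(r in `[t, +oo[) (layer_density e r)%:E = (poisson e t)%:E.
Proof.
move=> e0 t0.
have dp x : derivable (fun r => - poisson e r)%R x 1.
  by have [] := is_derive_poisson e x e0.
rewrite (@ge0_continuous_FTC2y R _ (fun r => - poisson e r)%R t 0%R).
- by rewrite sub0e -EFinN opprK.
- by move=> x tx; rewrite layer_density_ge0// (le_trans t0).
- apply: continuous_subspaceT => x; apply: cvgM.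
    by apply: cvgM; [apply: cvgM => //; exact: cvg_cst|exact: cvg_cst].
  apply: cvgV; first by rewrite gt_eqF// exprn_gt0// sqrD_gt0.
  have h : (x0 ^+ 2 + e ^+ 2)%R @[x0 --> x] --> (x ^+ 2 + e ^+ 2)%R.
    by apply: cvgD; [exact: exprn_continuous|exact: cvg_cst].
  exact: (cvg_comp _ _ h (@exprn_continuous R 2 _)).
- rewrite -oppr0; apply: cvgN; apply/cvgrPdist_le => d d0.
  near=> x; rewrite sub0r normrN ger0_norm ?poisson_ge0//.
  have x1 : (1 <= x)%R by near: x; apply: nbhs_pinfty_ge; rewrite num_real.
  have xd : (e / d <= x)%R by near: x; apply: nbhs_pinfty_ge; rewrite num_real.
  rewrite /poisson ler_pdivrMr ?sqrD_gt0// mulrC -ler_pdivrMr//.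
  apply: (le_trans xd); apply: (@le_trans _ _ (x ^+ 2)%R).
    by rewrite expr2 ler_peMr// (le_trans ler01).
  by rewrite lerDl sqr_ge0.
- by move=> x _; exact: dp.
- apply: cvg_at_right_filter; have := dp t.
  by move=> /derivable1_diffP/differentiable_continuous.
- move=> x _; rewrite derive1E; by have [_ ->] := is_derive_poisson e x e0.
Unshelve. all: by end_near. Qed.

Lemma integral_ball_le_maximal (h : R -> R) (x r k : R) : (0 < r)%R ->
  HL_maximal h x <= k%:E ->
  \int[mu]_(t in ball x r) `|h t|%:E <= (2 * r * k)%:E.
Proof.
move=> r0 hk.
have : iavg h (ball x r) <= k%:E.
  apply: le_trans hk; apply: ereal_sup_ubound; exists r => //=.
  by rewrite in_itv/= andbT.
rewrite /iavg (lebesgue_measure_ball _ (ltW r0)).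
have r2 : (0 < r *+ 2)%R by rewrite mulrn_wgt0.
rewrite inver (gt_eqF r2) lee_pdivrMl// => /le_trans; apply.
by rewrite -EFinM -(mulr_natl r 2).
Qed.

(** As the kernel is an average of indicators of intervals, the Poisson integral is
    bounded by [k] times the integral of [2 * r * layer_density e r]. That function
    is at most [4 * poisson e r], and half of the Poisson kernel has mass [pi / 2]. *)
Lemma poisson_le_maximal (h : R -> R) (e x k : R) : (0 < e)%R ->
  measurable_fun setT h -> (0 <= k)%R -> HL_maximal h x <= k%:E ->
  \int[mu]_t (`|h t| * poisson e (x - t))%:E <= (2 * pi * k)%:E.
Proof.
move=> e0 mh k0 hk.
pose H (z : R * R) : \bar R :=
  ((`|h z.1| * layer_density e z.2 * (`|x - z.1| <= z.2)%R%:R)%:E)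
   * (\1_(`[0%R, +oo[%classic) z.2)%:E.
have mxt : measurable_fun setT (fun z : R * R => `|x - z.1|)%R.
  apply: measurable_fun_normr.
  by apply: measurable_funB => //; exact: measurable_fst.
have mH : measurable_fun setT H.
  apply: emeasurable_funM; apply/measurable_EFinP; last first.
    by apply: measurable_fun_indic => //; exact: measurable_snd.
  apply: measurable_funM; last first.
    by apply: measurable_natr_bool; apply: measurable_ler => //; exact: measurable_snd.
  apply: measurable_funM.
    apply: measurable_fun_normr.
    exact: (measurableT_comp mh measurable_fst).
  exact: (measurableT_comp (measurable_layer_density e) measurable_snd).
have H0 z : 0 <= H z.
  rewrite /H indicE; case: (boolP (z.2 \in _)) => [|_]; last by rewrite mule0.
  rewrite inE/= in_itv/= andbT => z0.
  rewrite mule1 lee_fin; apply: mulr_ge0 => //; apply: mulr_ge0 => //.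
  exact: layer_density_ge0.
have -> : \int[mu]_t (`|h t| * poisson e (x - t))%:E = \int[mu]_t \int[mu]_r H (t, r).
  apply: eq_integral => t _.
  have -> : (`|h t| * poisson e (x - t))%:E = `|h t|%:E * (poisson e `|x - t|)%:E.
    by rewrite EFinM /poisson real_normK// num_real.
  rewrite -integral_layer_density// -ge0_integralZl_EFin//; last 2 first.
  - move=> r; rewrite /= in_itv/= andbT => tr.
    by rewrite lee_fin layer_density_ge0// (le_trans _ tr).
  - by apply/measurable_EFinP/measurable_funTS; exact: measurable_layer_density.
  rewrite integral_mkcond; apply: eq_integral => r _.
  rewrite /H /= /patch indicE !mem_setE /= !in_itv/= !andbT.
  case: (leP `|x - t|%R r) => xtr; last by rewrite mulr0 mul0e.
  by rewrite (le_trans _ xtr)// mulr1 mule1 EFinM.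
rewrite (@fubini_tonelli _ _ (measurableTypeR R) (measurableTypeR R) R mu mu H)//.
apply: (@le_trans _ _ (\int[mu]_(r in `[0%R, +oo[) ((4 * k)%:E * (poisson e r)%:E))).
  rewrite [leRHS]integral_mkcond; apply: ge0_le_integral => //.
  - by move=> r _; exact: integral_ge0.
  - exact: (@measurable_fun_fubini_tonelli_G _ _ (measurableTypeR R) (measurableTypeR R) R mu H).
  - apply/(measurable_restrictT _ _).1 => //; apply: measurable_funTS.
    by apply: emeasurable_funM => //; apply/measurable_EFinP; exact: measurable_poisson.
  move=> r _; rewrite /patch; case: ifPn => rI; last first.
    by rewrite integral0_eq// => t _; rewrite /H/= indicE (negbTE rI) mule0.
  have r0 : (0 <= r)%R by move: rI; rewrite inE/= in_itv/= andbT.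
  (* balls are open: the closed interval of radius [r] lies in those of radius [s > r] *)
  have step s : (r < s)%R ->
     \int[mu]_t H (t, r) <= (layer_density e r)%:E * (2 * s * k)%:E.
    move=> rs; have s0 : (0 < s)%R by apply: le_lt_trans rs.
    apply: (@le_trans _ _ ((layer_density e r)%:E * \int[mu]_(t in ball x s) `|h t|%:E)); last first.
      rewrite lee_wpmul2l ?lee_fin ?layer_density_ge0//.
      exact: integral_ball_le_maximal.
    rewrite -ge0_integralZl_EFin ?layer_density_ge0//; last 2 first.
    - exact: measurable_ball.
    - apply/measurable_EFinP/measurable_funTS.
      exact: measurable_fun_normr.
    rewrite [leRHS]integral_mkcond; apply: ge0_le_integral => //.
    - exact: (measurableT_comp mH (@pair2_measurable _ _ R R r)).
    - apply/(measurable_restrictT _ _).1; first exact: measurable_ball.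
      apply: measurable_funTS; apply: emeasurable_funM => //; apply/measurable_EFinP.
      exact: measurable_fun_normr.
    move=> t _; rewrite /H/= indicE rI mule1 /patch.
    case: (leP `|x - t|%R r) => xtr.
      by rewrite mem_set /ball/= ?(le_lt_trans xtr)// mulr1 mulrC EFinM.
    rewrite mulr0; case: ifP => _ //.
    by rewrite mule_ge0 ?lee_fin// layer_density_ge0.
  apply/lee_addgt0Pr => d d0.
  pose c := (layer_density e r * 2 * k)%R.
  have c0 : (0 <= c)%R by do 2!apply: mulr_ge0 => //; exact: layer_density_ge0.
  have c1 : (0 < c + 1)%R by rewrite ltr_wpDl.
  have dc : (0 < d / (c + 1))%R by rewrite divr_gt0.
  have rs : (r < r + d / (c + 1))%R by rewrite ltrDl.
  apply: le_trans (step _ rs) _.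
  rewrite -!EFinM -EFinD lee_fin.
  have -> : (layer_density e r * (2 * (r + d / (c + 1)) * k) =
    layer_density e r * 2 * r * k + c / (c + 1) * d)%R by rewrite /c; field; rewrite gt_eqF.
  apply: lerD; last first.
    by rewrite ler_piMl ?(ltW d0)// ler_pdivrMr// mul1r lerDl.
  have p0 := poisson_ge0 e r e0.
  have -> : (layer_density e r * 2 * r * k = 4 * k * poisson e r * (r ^+ 2 / (r ^+ 2 + e ^+ 2)))%R.
    by rewrite /layer_density /poisson; field; rewrite gt_eqF// sqrD_gt0.
  apply: ler_piMr; first by apply: mulr_ge0 => //; exact: mulr_ge0.
  by rewrite ler_pdivrMr ?sqrD_gt0// mul1r lerDl sqr_ge0.
rewrite ge0_integralZl_EFin ?mulr_ge0//; last 2 first.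
- by move=> r _; rewrite lee_fin poisson_ge0.
- by apply/measurable_EFinP/measurable_funTS; exact: measurable_poisson.
rewrite integral_poisson_tail// -EFinM lee_fin.
by rewrite le_eqVlt; apply/orP; left; apply/eqP; field.
Qed.

End Poisson.

(** * Boole's identity *)

Section Boole.
Context {R : realType}.
Implicit Types (a b c d x y m : R).

Lemma poly_ivt_sign (P : {poly R}) a b : a < b -> P.[a] * P.[b] < 0 ->
  exists2 x, a < x < b & root P x.
Proof.
move=> ab; wlog Pa : P / P.[a] <= 0.
  move=> H h; have [h0|h0] := leP P.[a] 0; first exact: H.
  have [||x xab] := H (- P).
  - by rewrite hornerN oppr_le0 ltW.
  - by rewrite !hornerN mulrNN.
  by rewrite rootN; exists x.
move=> h; have a0 : P.[a] < 0.
  rewrite lt_neqAle Pa andbT; apply/eqP => e.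
  by move: h; rewrite e mul0r ltxx.
have b0 : 0 < P.[b] by move: h; rewrite nmulr_rlt0.
have [|x /andP[ax xb] rx] := poly_ivt (ltW ab) (_ : P.[a] <= 0 <= P.[b]).
  by rewrite Pa ltW.
exists x => //; rewrite !lt_neqAle ax xb !andbT; apply/andP; split; apply/eqP => e.
  by move/rootP: rx; rewrite -e => e0; rewrite e0 ltxx in a0.
by move/rootP: rx; rewrite e => e0; rewrite e0 ltxx in b0.
Qed.

(** The argument of [x + i y - t], minus a right angle. *)
Definition angle x y (t : R) : R := atan ((t - x) / y).

Lemma angle_polar x y t : 0 < y -> exists2 r : R, 0 < r &
  (r * cos (angle x y t) = y) /\ (r * sin (angle x y t) = t - x).
Proof.
move=> y0; set al := angle x y t.
have c0 : 0 < cos al.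
  by apply: cos_gt0_pihalf; rewrite atan_gtNpi2 atan_ltpi2.
exists (y / cos al); first by rewrite divr_gt0.
split; first by rewrite divfK// gt_eqF.
have : tan al = (t - x) / y by rewrite /al /angle atanK.
rewrite /tan => h.
have -> : y / cos al * sin al = y * (sin al / cos al) by ring.
by rewrite h mulrC divfK// gt_eqF.
Qed.

(** Arguments add up in products and change sign under conjugation; the right angles
    in [angle] cancel. *)
Lemma prod_polar (n : nat) (c d : nat -> R) x y : 0 < y ->
  let z : R[i] := Complex x y in
  exists2 S : R, 0 < S &
  (\prod_(i < n) (z - (c i)%:C%C)) * (\prod_(i < n) (z - (d i)%:C%C))^*%C =
  Complex (S * cos (\sum_(i < n) (angle x y (c i) - angle x y (d i))))
          (S * sin (\sum_(i < n) (angle x y (c i) - angle x y (d i)))).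
Proof.
move=> y0 z; elim: n => [|n [S S0 IH]].
  exists 1 => //; rewrite !big_ord0 cos0 sin0 mulr0 mulr1.
  by rewrite mul1r; apply/eqP; rewrite eq_complex/= oppr0 !eqxx.
rewrite 3!big_ord_recr/= rmorphM/=.
have [r r0 [rc rs]] := angle_polar x y (c n) y0.
have [q q0 [qc qs]] := angle_polar x y (d n) y0.
exists (S * (r * q)); first by rewrite !mulr_gt0.
rewrite mulrACA IH.
set T := \sum_(i < n) _.
set A := angle x y (c n) in rc rs *; set B := angle x y (d n) in qc qs *.
have -> : (z - (c n)%:C%C) * (z - (d n)%:C%C)^*%C =
  Complex (r * q * cos (A - B)) (r * q * sin (A - B)).
  rewrite cosB sinB /z.
  apply/eqP; rewrite eq_complex /=; apply/andP; split; apply/eqP.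
    have -> : r * q * (cos A * cos B + sin A * sin B) =
      (r * cos A) * (q * cos B) + (r * sin A) * (q * sin B) by ring.
    rewrite rc rs qc qs; ring.
  have -> : r * q * (sin A * cos B - cos A * sin B) =
      (r * sin A) * (q * cos B) - (r * cos A) * (q * sin B) by ring.
  rewrite rc rs qc qs; ring.
rewrite (cosD T) (sinD T); apply/eqP; rewrite eq_complex /=.
by apply/andP; split; apply/eqP; ring.
Qed.

Lemma prod_sqr_modulus (n : nat) (a : nat -> R) x y :
  let z : R[i] := Complex x y in
  let p := \prod_(i < n) (z - (a i)%:C%C) in
  complex.Re p ^+ 2 + complex.Im p ^+ 2 = \prod_(i < n) ((x - a i) ^+ 2 + y ^+ 2).
Proof.
move=> z; elim: n => [|n /= IH]; first by rewrite !big_ord0/= expr0n/= addr0 expr1n.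
rewrite /= !big_ord_recr/= -IH /z.
case: (\prod_(i < n) _) => u v /=; ring.
Qed.

Section Interlacing.
Variables (n : nat) (a b : nat -> R) (m : R).
Hypothesis ab : forall i, a i < b i.
Hypothesis ba : forall i, b i < a i.+1.
Hypothesis m1 : 1 < m.

Let Pa : {poly R} := \prod_(i < n) ('X - (a i)%:P).
Let Pb : {poly R} := \prod_(i < n) ('X - (b i)%:P).

Let PaE x : Pa.[x] = \prod_(i < n) (x - a i).
Proof. by rewrite horner_prod; apply: eq_bigr => i _; rewrite hornerXsubC. Qed.

Let PbE x : Pb.[x] = \prod_(i < n) (x - b i).
Proof. by rewrite horner_prod; apply: eq_bigr => i _; rewrite hornerXsubC. Qed.

Let lt_a i j : (i < j)%N -> a i < a j.
Proof.
have st k : a k < a k.+1 by exact: lt_trans (ab k) (ba k).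
elim: j => // j IH; rewrite ltnS leq_eqVlt => /predU1P[->|/IH h]; first exact: st.
exact: lt_trans h (st j).
Qed.

Let le_a i j : (i <= j)%N -> a i <= a j.
Proof. by rewrite leq_eqVlt => /predU1P[->//|/lt_a/ltW]. Qed.

Let lt_ba i j : (i < j)%N -> b i < a j.
Proof. by move=> ij; apply: lt_le_trans (ba i) (le_a _ _ ij). Qed.

Let lt_ab i j : (i <= j)%N -> a i < b j.
Proof. by move=> ij; apply: le_lt_trans (le_a _ _ ij) (ab j). Qed.

(** At [a i] only [m *: Pb] survives and at [b i] only [Pa]; for every [j != i] the
    factors of index [j] have the same sign at both points. *)
Let plus_root i : (i < n)%N -> exists d, a i < d < b i /\ root (Pa + m *: Pb) d.
Proof.
move=> iltn; have [||d h r] := @poly_ivt_sign (Pa + m *: Pb) (a i) (b i) => //; last by exists d.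
rewrite !hornerD !hornerZ !PaE !PbE.
rewrite (bigD1 (Ordinal iltn))//= subrr mul0r add0r.
rewrite [\prod_(j < n) (b i - b j)](bigD1 (Ordinal iltn))//= subrr mul0r mulr0 addr0.
rewrite -mulrA -big_split/= (bigD1 (Ordinal iltn))//=.
rewrite pmulr_rlt0 ?(lt_trans ltr01)// nmulr_rlt0.
  apply: prodr_gt0 => j /eqP ji.
  have [ji'|ij'|e] := ltngtP j i; last by case: ji; apply: val_inj.
    by rewrite mulr_gt0 ?subr_gt0 ?lt_ba// lt_ab// ltnW.
  by rewrite nmulr_rgt0 subr_lt0; [rewrite lt_ba|rewrite lt_ab// ltnW].
by rewrite nmulr_rlt0 ?subr_gt0 ?subr_lt0.
Qed.

Let minus_root_inner i : (i.+1 < n)%N -> exists c, b i < c < a i.+1 /\ root (Pa - m *: Pb) c.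
Proof.
move=> iltn; have [||c h r] := @poly_ivt_sign (Pa - m *: Pb) (b i) (a i.+1) => //; last by exists c.
rewrite !hornerD !hornerN !hornerZ !PaE !PbE.
rewrite [\prod_(j < n) (b i - b j)](bigD1 (Ordinal (ltnW iltn)))//= subrr mul0r mulr0 subr0.
rewrite [\prod_(j < n) (a i.+1 - a j)](bigD1 (Ordinal iltn))//= subrr mul0r add0r.
have m0 : 0 < m := lt_trans ltr01 m1.
rewrite mulrN mulrCA oppr_lt0 -big_split/= (pmulr_rgt0 _ m0).
apply: prodr_gt0 => j _.
have [ji|ij] := leqP j i.
  by rewrite mulr_gt0 ?subr_gt0 ?lt_ab// lt_ba.
by rewrite nmulr_rgt0 subr_lt0 ?lt_ba// lt_ab.
Qed.

Let prodE (f : nat -> R) : \prod_(i < n) ('X - (f i)%:P) =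
  \prod_(x <- [seq f i | i <- iota 0 n]) ('X - x%:P) :> {poly R}.
Proof. by rewrite big_map -[in RHS](subn0 n) -/(index_iota 0 n) big_mkord. Qed.

Let size_comb (k : R) : 1 + k != 0 -> (0 < n)%N ->
  size (Pa + k *: Pb) = n.+1 /\ lead_coef (Pa + k *: Pb) = 1 + k.
Proof.
move=> k1 n0.
have sz (f : nat -> R) : size (\prod_(i < n) ('X - (f i)%:P) : {poly R}) = n.+1.
  by rewrite prodE size_prod_XsubC size_map size_iota.
have lc (f : nat -> R) : (\prod_(i < n) ('X - (f i)%:P) : {poly R})`_n = 1.
  have := monic_prod_XsubC (index_enum 'I_n) xpredT f.
  by rewrite monicE lead_coefE sz => /eqP.
have cn : (Pa + k *: Pb)`_n = 1 + k by rewrite coefD coefZ !lc mulr1.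
have s : size (Pa + k *: Pb) = n.+1.
  apply/eqP; rewrite eqn_leq; apply/andP; split.
    rewrite (leq_trans (size_polyD _ _))// geq_max sz leqnn/=.
    by rewrite (leq_trans (size_scale_leq _ _))// sz.
  rewrite ltnNge; apply/negP => h.
  by have := nth_default 0 h; rewrite cn => /eqP; rewrite (negbTE k1).
by split => //; rewrite lead_coefE s.
Qed.

(** [Pa - m *: Pb] is positive at the last [b] and has leading coefficient
    [1 - m < 0]. *)
Let minus_root_last : (0 < n)%N -> exists c, b n.-1 < c /\ root (Pa - m *: Pb) c.
Proof.
move=> n0; have [|_ lc] := @size_comb (- m) _ n0.
  by rewrite subr_eq0 lt_eqF.
rewrite scaleNr in lc.
have lc' : 0 < lead_coef (- (Pa - m *: Pb)) by rewrite lead_coefN lc opprB subr_gt0.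
have [N hN] := polyrcf.poly_pinfty_gt_lc lc'.
pose M := Num.max N (b n.-1 + 1).
have bM : b n.-1 < M by rewrite lt_max ltrDl ltr01 orbT.
have [||c /andP[bc _] rc] := @poly_ivt_sign (Pa - m *: Pb) (b n.-1) M => //; last by exists c.
have hM : (Pa - m *: Pb).[M] < 0.
  by rewrite -oppr_gt0 -hornerN (lt_le_trans lc')// hN// le_max lexx.
rewrite nmulr_llt0//.
have nn : (n.-1 < n)%N by rewrite prednK.
rewrite hornerD hornerN hornerZ PaE PbE.
rewrite [\prod_(j < n) (b _ - b j)](bigD1 (Ordinal nn))//= subrr mul0r mulr0 subr0.
apply: prodr_gt0 => j _; rewrite subr_gt0 lt_ab//.
by rewrite -ltnS prednK.
Qed.

Let interlacing_roots : (0 < n)%N -> exists c d : nat -> R,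
  [/\ forall i, (i < n)%N -> a i < d i < b i,
      forall i, (i < n)%N -> b i < c i /\ ((i.+1 < n)%N -> c i < a i.+1),
      forall i, (i < n)%N -> root (Pa + m *: Pb) (d i) &
      forall i, (i < n)%N -> root (Pa - m *: Pb) (c i)].
Proof.
move=> n0.
have /choice[d hd] : forall i, exists d, (i < n)%N -> a i < d < b i /\ root (Pa + m *: Pb) d.
  move=> i; have [iltn|_] := boolP (i < n)%N; last by exists 0.
  by have [d h] := plus_root _ iltn; exists d.
have /choice[c hc] : forall i, exists c, (i < n)%N ->
    (b i < c /\ ((i.+1 < n)%N -> c < a i.+1)) /\ root (Pa - m *: Pb) c.
  move=> i; have [iltn|_] := boolP (i < n)%N; last by exists 0.
  have [i1|] := boolP (i.+1 < n)%N.
    by have [c [/andP[bc ca] rc]] := minus_root_inner _ i1; exists c.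
  rewrite -leqNgt => i1.
  have ni : n = i.+1 by apply/eqP; rewrite eqn_leq i1.
  have [c [h1 h2]] := minus_root_last n0; exists c => _; split => //; split => //.
  by move: h1; rewrite ni.
exists c, d; split => i iltn; [by have [] := hd i iltn|by have [] := hc i iltn|
  by have [] := hd i iltn|by have [] := hc i iltn].
Qed.

Let coef_prod (f : nat -> R) : (0 < n)%N ->
  (\prod_(i < n) ('X - (f i)%:P) : {poly R})`_n.-1 = - \sum_(i < n) f i.
Proof.
move=> n0; rewrite prodE.
have := @coefPn_prod_XsubC R [seq f i | i <- iota 0 n].
rewrite size_map size_iota => ->; last by rewrite -lt0n.
by rewrite big_map -[in LHS](subn0 n) -/(index_iota 0 n) big_mkord.
Qed.

Let factor (k : R) (f : nat -> R) : 1 + k != 0 -> (0 < n)%N ->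
  (forall i j, (i < j < n)%N -> f i < f j) ->
  (forall i, (i < n)%N -> root (Pa + k *: Pb) (f i)) ->
  Pa + k *: Pb = (1 + k) *: \prod_(i < n) ('X - (f i)%:P).
Proof.
move=> k1 n0 fm fr; have [s l] := size_comb _ k1 n0.
rewrite prodE -l; apply: all_roots_prod_XsubC.
- by rewrite s size_map size_iota.
- by rewrite all_map; apply/allP => i; rewrite mem_iota => /andP[_ iltn] /=; exact: fr.
rewrite uniq_rootsE map_inj_in_uniq ?iota_uniq// => i j.
rewrite !mem_iota !add0n => /andP[_ iltn] /andP[_ jn] fij.
have [ij|ji|//] := ltngtP i j.
  by have := fm i j; rewrite ij jn => /(_ isT); rewrite fij ltxx.
by have := fm j i; rewrite ji iltn => /(_ isT); rewrite fij ltxx.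
Qed.

(** The roots [d] of [Pa + m *: Pb] and [c] of [Pa - m *: Pb] interlace, and their
    sums are read off the coefficients of degree [n - 1]; this is Boole's identity.

    At [z = x + i y] the real part of [(Pa - m Pb) * conj (Pa + m Pb)] is
    [|Pa|^2 - m^2 |Pb|^2]. When it is nonnegative, the leading coefficients [1 - m]
    and [1 + m] being of opposite signs, [prod (z - c) * conj (prod (z - d))] has a
    real part at most 0. Its argument is the sum of the differences of angles: it is
    nonnegative since [d i < c i], hence at least a right angle. *)
Lemma boole_roots : (0 < n)%N -> exists c d : nat -> R,
  [/\ forall i, (i < n)%N -> d i < c i,
      \sum_(i < n) (c i - d i) = 2 * m / (m ^+ 2 - 1) * \sum_(i < n) (b i - a i) &
      forall x y, 0 < y ->
       m ^+ 2 * \prod_(i < n) ((x - b i) ^+ 2 + y ^+ 2) <=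
       \prod_(i < n) ((x - a i) ^+ 2 + y ^+ 2) ->
       pi / 2 <= \sum_(i < n) (angle x y (c i) - angle x y (d i))].
Proof.
move=> n0; have [c [d [hd hc rd rc]]] := interlacing_roots n0.
have m0 : 0 < m := lt_trans ltr01 m1.
have dm i j : (i < j < n)%N -> d i < d j.
  move=> /andP[ij jn]; have iltn := ltn_trans ij jn.
  have /andP[_ h1] := hd _ iltn; have /andP[h2 _] := hd _ jn.
  exact: lt_trans h1 (lt_trans (lt_ba _ _ ij) h2).
have cm i j : (i < j < n)%N -> c i < c j.
  move=> /andP[ij jn]; have iltn := ltn_trans ij jn.
  have [_ h1] := hc _ iltn; have [h2 _] := hc _ jn.
  have {}h1 := h1 (leq_ltn_trans ij jn).
  exact: lt_trans h1 (le_lt_trans (le_a _ _ ij) (lt_trans (ab j) h2)).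
have p1 : 1 + m != 0 by rewrite gt_eqF// addr_gt0.
have q1 : 1 + - m != 0 by rewrite subr_eq0 lt_eqF.
have fd := factor _ _ p1 n0 dm rd.
have fc : Pa - m *: Pb = (1 + - m) *: \prod_(i < n) ('X - (c i)%:P).
  by rewrite -scaleNr; apply: factor => // i iltn; rewrite scaleNr; exact: rc.
exists c, d; split.
- move=> i iltn; have /andP[_ h1] := hd _ iltn; have [h2 _] := hc _ iltn.
  exact: lt_trans h2.
- have ed := congr1 (fun P : {poly R} => P`_n.-1) fd.
  have ec := congr1 (fun P : {poly R} => P`_n.-1) fc.
  move: ed ec; rewrite !coefD coefN !coefZ !coef_prod//.
  rewrite !sumrB; set C := \sum_(i < n) c i; set D := \sum_(i < n) d i.
  set A := \sum_(i < n) a i; set B := \sum_(i < n) b i => ed ec.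
  have m2 : m ^+ 2 - 1 != 0 by rewrite subr_eq0 gt_eqF// exprn_egt1.
  apply: (mulfI m2).
  have -> : (m ^+ 2 - 1) * (2 * m / (m ^+ 2 - 1) * (B - A)) = 2 * m * (B - A) by field.
  transitivity ((m + 1) * ((1 - m) * - C) + (m - 1) * ((1 + m) * - D)); first by ring.
  by rewrite -ec -ed; ring.
- move=> x y y0 hxy; set T := \sum_(i < n) _.
  pose z : R[i] := Complex x y.
  have ev (f : nat -> R) : (map_poly (real_complex R) (\prod_(i < n) ('X - (f i)%:P))).[z] =
      \prod_(i < n) (z - (f i)%:C%C).
    rewrite rmorph_prod horner_prod; apply: eq_bigr => i _.
    by rewrite /= map_polyXsubC hornerXsubC.
  have ed := congr1 (fun P : {poly R} => (map_poly (real_complex R) P).[z]) fd.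
  have ec := congr1 (fun P : {poly R} => (map_poly (real_complex R) P).[z]) fc.
  rewrite rmorphD/= !map_polyZ !hornerD !hornerZ !ev in ed.
  rewrite rmorphB/= !map_polyZ !hornerD hornerN !hornerZ !ev in ec.
  have [S S0 hS] := prod_polar n c d x y y0.
  have na := prod_sqr_modulus n a x y; have nb := prod_sqr_modulus n b x y.
  move: na nb ed ec hS; rewrite -/z -/T /=.
  set A := \prod_(i < n) (z - (a i)%:C%C); set B := \prod_(i < n) (z - (b i)%:C%C).
  set C := \prod_(i < n) (z - (c i)%:C%C); set D := \prod_(i < n) (z - (d i)%:C%C).
  move=> na nb ed ec hS.
  have hre : (1 - m) * (1 + m) * (S * cos T) =
     complex.Re A ^+ 2 + complex.Im A ^+ 2 - m ^+ 2 * (complex.Re B ^+ 2 + complex.Im B ^+ 2).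
    have -> : S * cos T = complex.Re (C * D^*%C) by rewrite hS.
    have -> : (1 - m) * (1 + m) * complex.Re (C * D^*%C) =
       complex.Re (((1 - m)%:C%C * C) * ((1 + m)%:C%C * D)^*%C).
      by case: C D {ed ec hS} => [c1 c2] [d1 d2] /=; ring.
    rewrite -ed -ec.
    by case: A B {ed ec na nb} => [a1 a2] [b1 b2] /=; ring.
  have cT : cos T <= 0.
    rewrite leNgt; apply/negP => cT.
    have : 0 <= (1 - m) * (1 + m) * (S * cos T).
      by rewrite hre na nb subr_ge0.
    apply/negP; rewrite -ltNge nmulr_rlt0 ?mulr_gt0//.
    by rewrite nmulr_rlt0 ?addr_gt0// subr_lt0.
  have T0 : 0 <= T.
    apply: sumr_ge0 => i _; rewrite subr_ge0; apply: le_atan.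
    rewrite ler_pM2r ?invr_gt0// lerD2r ltW//.
    have /andP[_ h1] := hd _ (ltn_ord i); have [h2 _] := hc _ (ltn_ord i).
    exact: lt_trans h2.
  rewrite leNgt; apply/negP => Tpi.
  have : 0 < cos T.
    apply: cos_gt0_pihalf; rewrite Tpi andbT (lt_le_trans _ T0)//.
    by rewrite oppr_lt0 divr_gt0// pi_gt0.
  by rewrite ltNge cT.
Qed.

End Interlacing.
End Boole.

(** * Conjugate Poisson integrals of step functions *)

Section BooleWeak.
Context {R : realType}.
Local Notation mu := (@lebesgue_measure R).

Definition conj_poisson (e s : R) : R := s / (s ^+ 2 + e ^+ 2).

Lemma measurable_conj_poisson (e : R) : measurable_fun setT (conj_poisson e).
Proof.
by apply: measurable_funM => //; apply: measurable_funV; apply: measurable_funD.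
Qed.

Lemma continuous_conj_poisson (e : R) : 0 < e -> continuous (conj_poisson e).
Proof.
move=> e0 x; apply: cvgM; first exact: cvg_id.
apply: cvgV; first by rewrite gt_eqF// sqrD_gt0.
by apply: cvgD; [exact: exprn_continuous|exact: cvg_cst].
Qed.

Lemma continuous_reflect (K : R -> R) (x : R) : continuous K -> continuous (fun t => K (x - t)).
Proof.
move=> cK t; have h : (x - s) @[s --> t] --> (x - t).
  by apply: cvgB; [exact: cvg_cst|exact: cvg_id].
exact: (cvg_comp _ _ h (cK _)).
Qed.

Lemma is_derive_ln_sqr (e x t : R) : 0 < e ->
  is_derive t 1 (fun t => - (2^-1 * ln ((x - t) ^+ 2 + e ^+ 2))) (conj_poisson e (x - t)).
Proof.
move=> e0; pose q := fun t : R => (x - t) ^+ 2 + e ^+ 2.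
have h1 : is_derive t 1 q (- (2 * (x - t))).
  by apply: is_derive_eq; rewrite /GRing.scale/=; ring.
have h2 : is_derive (q t) 1 (@ln R) (q t)^-1 by apply: is_derive1_ln; exact: sqrD_gt0.
have h3 := is_deriveZ (- 2^-1) (is_derive1_comp h2 h1).
have -> : (fun t => - (2^-1 * ln ((x - t) ^+ 2 + e ^+ 2))) = (- 2^-1) *: (@ln R \o q).
  by apply/funext => r; rewrite -mulNr.
apply: (is_derive_eq h3); rewrite /conj_poisson /GRing.scale/= /q; field.
by rewrite gt_eqF// sqrD_gt0.
Qed.

Lemma is_derive_angle (e x t : R) : 0 < e ->
  is_derive t 1 (angle x e) (poisson e (x - t)).
Proof.
move=> e0; pose g := fun t : R => t - x.
have h2 : is_derive t 1 g 1.
  by apply: is_derive_eq; rewrite /GRing.scale/=; ring.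
have h1 := is_derive_atan_div e (g t) e0.
have -> : poisson e (x - t) = poisson e (g t) * 1.
  by rewrite mulr1 /poisson /g -(opprB t x) sqrrN.
exact: (is_derive1_comp h1 h2).
Qed.

Lemma integral_derive_itv (F f : R -> R) (a b : R) : a < b -> continuous f ->
  (forall t : R, is_derive t 1 F (f t)) ->
  (\int[mu]_(t in `[a, b]) (f t)%:E = (F b - F a)%:E)%E.
Proof.
move=> ab cf dF.
have cF : continuous F.
  by move=> t; apply/differentiable_continuous/derivable1_diffP; have [] := dF t.
rewrite (@continuous_FTC2 R f F)//.
- exact: continuous_subspaceT.
- split; [by move=> t _; have [] := dF t|apply: cvg_at_right_filter; exact: cF|apply: cvg_at_left_filter; exact: cF].
- by move=> t _; rewrite derive1E; have [_ ->] := dF t.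
Qed.

Definition steps (n : nat) (a b : nat -> R) (t : R) : R :=
  \sum_(i < n) \1_(`[a i, b i]%classic) t.

Lemma measurable_steps n a b : measurable_fun setT (steps n a b).
Proof. by apply: measurable_sum => i; exact: measurable_indic. Qed.

Lemma steps_ge0 n a b t : 0 <= steps n a b t.
Proof. by apply: sumr_ge0 => i _; rewrite indicE. Qed.

Lemma integrable_step (a b : R) (K : R -> R) : continuous K ->
  mu.-integrable setT (fun t => (\1_(`[a, b]%classic) t * K t)%:E).
Proof.
move=> cK; have h : mu.-integrable `[a, b] (EFin \o K).
  apply: continuous_compact_integrable; first exact: segment_compact.
  exact: continuous_subspaceT.
have h2 := (@integrable_mkcond _ _ R mu `[a, b]%classic (EFin \o K) (measurable_itv _)).1 h.
apply: eq_integrable h2 => // t _; rewrite /patch /= indicE.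
by case: ifP => _; rewrite ?mul1r ?mul0r.
Qed.

Lemma integrable_steps n a b (K : R -> R) : continuous K ->
  mu.-integrable setT (fun t => (steps n a b t * K t)%:E).
Proof.
move=> cK; under eq_fun do rewrite /steps mulr_suml -sumEFin.
by apply: integrable_sum => // i _; exact: integrable_step.
Qed.

Lemma integral_steps n (a b : nat -> R) (f F : R -> R) : (forall i, (i < n)%N -> a i < b i) ->
  continuous f -> (forall t : R, is_derive t 1 F (f t)) ->
  (\int[mu]_t (steps n a b t * f t)%:E = (\sum_(i < n) (F (b i) - F (a i)))%:E)%E.
Proof.
move=> ab cf dF; under eq_integral do rewrite /steps mulr_suml -sumEFin.
rewrite (@integral_sum _ _ R mu setT measurableT 'I_n
  (fun i t => (\1_(`[a i, b i]%classic) t * f t)%:E)); last first.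
  by move=> i; exact: integrable_step.
rewrite -sumEFin; apply: eq_bigr => i _.
rewrite -(integral_derive_itv F f)//; last exact: ab.
rewrite [RHS]integral_mkcond; apply: eq_integral => t _; rewrite /patch indicE.
by case: ifP => _; rewrite ?mul1r ?mul0r.
Qed.

Lemma integral_steps1 n (a b : nat -> R) : (forall i, (i < n)%N -> a i < b i) ->
  (\int[mu]_t (steps n a b t)%:E = (\sum_(i < n) (b i - a i))%:E)%E.
Proof.
move=> ab; rewrite -(integral_steps n a b (cst 1) id)//.
- by apply: eq_integral => t _; rewrite /= mulr1.
- by move=> t; exact: cvg_cst.
Qed.

Lemma integrable_steps1 n a b : mu.-integrable setT (EFin \o steps n a b).
Proof.
have c1 : continuous (cst 1 : R -> R) by move=> t; exact: cvg_cst.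
have h := integrable_steps n a b (cst 1) c1.
by apply: eq_integrable h => // t _ /=; rewrite mulr1.
Qed.

Lemma ln_prod_sqr n (f : nat -> R) (e x : R) : 0 < e ->
  ln (\prod_(i < n) ((x - f i) ^+ 2 + e ^+ 2)) = \sum_(i < n) ln ((x - f i) ^+ 2 + e ^+ 2).
Proof.
move=> e0; elim: n => [|k IH]; first by rewrite !big_ord0 ln1.
rewrite !big_ord_recr/= lnM ?IH ?posrE ?sqrD_gt0//.
by apply: prodr_gt0 => i _; exact: sqrD_gt0.
Qed.

(** The conjugate Poisson integral of [steps n a b] at [x + i e] is [ln |Pa / Pb|].
    Where it reaches [l], [boole_roots] with [m = expR l] makes the Poisson integral
    of [steps n d c] at least [pi / 2], whence by [poisson_le_maximal] the maximal
    function of [steps n d c] exceeds [5^-1], as [2 * pi / 5 < pi / 2]. This set does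
    not depend on [e]. The maximal inequality, with its constant 3, and Boole's
    identity bound its measure. *)
Lemma boole_weak n (a b : nat -> R) (l : R) : (0 < n)%N ->
  (forall i, a i < b i) -> (forall i, b i < a i.+1) -> 0 < l ->
  exists B : set R, [/\ measurable B,
    (mu B <= (15 * (2 * expR l / (expR l ^+ 2 - 1)) * \sum_(i < n) (b i - a i))%:E)%E &
    forall x e, 0 < e ->
      (l%:E <= \int[mu]_t (steps n a b t * conj_poisson e (x - t))%:E)%E -> B x].
Proof.
move=> n0 ab ba l0; have m1 : 1 < expR l by rewrite expR_gt1.
have [c [d [dc cd hang]]] := boole_roots n a b (expR l) ab ba m1 n0.
pose h := steps n d c.
have lh : locally_integrable [set: R] h.
  by apply: open_integrable_locally; [exact: openT|exact: integrable_steps1].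
exists [set x | (HL_maximal h x > (5^-1)%:E)%E]; split.
- rewrite -[X in measurable X]setTI; apply: emeasurable_fun_o_infty => //.
  exact: measurable_HL_maximal.
- apply: le_trans (maximal_inequality lh _) _; first by rewrite invr_gt0.
  under eq_integral do rewrite /= ger0_norm ?steps_ge0//.
  rewrite integral_steps1// cd -EFinM lee_fin; rewrite le_eqVlt.
  by apply/orP; left; apply/eqP; rewrite invrK; ring.
move=> x e e0 hl /=; rewrite ltNge; apply/negP => hM.
have k0 : 0 <= 5^-1 :> R by [].
have := poisson_le_maximal h e x 5^-1 e0 (measurable_steps _ _ _) k0 hM.
under eq_integral do rewrite ger0_norm ?steps_ge0//.
have cP := continuous_reflect (poisson e) x (continuous_poisson e e0).
have dP (t : R) : is_derive t 1 (angle x e) (poisson e (x - t)) by exact: is_derive_angle.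
rewrite (integral_steps n d c (fun t => poisson e (x - t)) (angle x e) dc cP dP).
rewrite lee_fin; apply/negP; rewrite -ltNge.
apply: (@lt_le_trans _ _ (pi / 2)).
  have p0 := pi_gt0 R; lra.
apply: hang => //.
have cC := continuous_reflect (conj_poisson e) x (continuous_conj_poisson e e0).
have dC (t : R) := is_derive_ln_sqr e x t e0.
move: hl; rewrite (integral_steps n a b (fun t => conj_poisson e (x - t))
  (fun t => - (2^-1 * ln ((x - t) ^+ 2 + e ^+ 2))) (fun i _ => ab i) cC dC).
rewrite lee_fin => hl.
have pA (f : nat -> R) : 0 < \prod_(i < n) ((x - f i) ^+ 2 + e ^+ 2).
  by apply: prodr_gt0 => i _; exact: sqrD_gt0.
have lnp f := ln_prod_sqr n f e x e0.
rewrite -ler_ln ?posrE ?mulr_gt0 ?exprn_gt0 ?expR_gt0//.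
rewrite lnM ?posrE ?exprn_gt0 ?expR_gt0// lnXn ?expR_gt0// expRK !lnp -lerBrDr.
move: hl; rewrite sumrB !sumrN -!mulr_sumr; set A := \sum_(i < n) _; set B := \sum_(i < n) _.
rewrite -mulr_natl => hl; lra.
Qed.

End BooleWeak.

(** * Truncated Hilbert transforms *)

Section Truncated.
Context {R : realType}.
Local Notation mu := (@lebesgue_measure R).

Definition trunc_kernel (e s : R) : R := if e < `|s| then s^-1 else 0.

Definition trunc (f : R -> R) (e x : R) : R :=
  \int[mu]_(y in [set y | e < `|x - y|]) (f y / (x - y)).

Lemma truncE f e x : trunc f e x = \int[mu]_y (f y * trunc_kernel e (x - y)).
Proof.
rewrite /trunc Rintegral_mkcond; congr fine; apply: eq_integral => y _.
rewrite /patch /trunc_kernel; case: ifPn => h; last first.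
  rewrite ifF ?mulr0//; apply/negbTE; move: h; rewrite notin_setE /=.
  by move=> /negP.
by move: h; rewrite inE /= => ->.
Qed.

Lemma measurable_trunc_kernel e : measurable_fun setT (trunc_kernel e).
Proof.
apply: measurable_fun_ifT => //; last exact: measurable_inv.
by apply: measurable_fun_ltr => //; exact: measurable_fun_normr.
Qed.

Lemma trunc_kernel_le (e s : R) : 0 < e -> `|trunc_kernel e s| <= e^-1.
Proof.
move=> e0; rewrite /trunc_kernel; case: ifPn => es; last by rewrite normr0 invr_ge0 ltW.
have s0 := lt_trans e0 es.
by rewrite normfV lef_pV2 ?posrE// ltW.
Qed.

Lemma trunc_kernel_poisson (e s : R) : 0 < e ->
  `|trunc_kernel e s - conj_poisson e s| <= poisson e s.
Proof.
move=> e0; have d0 := sqrD_gt0 e s e0; rewrite /trunc_kernel /conj_poisson /poisson.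
case: ifPn => [es|]; last first.
  rewrite -leNgt => es; rewrite sub0r normrN normrM normfV (gtr0_norm d0).
  by rewrite ler_pM2r ?invr_gt0.
have s0 := lt_trans e0 es.
have sn0 : s != 0 by rewrite -normr_gt0.
have -> : s^-1 - s / (s ^+ 2 + e ^+ 2) = (e ^+ 2 / s) / (s ^+ 2 + e ^+ 2).
  by field; rewrite sn0 gt_eqF.
rewrite normrM normfV (gtr0_norm d0) ler_pM2r ?invr_gt0//.
rewrite normrM normfV (ger0_norm (sqr_ge0 _)) ler_pdivrMr//.
by rewrite expr2 ler_pM2l// ltW.
Qed.

Lemma conj_poisson_le (e s : R) : 0 < e -> `|conj_poisson e s| <= e^-1.
Proof.
move=> e0; have d0 := sqrD_gt0 e s e0; rewrite /conj_poisson.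
rewrite normrM normfV (gtr0_norm d0) ler_pdivrMr// ler_pdivlMl//.
rewrite -real_normK ?num_real//.
by have := sqr_ge0 (`|s| - e); have := sqr_ge0 `|s|; have := sqr_ge0 e; rewrite sqrrB; nra.
Qed.

Lemma poisson_le (e s : R) : 0 < e -> `|poisson e s| <= e^-1.
Proof.
move=> e0; have d0 := sqrD_gt0 e s e0; rewrite ger0_norm ?poisson_ge0// /poisson.
rewrite ler_pdivrMr// ler_pdivlMl// -expr2.
by rewrite lerDr sqr_ge0.
Qed.

Lemma integrable_bounded_kernel (f K : R -> R) (M x : R) : measurable_fun setT K ->
  (forall s, `|K s| <= M) -> mu.-integrable setT (EFin \o f) ->
  mu.-integrable setT (fun y => (f y * K (x - y))%:E).
Proof.
move=> mK KM intf; have mf : measurable_fun setT f by apply/measurable_EFinP; exact: measurable_int intf.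
have mKx : measurable_fun [set: R] (fun y : R => K (x - y)).
  by apply: (measurableT_comp mK); exact: measurable_funB.
apply: (@le_integrable _ _ R mu setT measurableT _ (fun y => (M%:E * (f y)%:E)%E)).
- by apply/measurable_EFinP; exact: measurable_funM.
- move=> y _; rewrite -EFinM lee_fin !normrM mulrC ler_wpM2r//.
  by apply: (le_trans (KM _)); exact: ler_norm.
- exact: integrableZl.
Qed.

Lemma integrable_trunc (f : R -> R) (e x : R) : 0 < e ->
  mu.-integrable setT (EFin \o f) ->
  mu.-integrable setT (fun y => (f y * trunc_kernel e (x - y))%:E).
Proof.
move=> e0; apply: integrable_bounded_kernel; first exact: measurable_trunc_kernel.
by move=> s; exact: trunc_kernel_le.
Qed.

Lemma truncB f g e x : 0 < e ->
  mu.-integrable setT (EFin \o f) -> mu.-integrable setT (EFin \o g) ->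
  trunc f e x - trunc g e x = trunc (f \- g) e x.
Proof.
move=> e0 fi gi; rewrite !truncE -RintegralB//; try exact: integrable_trunc.
by apply: eq_Rintegral => y _; rewrite /= mulrBl.
Qed.

Lemma trunc_le f e x : 0 < e -> mu.-integrable setT (EFin \o f) ->
  (`|trunc f e x|%:E <= e^-1%:E * \int[mu]_y `|f y|%:E)%E.
Proof.
move=> e0 fi; rewrite truncE.
have mf : measurable_fun setT f by apply/measurable_EFinP; exact: measurable_int fi.
have hi := integrable_trunc f e x e0 fi.
rewrite EFin_normr_Rintegral//.
apply: le_trans (le_abse_integral _ _ _) _ => //; first exact: measurable_int hi.
rewrite -ge0_integralZl_EFin ?invr_ge0 ?(ltW e0)//; last first.
  by apply/measurable_EFinP; exact: measurable_fun_normr.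
apply: ge0_le_integral => //.
- apply: measurableT_comp => //; exact: measurable_int hi.
- apply: emeasurable_funM => //; apply/measurable_EFinP; exact: measurable_fun_normr.
- move=> y _; rewrite -EFinM lee_fin normrM mulrC ler_wpM2r//.
  exact: trunc_kernel_le.
Qed.

Lemma measurable_Rintegral2 d (T : measurableType d) (F : T * R -> R) : measurable_fun setT F ->
  measurable_fun setT (fun x => \int[mu]_y F (x, y)).
Proof.
move=> mF; apply: (measurableT_comp (fine_measurable measurableT)).
under eq_fun do rewrite integralE.
apply: emeasurable_funB.
  have h : measurable_fun setT ((EFin \o F)^\+)%E by apply: measurable_funepos; exact/measurable_EFinP.
  have := (@measurable_fun_fubini_tonelli_F _ _ T (measurableTypeR R) R mu
    ((EFin \o F)^\+)%E h (funepos_ge0 _)).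
  congr measurable_fun; apply/funext => x; apply: eq_integral => y _; by rewrite !funeposE.
have h : measurable_fun setT ((EFin \o F)^\-)%E by apply: measurable_funeneg; exact/measurable_EFinP.
have := (@measurable_fun_fubini_tonelli_F _ _ T (measurableTypeR R) R mu
  ((EFin \o F)^\-)%E h (funeneg_ge0 _)).
by congr measurable_fun; apply/funext => x; apply: eq_integral => y _; rewrite !funenegE.
Qed.

Lemma measurable_trunc (f : R -> R) (e : R) : measurable_fun [set: R] f ->
  measurable_fun [set: R] (trunc f e).
Proof.
move=> mf; have -> : trunc f e = (fun x => \int[mu]_y (f y * trunc_kernel e (x - y))).
  by apply/funext => x; rewrite truncE.
apply: (measurable_Rintegral2 _ (measurableTypeR R) (fun z : R * R => f z.2 * trunc_kernel e (z.1 - z.2))).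
apply: measurable_funM; first exact: (measurableT_comp mf measurable_snd).
apply: (measurableT_comp (measurable_trunc_kernel e)).
by apply: measurable_funB; [exact: measurable_fst|exact: measurable_snd].
Qed.

Lemma Rintegral_opp (f : R -> R) : measurable_fun setT f ->
  \int[mu]_x f (- x) = \int[mu]_x f x.
Proof.
move=> mf; rewrite /Rintegral -(integral_reflect (EFin \o f) 0).
  by congr fine; apply: eq_integral => x _; rewrite /= sub0r.
exact/measurable_EFinP.
Qed.

Lemma trunc_kernelN (e s : R) : trunc_kernel e (- s) = - trunc_kernel e s.
Proof.
by rewrite /trunc_kernel normrN; case: ifP => _; rewrite ?invrN ?oppr0.
Qed.

Lemma trunc_opp (f : R -> R) (e x : R) : 0 < e -> mu.-integrable setT (EFin \o f) ->
  trunc (fun y => f (- y)) e (- x) = - trunc f e x.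
Proof.
move=> e0 fi; rewrite !truncE.
have mf : measurable_fun setT f by apply/measurable_EFinP; exact: measurable_int fi.
rewrite -[RHS]mulN1r -[RHS]RintegralZl//; last exact: integrable_trunc.
pose g := fun y => f y * trunc_kernel e (- x + y).
transitivity (\int[mu]_y g (- y)).
  by apply: eq_Rintegral => y _; rewrite /g.
rewrite Rintegral_opp; last first.
  apply: measurable_funM => //; apply: (measurableT_comp (measurable_trunc_kernel e)).
  exact: measurable_funD.
apply: eq_Rintegral => y _; rewrite /g mulN1r -mulrN -trunc_kernelN; congr (_ * trunc_kernel _ _); ring.
Qed.

End Truncated.

(** * Weak-type bounds on sets *)

Section WeakType.
Context {R : realType}.
Local Notation mu := (@lebesgue_measure R).

Definition interlaced (a b : nat -> R) :=
  (forall i, a i < b i) /\ (forall i, b i < a i.+1).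

(** The Poisson integral of an interval is the angle under which it is seen from
    [x + i e], and the angles of disjoint intervals add up to at most a flat angle. *)
Lemma steps_poisson_le_pi n (a b : nat -> R) (e x : R) : interlaced a b -> 0 < e ->
  (\int[mu]_t (steps n a b t * poisson e (x - t))%:E <= pi%:E)%E.
Proof.
move=> [ab ba] e0.
have cP := continuous_reflect (poisson e) x (continuous_poisson e e0).
have dP (t : R) : is_derive t 1 (angle x e) (poisson e (x - t)) by exact: is_derive_angle.
rewrite (integral_steps n a b (fun t => poisson e (x - t)) (angle x e) (fun i _ => ab i) cP dP).
rewrite lee_fin.
have am u v : u <= v -> angle x e u <= angle x e v.
  by move=> uv; apply: le_atan; rewrite ler_pM2r ?invr_gt0// lerD2r.
have st k : \sum_(i < k) (angle x e (b i) - angle x e (a i)) <= angle x e (a k) - angle x e (a 0%N).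
  elim: k => [|k IH]; first by rewrite big_ord0 subrr.
  rewrite big_ord_recr/=; have := am _ _ (ltW (ba k)); lra.
apply: (le_trans (st n)).
have := atan_ltpi2 ((a n - x) / e); have := atan_gtNpi2 ((a 0%N - x) / e).
rewrite -/(angle x e _) -/(angle x e (a n)); lra.
Qed.

(** The first term bounds the conjugate Poisson part and the second the Poisson part,
    each at level [l / 2]. The Poisson part never exceeds [pi], so for [l > 2 * pi]
    the first term is alone and decays exponentially; this decay gives all exponents
    above 1 later. *)
Definition weakc (l : R) : R :=
  15 * (2 * expR (l / 2) / (expR (l / 2) ^+ 2 - 1)) + (if l <= 2 * pi then 15 * pi / l else 0).

Lemma weakc_ge0 l : 0 < l -> 0 <= weakc l.
Proof.
move=> l0; apply: addr_ge0.
  rewrite mulr_ge0// divr_ge0 ?mulr_ge0 ?expR_ge0// subr_ge0 exprn_ege1//.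
  by rewrite ltW// expR_gt1 divr_gt0.
by case: ifP => // _; rewrite divr_ge0 ?mulr_ge0 ?pi_ge0// ltW.
Qed.

(** [trunc] is at most the conjugate Poisson integral plus the Poisson integral, and
    one of the two is at least [l / 2]. *)
Lemma weak_steps n (a b : nat -> R) (l : R) : interlaced a b -> 0 < l ->
  exists B : set R, [/\ measurable B,
    (mu B <= (weakc l * \sum_(i < n) (b i - a i))%:E)%E &
    forall x e, 0 < e -> l <= trunc (steps n a b) e x -> B x].
Proof.
move=> iab l0; have [ab ba] := iab.
case: n => [|n].
  exists set0; split => //; first by rewrite measure0 big_ord0 mulr0.
  move=> x e e0; rewrite truncE (_ : \int[mu]_y _ = 0).
    by rewrite leNgt l0.
  rewrite -[RHS](@Rintegral_set0 _ _ R mu (cst 0)) /Rintegral integral_set0.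
  by congr fine; rewrite integral0_eq// => y _; rewrite /steps big_ord0 mul0r.
set h := steps n.+1 a b.
have l20 : 0 < l / 2 by rewrite divr_gt0.
have [B1 [mB1 hB1 B1P]] := boole_weak n.+1 a b (l / 2) isT ab ba l20.
have lh : locally_integrable [set: R] h.
  by apply: open_integrable_locally; [exact: openT|exact: integrable_steps1].
(* below this level, [poisson_le_maximal] gives at most [2 * pi * c = 2 * l / 5 < l / 2] *)
pose c := l / (5 * pi).
have pi0 : 0 < pi :> R := pi_gt0 R.
have c0 : 0 < c by rewrite divr_gt0// mulr_gt0.
pose B2 := if l <= 2 * pi then [set x | (HL_maximal h x > c%:E)%E] else set0.
have mB2 : measurable B2.
  rewrite /B2; case: ifP => // _.
  rewrite -[X in measurable X]setTI; apply: emeasurable_fun_o_infty => //.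
  exact: measurable_HL_maximal.
have S0 : 0 <= \sum_(i < n.+1) (b i - a i).
  by apply: sumr_ge0 => i _; rewrite subr_ge0 ltW.
exists (B1 `|` B2); split; first exact: measurableU.
- apply: (le_trans (measureU2 mu mB1 mB2)).
  rewrite /weakc mulrDl EFinD; apply: leeD => //.
  rewrite /B2; case: ifP => l2; last by rewrite measure0 mul0r.
  apply: (le_trans (maximal_inequality lh c0)).
  under eq_integral do rewrite /= ger0_norm ?steps_ge0//.
  rewrite integral_steps1// -EFinM lee_fin le_eqVlt; apply/orP; left; apply/eqP.
  congr (_ * _); rewrite /c; move: pi0; move: (pi : R) => P P0; field.
  by rewrite (gt_eqF P0) (gt_eqF l0).
move=> x e e0 hl; apply: contrapT => /not_orP[nB1 nB2].
have lt1 : (\int[mu]_t (h t * conj_poisson e (x - t))%:E < (l / 2)%:E)%E.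
  by rewrite ltNge; apply/negP => H; apply: nB1; exact: B1P H.
have lt2 : (\int[mu]_t (h t * poisson e (x - t))%:E < (l / 2)%:E)%E.
  move: nB2; rewrite /B2; case: (leP l (2 * pi)) => l2; last first.
    move=> _; apply: le_lt_trans (steps_poisson_le_pi n.+1 a b e x iab e0) _.
    rewrite lte_fin; lra.
  move=> /negP; rewrite -leNgt => hM.
  have := poisson_le_maximal h e x c e0 (measurable_steps _ _ _) (ltW c0) hM.
  under eq_integral do rewrite ger0_norm ?steps_ge0//.
  move=> /le_lt_trans; apply; rewrite lte_fin /c.
  have -> : 2 * pi * (l / (5 * pi)) = 2 * l / 5 by move: pi0; move: (pi : R) => P P0; field; exact: lt0r_neq0.
  lra.
have ih : mu.-integrable setT (EFin \o h) by exact: integrable_steps1.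
have i1 : mu.-integrable setT (fun t => (h t * conj_poisson e (x - t))%:E).
  by apply: integrable_bounded_kernel => //; [exact: measurable_conj_poisson|
    move=> s; exact: conj_poisson_le].
have i2 : mu.-integrable setT (fun t => (h t * poisson e (x - t))%:E).
  by apply: integrable_bounded_kernel => //; [exact: measurable_poisson|
    move=> s; exact: poisson_le].
have i3 := integrable_trunc h e x e0 ih.
have : ((trunc h e x)%:E < l%:E)%E.
  rewrite truncE fineK; last exact: integrable_fin_num.
  apply: (@le_lt_trans _ _ (\int[mu]_t ((h t * conj_poisson e (x - t))%:E + (h t * poisson e (x - t))%:E))%E).
    apply: le_integral => //; first exact: integrableD.
    move=> t _; rewrite -EFinD lee_fin -mulrDr ler_wpM2l ?steps_ge0//.
    rewrite -lerBlDl; apply: le_trans (trunc_kernel_poisson _ (x - t) e0).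
    exact: ler_norm.
  rewrite integralD//; have -> : l = l / 2 + l / 2 by field.
  by rewrite EFinD; exact: lteD.
by rewrite lte_fin ltNge hl.
Qed.

Lemma steps_le1 n (a b : nat -> R) t : interlaced a b -> steps n a b t <= 1.
Proof.
move=> [ab ba].
suff : steps n a b t <= 1 /\ (a n <= t -> steps n a b t = 0) by case.
elim: n => [|n [IH1 IH0]]; first by rewrite /steps big_ord0.
rewrite /steps big_ord_recr/= -/(steps n a b t) indicE mem_setE in_itv/=.
have [ant|tan] := leP (a n) t.
  rewrite (IH0 ant) add0r; split; first by case: (t <= b n); rewrite ?lexx.
  by move=> at1; rewrite leNgt (lt_le_trans (ba n) at1).
rewrite addr0; split => // ant.
by move: tan; rewrite ltNge (ltW (lt_le_trans (lt_trans (ab n) (ba n)) ant)).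
Qed.

(** The selected cells of a grid of mesh [h], each shortened by [d]: without the gap,
    adjacent cells would share an endpoint, which [interlaced] excludes. *)
Lemma grid_steps (h d : R) (k : nat) (p : R) (sel : nat -> bool) : 0 < d -> d < h ->
  exists n a b, [/\ interlaced a b, p <= a 0%N & forall t, steps n a b t =
    \sum_(j < k) (sel j)%:R * \1_(`[p + j%:R * h, p + j.+1%:R * h - d]%classic) t].
Proof.
move=> d0 dh; elim: k p sel => [|k IH] p sel.
  (* [interlaced] bears on all indices, so the intervals are continued beyond [n] *)
  exists 0%N, (fun i => p + 2 * i%:R), (fun i => p + 2 * i%:R + 1); split.
  - split => i; first by rewrite ltrDl.
    by rewrite -natr1; lra.
  - by rewrite mulr0 addr0.
  - by move=> t; rewrite /steps !big_ord0.
have [n [a [b [[ab ba] pa st]]]] := IH (p + h) (sel \o S).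
have st' t : \sum_(j < k.+1) (sel j)%:R * \1_(`[p + j%:R * h, p + j.+1%:R * h - d]%classic) t =
    (sel 0%N)%:R * \1_(`[p, p + h - d]%classic) t + steps n a b t.
  rewrite big_ord_recl/= mul0r addr0 mul1r st; congr (_ + _); apply: eq_bigr => j _.
  rewrite /bump/= add1n.
  have -> : p + j.+1%:R * h = p + h + j%:R * h by rewrite -natr1; ring.
  by have -> : p + j.+2%:R * h - d = p + h + j.+1%:R * h - d by rewrite -(natr1 j.+1); ring.
case s0 : (sel 0%N); last first.
  exists n, a, b; split => //; first by apply: le_trans pa; lra.
  by move=> t; rewrite st' s0 mul0r add0r.
exists n.+1, (fun i => if i is i'.+1 then a i' else p),
  (fun i => if i is i'.+1 then b i' else p + h - d); split => //.
- split; case => [|i] //; first by lra.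
  by apply: lt_le_trans pa; lra.
- by move=> t; rewrite st' s0 mul1r /steps big_ord_recl.
Qed.

Lemma compact_margin (K U : set R) : compact K -> open U -> K `<=` U ->
  exists2 h : R, 0 < h & forall y t, K y -> `|y - t| < h -> U t.
Proof.
move=> cK oU KU.
have /compact_near_coveringP nc := cK.
have := nc R (0^'+) (fun h y => forall t, `|y - t| < h -> U t) _ _.
case.
- move=> x /KU Ux.
  have [r /= r0 rU] := (nbhs_ballP x U).1 (open_nbhs_nbhs (conj oU Ux)).
  exists (ball x (r / 2), [set e | e < r / 2]).
    split => /=; first by apply: nbhsx_ballx; rewrite divr_gt0.
    by apply: nbhs_right_lt; rewrite divr_gt0.
  move=> [y e] /= [xy er] t yt; apply: rU; rewrite /ball/= (splitr r).
  have -> : x - t = (x - y) + (y - t) by ring.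
  by rewrite (le_lt_trans (ler_normD _ _))// ltrD// (lt_trans yt).
move=> h0 /= h00 hK; exists (h0 / 2); first by rewrite divr_gt0.
move=> y t Ky; apply: (hK (h0 / 2)) => //=; last by rewrite divr_gt0.
rewrite sub0r normrN gtr0_norm ?divr_gt0// ltr_pdivrMr// ltr_pMr// ltr1n//.
Qed.

(** [E] lies between a compact set [K] and an open set [U] of almost the same measure.
    The cells that meet [K] stay in [U] when the mesh is below the distance from [K]
    to the complement of [U], so the error is carried by [E `\` K], [U `\` E] and the
    gaps of length [d] between the cells. *)
Lemma approx_steps (E : set R) (eta : R) : measurable E -> (mu E < +oo)%E -> 0 < eta ->
  exists n a b, interlaced a b /\
    (\int[mu]_t `|\1_E t - steps n a b t|%:E <= eta%:E)%E.
Proof.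
move=> mE Efin eta0; have e3 : 0 < eta / 3 by rewrite divr_gt0.
have [U [oU EU hU]] := lebesgue_regularity_outer mE Efin e3.
have [K [cK KE hK]] := lebesgue_regularity_inner mE Efin e3.
have [h h0 hm] := compact_margin K U cK oU (subset_trans KE EU).
have [M [_ hM]] := compact_bounded cK.
pose m := Num.max M 0 + 1.
have m0 : 0 < m by rewrite ltr_wpDl// le_max lexx orbT.
have Km t : K t -> `|t| <= m.
  move=> Kt; apply: (hM m) => //.
  by rewrite (@le_lt_trans _ _ (Num.max M 0)) ?ltrDl// le_max lexx.
pose k := (Num.truncn (2 * m / h)).+1.
pose d := Num.min (h / 2) (eta / 3 / k%:R).
have d0 : 0 < d by rewrite lt_min !divr_gt0.
have dh : d < h by rewrite gt_min ltr_pdivrMr// ltr_pMr// ltr1n.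
pose p := - m.
pose sel j := `[< exists2 y, K y & p + j%:R * h <= y < p + j.+1%:R * h >].
have [n [a [b [iab _ st]]]] := grid_steps h d k p sel d0 dh.
exists n, a, b; split => //.
pose gap (j : 'I_k) := `[p + j.+1%:R * h - d, p + j.+1%:R * h]%classic : set R.
have mK : measurable K by exact: compact_measurable.
have mU : measurable U by exact: open_measurable.
have mEK : measurable (E `\` K) by exact: measurableD.
have mUE : measurable (U `\` E) by exact: measurableD.
have E1 j : p + j.+1%:R * h = p + j%:R * h + h by rewrite -natr1; ring.
have sel_in j t : sel j -> p + j%:R * h <= t < p + j.+1%:R * h -> U t.
  move=> /asboolP[y Ky /andP[y1 y2]] /andP[t1 t2]; apply: (hm y t Ky).
  by rewrite E1 in y2 t2; rewrite ltr_norml; apply/andP; split; lra.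
have S1 t := steps_le1 n a b t iab.
have S0 t := steps_ge0 n a b t.
have G0 t : 0 <= \sum_(j < k) \1_(gap j) t :> R by apply: sumr_ge0 => j _; rewrite indicE.
have pw t : `|\1_E t - steps n a b t| <=
    \1_(E `\` K) t + \1_(U `\` E) t + \sum_(j < k) \1_(gap j) t.
  rewrite !indicE; have [Et|nEt] := pselect (E t); last first.
    rewrite (memNset nEt) sub0r normrN ger0_norm//.
    rewrite memNset; last by move=> [].
    rewrite add0r; have [Ut|nUt] := pselect (U t).
      by rewrite mem_set//; apply: le_trans (S1 t) _; rewrite lerDl.
    rewrite memNset; last by move=> [].
    rewrite add0r; suff -> : steps n a b t = 0 by [].
    rewrite st big1// => j _; case sj : (sel j); last by rewrite mul0r.
    rewrite indicE mem_setE in_itv/=; case: (boolP (_ && _)) => [/andP[h1 h2]|_]; last by rewrite mulr0.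
    by exfalso; apply: nUt; apply: (sel_in j) => //; rewrite h1 (le_lt_trans h2)// gtrBl.
  rewrite (mem_set Et) (_ : true%:R = 1 :> R)// ger0_norm ?subr_ge0//.
  have [Kt|nKt] := pselect (K t); last first.
    rewrite mem_set// (_ : true%:R = 1 :> R)// -addrA; apply: (@le_trans _ _ 1).
      by rewrite gerDl oppr_le0.
    by rewrite lerDl addr_ge0.
  rewrite memNset; last by move=> [].
  rewrite memNset; last by move=> [].
  rewrite !add0r.
  have tp0 : 0 <= (t - p) / h.
    apply: divr_ge0; last exact: ltW.
    by rewrite /p; have := Km t Kt; rewrite ler_norml => /andP[]; lra.
  pose j0 := Num.truncn ((t - p) / h).
  have /andP[] := truncn_itv tp0; rewrite -/j0 ler_pdivlMr// ltr_pdivrMr// => j1 j2.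
  have j0k : (j0 < k)%N.
    rewrite ltnS; apply: le_truncn; rewrite ler_pM2r ?invr_gt0// /p.
    by have := Km t Kt; rewrite ler_norml => /andP[_]; lra.
  have sj0 : sel j0 by apply/asboolP; exists t => //; apply/andP; split; lra.
  have [tl|tg] := leP t (p + j0.+1%:R * h - d).
    have : 1 <= steps n a b t.
      rewrite st (bigD1 (Ordinal j0k))//= sj0 mul1r indicE mem_setE in_itv/= tl andbT.
      rewrite (_ : p + j0%:R * h <= t); last by lra.
      by rewrite lerDl; apply: sumr_ge0 => j _; rewrite indicE mulr_ge0.
    have := G0 t; lra.
  have : 1 <= \sum_(j < k) \1_(gap j) t :> R.
    rewrite (bigD1 (Ordinal j0k))//= indicE mem_setE in_itv/= (ltW tg)/=.
    rewrite (_ : t <= p + j0.+1%:R * h); last by lra.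
    by rewrite lerDl; apply: sumr_ge0 => j _; rewrite indicE.
  have := S0 t; lra.
have mgap j : measurable (gap j) by exact: measurable_itv.
have mG : measurable_fun setT (fun t => \sum_(j < k) \1_(gap j) t : R).
  by apply: measurable_sum => j; exact: measurable_indic.
apply: (@le_trans _ _ (\int[mu]_t ((\1_(E `\` K) t)%:E + ((\1_(U `\` E) t)%:E +
   \sum_(j < k) (\1_(gap j) t)%:E))%E)%E).
  apply: ge0_le_integral => //.
  - apply/measurable_EFinP/measurable_fun_normr/measurable_funB; last exact: measurable_steps.
    exact: measurable_indic.
  - by under eq_fun do rewrite sumEFin -!EFinD; apply/measurable_EFinP;
      apply: measurable_funD; [|apply: measurable_funD].
  - by move=> t _; rewrite sumEFin -!EFinD lee_fin addrA.
have i0 (A : set R) t : (0 <= (\1_A t)%:E :> \bar R)%E by rewrite lee_fin indicE.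
rewrite ge0_integralD//; last 3 first.
- by apply/measurable_EFinP; apply: measurable_indic.
- by move=> t _; rewrite adde_ge0// sume_ge0.
- by under eq_fun do rewrite sumEFin -!EFinD; apply/measurable_EFinP; apply: measurable_funD.
rewrite ge0_integralD//; last 3 first.
- by apply/measurable_EFinP; apply: measurable_indic.
- by move=> t _; rewrite sume_ge0.
- by under eq_fun do rewrite sumEFin; exact/measurable_EFinP.
rewrite ge0_integral_sum//.
rewrite !integral_indic// !setIT.
have -> : eta = eta / 3 + (eta / 3 + eta / 3) by field.
rewrite !EFinD; apply: leeD; first exact: ltW.
apply: leeD; first exact: ltW.
have -> : (\sum_(j < k) \int[mu]_t (\1_(gap j) t)%:E = \sum_(j < k) d%:E)%E.
  apply: eq_bigr => j _; have mgj := mgap j.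
  rewrite integral_indic// setIT /gap /= lebesgue_measure_itv /= lte_fin.
  rewrite ltrBlDr ltrDl d0 -EFinD; congr (_%:E); ring.
rewrite sumEFin lee_fin sumr_const card_ord -(mulr_natr d k) -ler_pdivlMr ?ltr0n//.
  by rewrite /d ge_min lexx orbT.
by move=> j; apply/measurable_EFinP; apply: measurable_indic; exact: mgap.
Qed.

Lemma integrable_indic_fin (E : set R) : measurable E -> (mu E < +oo)%E ->
  mu.-integrable setT (EFin \o (\1_E : R -> R)).
Proof.
move=> mE Efin; apply/integrableP; split; first exact/measurable_EFinP.
under eq_integral do rewrite /= ger0_norm ?indicE//.
have -> : (\int[mu]_x ((x \in E)%:R : R)%:E = mu E)%E; last exact: Efin.
transitivity (\int[mu]_x (\1_E x)%:E)%E; last by rewrite integral_indic// setIT.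
by apply: eq_integral => x _; rewrite indicE.
Qed.

(** The finitely many radii are bounded below by some [m], hence a perturbation of
    the indicator that is small in L^1 moves all the truncations by at most [l / 2]
    everywhere. The bound for step functions at level [l / 2] then applies. *)
(** The kernel is odd, so reflecting [E] changes the sign of the truncations. *)
Lemma weak_set_onesided (E : set R) (s : seq R) (l : R) : measurable E ->
  (mu E < +oo)%E -> 0 < l -> all (fun e => 0 < e) s ->
  (mu [set x | has (fun e => (l <= trunc (\1_E) e x)%R) s] <= (weakc (l / 2))%:E * mu E)%E.
Proof.
move=> mE Efin l0 s0.
have l20 : 0 < l / 2 by rewrite divr_gt0.
have w0 := weakc_ge0 (l / 2) l20.
have Ef : mu E \is a fin_num by rewrite ge0_fin_numE.
have iE : mu.-integrable setT (EFin \o (\1_E : R -> R)) by exact: integrable_indic_fin.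
apply/lee_addgt0Pr => eps eps0.
have [m m0 hm] : exists2 m : R, 0 < m & forall e, e \in s -> m <= e.
  elim: s s0 {l0} => [_|e s IH /= /andP[e0 /IH[m m0 hm]]]; first by exists 1.
  exists (Num.min e m); first by rewrite lt_min e0.
  move=> f; rewrite inE => /predU1P[->|/hm mf]; first by rewrite ge_min lexx.
  by rewrite ge_min mf orbT.
pose eta := Num.min (m * (l / 2)) (eps / (weakc (l / 2) + 1)).
have w1 : 0 < weakc (l / 2) + 1 by rewrite ltr_wpDl.
have eta0 : 0 < eta by rewrite lt_min mulr_gt0//= divr_gt0.
have [n [a [b [iab hap]]]] := approx_steps E eta mE Efin eta0.
have [ab ba] := iab.
have [B [mB hB BP]] := weak_steps n a b (l / 2) iab l20.
have is_ := integrable_steps1 n a b.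
have sub : [set x | has (fun e => (l <= trunc (\1_E) e x)%R) s] `<=` B.
  move=> x /= /hasP[e es le]; have e0 : 0 < e := allP s0 e es.
  apply: (BP x e e0).
  have := trunc_le (\1_E \- steps n a b) e x e0 (integrableB measurableT iE is_).
  rewrite -truncB// => h; have {}h := le_trans h (lee_wpmul2l _ hap).
  have {h} : (`|trunc (\1_E) e x - trunc (steps n a b) e x| <= e^-1 * eta)%R.
    by rewrite -lee_fin EFinM; apply: h; rewrite lee_fin invr_ge0 ltW.
  have : e^-1 * eta <= l / 2.
    rewrite ler_pdivrMl//; apply: (@le_trans _ _ (m * (l / 2))); first by rewrite ge_min lexx.
    by rewrite ler_pM2r// hm.
  rewrite ler_norml => h1 /andP[_ h2]; lra.
apply: (@le_trans _ _ (mu B)); first by apply: le_outer_measure.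
apply: le_trans hB _.
have hS : ((\sum_(i < n) (b i - a i))%:E <= mu E + eta%:E)%E.
  rewrite -integral_steps1//.
  apply: (@le_trans _ _ (\int[mu]_t ((\1_E t)%:E + `|\1_E t - steps n a b t|%:E))%E).
    apply: ge0_le_integral => //.
    - by move=> t _; rewrite lee_fin steps_ge0.
    - by apply/measurable_EFinP; apply: measurable_steps.
    - apply: emeasurable_funD; apply/measurable_EFinP; first exact: measurable_indic.
      apply: measurable_fun_normr; apply: measurable_funB; last exact: measurable_steps.
      exact: measurable_indic.
    - move=> t _; rewrite -EFinD lee_fin -lerBlDl distrC; exact: ler_norm.
  rewrite ge0_integralD//; last 2 first.
  - by apply/measurable_EFinP; apply: measurable_indic.
  - apply/measurable_EFinP/measurable_fun_normr/measurable_funB; last exact: measurable_steps.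
    exact: measurable_indic.
  by apply: leeD => //; rewrite integral_indic ?setIT.
rewrite EFinM; apply: le_trans (lee_wpmul2l _ hS) _; first by rewrite lee_fin.
rewrite ge0_muleDr//; last by rewrite lee_fin ltW.
apply: leeD => //.
rewrite -EFinM lee_fin; apply: (@le_trans _ _ (weakc (l / 2) * (eps / (weakc (l / 2) + 1)))).
  by rewrite ler_wpM2l// ge_min lexx orbT.
rewrite mulrCA ler_piMr ?(ltW eps0)// ler_pdivrMr// mul1r lerDl//.
Qed.

Lemma measurable_has (P : R -> R -> bool) (s : seq R) :
  (forall e, measurable [set x | P e x]) -> measurable [set x | has (P ^~ x) s].
Proof.
move=> mP; elim: s => [|e s IH].
  by rewrite (_ : [set x | _] = set0)//; apply/seteqP; split.
rewrite (_ : [set x | _] = [set x | P e x] `|` [set x | has (P ^~ x) s]).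
  exact: measurableU.
by apply/seteqP; split => x /=; [move=> /orP|move=> h; apply/orP].
Qed.

Lemma weak_set (E : set R) (s : seq R) (l : R) : measurable E ->
  (mu E < +oo)%E -> 0 < l -> all (fun e => 0 < e) s ->
  (mu [set x | has (fun e => (l <= `|trunc (\1_E) e x|)%R) s] <= (2 * weakc (l / 2))%:E * mu E)%E.
Proof.
move=> mE Efin l0 s0.
have iE : mu.-integrable setT (EFin \o (\1_E : R -> R)) by exact: integrable_indic_fin.
have h1 := weak_set_onesided E s l mE Efin l0 s0.
pose E' : set R := -%R @^-1` E.
have mE' : measurable E'.
  rewrite -[E']setTI; exact: (oppr_measurable measurableT).
have muE' : mu E' = mu E by exact: lebesgue_measureN.
have h2 : (mu [set x | has (fun e => (l <= - trunc (\1_E) e x)%R) s] <= (weakc (l / 2))%:E * mu E)%E.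
  have := weak_set_onesided E' s l mE'; rewrite muE' => /(_ Efin l0 s0).
  apply: le_trans.
  pose G := [set x | has (fun e => (l <= trunc (\1_E') e x)%R) s].
  have mG : measurable G.
    apply: measurable_has => e.
    by apply: measurable_ge; apply: measurable_trunc; apply: measurable_indic.
  have := @lebesgue_measureN R G mG; rewrite /pushforward -/G => <-.
  apply: le_outer_measure.
  move=> x /=; rewrite /G /= => /hasP[e es le]; apply/hasP; exists e => //.
  by rewrite (_ : \1_E' = (fun y => \1_E (- y)))// trunc_opp//; exact: (allP s0).
apply: (@le_trans _ _ (mu ([set x | has (fun e => (l <= trunc (\1_E) e x)%R) s] `|`
   [set x | has (fun e => (l <= - trunc (\1_E) e x)%R) s]))).
  apply: le_outer_measure => x /= /hasP[e es]; rewrite ler_normr => /orP[h|h].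
    by left; apply/hasP; exists e.
  by right; apply/hasP; exists e.
apply: le_trans (measureU2 _ _ _) _.
- by apply: measurable_has => e; by apply: measurable_ge; apply: measurable_trunc; apply: measurable_indic.
- apply: measurable_has => e; apply: measurable_ge; apply: measurable_funN.
  by apply: measurable_trunc; apply: measurable_indic.
rewrite mulr2n mulrDl mul1r EFinD ge0_muleDl ?lee_fin ?weakc_ge0 ?divr_gt0//.
exact: leeD.
Qed.

End WeakType.

(** * Strong-type bounds on sets *)

Section StrongSets.
Context {R : realType}.
Local Notation mu := (@lebesgue_measure R).

(** A finite list of radii keeps the radii away from 0, which [weak_set] requires;
    since no bound depends on the list, [maximal_truncation] can pass to all radii. *)
Definition maxtrunc (s : seq R) (f : R -> R) (x : R) : R :=
  \big[Num.max/0]_(e <- s) `|trunc f e x|.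

Lemma maxtrunc_ge0 s f x : 0 <= maxtrunc s f x.
Proof.
rewrite /maxtrunc; elim: s => [|e s IH]; first by rewrite big_nil.
by rewrite big_cons le_max normr_ge0.
Qed.

Lemma le_maxtrunc s f x e : e \in s -> `|trunc f e x| <= maxtrunc s f x.
Proof.
rewrite /maxtrunc; elim: s => //= e' s IH; rewrite inE big_cons le_max => /predU1P[->|/IH ->].
  by rewrite lexx.
by rewrite orbT.
Qed.

Lemma maxtrunc_le s f x (c : R) : 0 <= c -> (forall e, e \in s -> `|trunc f e x| <= c) ->
  maxtrunc s f x <= c.
Proof.
move=> c0; rewrite /maxtrunc; elim: s => [|e s IH] h; first by rewrite big_nil.
rewrite big_cons ge_max h ?mem_head//=; apply: IH => e' es; apply: h.
by rewrite inE es orbT.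
Qed.

Lemma maxtrunc_has s f x (l : R) : 0 < l ->
  (l <= maxtrunc s f x) = has (fun e => l <= `|trunc f e x|) s.
Proof.
move=> l0; rewrite /maxtrunc; elim: s => [|e s IH]; first by rewrite big_nil leNgt l0.
by rewrite big_cons le_max IH.
Qed.

Lemma measurable_bigmax d (T : measurableType d) (s : seq R) (h : R -> T -> R) :
  (forall e, measurable_fun setT (h e)) ->
  measurable_fun setT (fun x => \big[Num.max/0]_(e <- s) h e x).
Proof.
move=> mh; elim: s => [|e s IH].
  by under eq_fun do rewrite big_nil; exact: measurable_cst.
by under eq_fun do rewrite big_cons; exact: measurable_maxr.
Qed.

Lemma measurable_maxtrunc (s : seq R) (f : R -> R) : measurable_fun setT f ->
  measurable_fun setT (maxtrunc s f).
Proof.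
move=> mf; apply: (measurable_bigmax _ R s (fun e x => `|trunc f e x|)) => e.
by apply: measurable_fun_normr; apply: measurable_trunc.
Qed.

Lemma expR1_le4 : expR 1 <= 4 :> R.
Proof.
have h : 1 / 2 <= expR (- (1 / 2)) :> R by apply: le_trans (expR_ge1Dx _); lra.
have -> : expR 1 = expR (1 / 2) * expR (1 / 2) :> R by rewrite -expRD; congr expR; field.
have e0 : 0 < expR (1 / 2) :> R by exact: expR_gt0.
have : expR (1 / 2) * expR (- (1 / 2)) = 1 :> R by rewrite expRN mulfV ?gt_eqF.
by move: e0 h; move: (expR _) (expR _) => u v; nra.
Qed.

Lemma expR_ge_powR (u q : R) : 0 <= u -> 0 < q -> (u / q) `^ q <= expR u.
Proof.
move=> u0 q0; have h : u / q <= expR (u / q).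
  by apply: le_trans (expR_ge1Dx _); rewrite lerDr.
have := ge0_ler_powR (ltW q0) (divr_ge0 u0 (ltW q0)) _ h.
rewrite nnegrE expR_ge0 => /(_ isT) /le_trans; apply.
by rewrite -expRM divfK// gt_eqF.
Qed.

Lemma weakc_small (l : R) : 0 < l -> l <= 1 -> weakc l <= (120 + 15 * pi) * l^-1.
Proof.
move=> l0 l1; rewrite [leRHS]mulrDl /weakc; apply: lerD; last first.
  by case: ifP => _ //; rewrite mulr_ge0 ?mulr_ge0 ?pi_ge0// invr_ge0 ltW.
set m := expR (l / 2).
have m1 : 1 + l / 2 <= m by exact: expR_ge1Dx.
have m4 : m <= 4.
  apply: (@le_trans _ _ (expR 1)); last exact: expR1_le4.
  by rewrite ler_expR; lra.
have d0 : 0 < m ^+ 2 - 1 by rewrite subr_gt0 exprn_egt1//; lra.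
have -> : 15 * (2 * m / (m ^+ 2 - 1)) = (30 * m) / (m ^+ 2 - 1) by field; rewrite gt_eqF.
rewrite ler_pdivrMr// mulrAC ler_pdivlMr//.
have : l <= m ^+ 2 - 1 by rewrite expr2; nra.
nra.
Qed.

(** Exponential decay beats any power, and the second term of [weakc] has bounded
    support. *)
Lemma weakc_large (q : R) : 0 < q -> exists2 C : R, 0 <= C &
  forall l, 1 / 2 <= l -> weakc l <= C * l `^ (- q).
Proof.
move=> q0.
have pi0 : 0 < pi :> R := pi_gt0 R.
exists (150 * (2 * q) `^ q + 30 * pi * (2 * pi) `^ q).
  by rewrite addr_ge0 ?mulr_ge0 ?powR_ge0// ltW.
move=> l l1; have l0 : 0 < l by lra.
rewrite [leRHS]mulrDl /weakc; apply: lerD.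
  set m := expR (l / 2).
  have m0 : 0 < m by exact: expR_gt0.
  have m1 : 5 / 4 <= m by apply: le_trans (expR_ge1Dx _); lra.
  have d0 : 0 < m ^+ 2 - 1 by rewrite subr_gt0 exprn_egt1//; lra.
  apply: (@le_trans _ _ (150 * m^-1)).
    have -> : 15 * (2 * m / (m ^+ 2 - 1)) = (30 * m) / (m ^+ 2 - 1) by field; rewrite gt_eqF.
    rewrite ler_pdivrMr// -mulrA [m^-1 * _]mulrC mulrA ler_pdivlMr//.
    rewrite expr2; nra.
  rewrite -mulrA ler_pM2l//.
  have h := expR_ge_powR (l / 2) q (ltac:(lra)) q0.
  rewrite -[leRHS]invrK lef_pV2 ?posrE ?invr_gt0 ?mulr_gt0 ?powR_gt0 ?mulr_gt0//.
  apply: le_trans h; rewrite powRN invfM invrK -powRV; last by rewrite mulr_ge0 ?ltW.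
  rewrite -powRM ?invr_ge0 ?mulr_ge0//; try exact: ltW.
  by rewrite le_eqVlt; apply/orP; left; apply/eqP; congr (_ `^ _); field; rewrite gt_eqF.
case: ifPn => [l2|_]; last by rewrite mulr_ge0 ?powR_ge0// mulr_ge0 ?powR_ge0 ?mulr_ge0 ?ltW.
apply: (@le_trans _ _ (30 * pi)).
  rewrite ler_pdivrMr//; nra.
rewrite -mulrA ler_peMr ?mulr_ge0 ?(ltW pi0)//.
rewrite powRN ler_pdivlMr ?powR_gt0// mul1r.
by apply: ge0_ler_powR => //; rewrite ?nnegrE ltW// mulr_gt0.
Qed.

(** [weakc (l / 2)] is [O(1 / l)] near 0 and decays faster than any power, so
    [strong_of_weak] applies with the exponents 1 and [2 * p], which enclose
    [(p + 1) / 2] and [2 * p - 1]. *)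
Lemma strong_set (p : R) : 1 < p -> exists2 C : R, 0 <= C &
  forall (E : set R) (s : seq R) (a : R), measurable E -> all (fun e => 0 < e) s ->
    (a = (p + 1) / 2 \/ a = 2 * p - 1) ->
    (mu E < +oo)%E ->
    (\int[mu]_x (maxtrunc s \1_E x `^ a)%:E <= C%:E * mu E)%E.
Proof.
move=> p1.
have pi0 : 0 < pi :> R := pi_gt0 R.
have [C2 C20 hC2] := weakc_large (2 * p) (ltac:(lra)).
pose C1 := 4 * (120 + 15 * pi) + 2 * C2 * (2^-1 `^ (- (2 * p))).
have C10 : 0 <= C1 by rewrite addr_ge0 ?mulr_ge0 ?powR_ge0 ?addr_ge0 ?mulr_ge0// ltW.
pose K a := a * C1 * ((a - 1)^-1 + (2 * p - a)^-1).
exists (Num.max (K ((p + 1) / 2)) (Num.max (K (2 * p - 1)) 0)).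
  by rewrite !le_max lexx !orbT.
move=> E s a mE s0 ha Efin.
have a1 : 1 < a by case: ha => ->; lra.
have a2 : a < 2 * p by case: ha => ->; lra.
have mT : measurable_fun setT (maxtrunc s \1_E).
  by apply: measurable_maxtrunc; exact: measurable_indic.
have key (l : R) : 0 < l -> (mu [set x | (l <= maxtrunc s \1_E x)%R] <= (2 * weakc (l / 2))%:E * mu E)%E.
  move=> l0; have := weak_set E s l mE Efin l0 s0.
  by congr (mu _ <= _)%E; apply/seteqP; split => x /=; rewrite maxtrunc_has.
apply: (@le_trans _ _ ((K a)%:E * mu E)%E); last first.
  rewrite lee_wpmul2r// lee_fin.
  by case: ha => ->; rewrite !le_max lexx ?orbT.
apply: (strong_of_weak (maxtrunc s \1_E) (mu E) C1 a 1 (2 * p)) => //.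
- exact: maxtrunc_ge0.
- lra.
- by rewrite a1.
- move=> l /andP[l0 l1]; apply: (le_trans (key l l0)); rewrite lee_wpmul2r// lee_fin.
  have := weakc_small (l / 2) (ltac:(lra)) (ltac:(lra)).
  rewrite powR_inv1; last exact: ltW.
  rewrite invfM invrK.
  have li : 0 < l^-1 by rewrite invr_gt0.
  have : 0 <= 2 * C2 * 2^-1 `^ (- (2 * p)) by rewrite !mulr_ge0 ?powR_ge0.
  rewrite /C1; nra.
- move=> l l1; have l0 : 0 < l by lra.
  apply: (le_trans (key l l0)); rewrite lee_wpmul2r// lee_fin.
  have := hC2 (l / 2) (ltac:(lra)).
  rewrite powRM ?invr_ge0 ?(ltW l0)//.
  have : 0 <= l `^ (- (2 * p)) by exact: powR_ge0.
  rewrite /C1; nra.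
Qed.

End StrongSets.

(** * Real-valued L^p functions *)

Section MemLp.
Context {R : realType}.
Local Notation mu := (@lebesgue_measure R).
Implicit Types (f g : R -> R) (p e x : R).

Definition memLp p f := measurable_fun [set: R] f /\
  (\int[mu]_x (`|f x| `^ p)%:E < +oo)%E.

Lemma powRD_le p (a b : R) : 0 < p -> 0 <= a -> 0 <= b ->
  (a + b) `^ p <= 2 `^ p * (a `^ p + b `^ p).
Proof.
move=> p0; wlog ab : a b / a <= b.
  move=> h a0 b0; have [ab|/ltW ba] := leP a b; first exact: h.
  by rewrite addrC [X in _ * X]addrC; apply: h.
move=> a0 b0; apply: (@le_trans _ _ (2 `^ p * b `^ p)).
  by rewrite -powRM//; apply: ge0_ler_powR; rewrite ?nnegrE ?addr_ge0 ?mulr_ge0//; lra.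
by rewrite ler_wpM2l ?powR_ge0// lerDr powR_ge0.
Qed.

Lemma measurable_normp p f : measurable_fun [set: R] f ->
  measurable_fun [set: R] (fun x => (`|f x| `^ p)%:E).
Proof.
by move=> mf; apply/measurable_EFinP; apply: measurable_fun_powR; exact: measurable_fun_normr.
Qed.

Lemma integral_normpD p f g : 0 < p -> measurable_fun [set: R] f ->
  measurable_fun [set: R] g ->
  (\int[mu]_x (`|f x + g x| `^ p)%:E <=
   (2 `^ p)%:E * (\int[mu]_x (`|f x| `^ p)%:E + \int[mu]_x (`|g x| `^ p)%:E))%E.
Proof.
move=> p0 mf mg.
rewrite -ge0_integralD//; try (by move=> x _; rewrite lee_fin powR_ge0); try exact: measurable_normp.
rewrite -ge0_integralZl//.
- apply: ge0_le_integral => //.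
  + by apply: measurable_normp; exact: measurable_funD.
  + by apply: measurable_funeM; apply: emeasurable_funD; exact: measurable_normp.
  + move=> x _; rewrite -EFinD -EFinM lee_fin.
    apply: le_trans (powRD_le p _ _ p0 (normr_ge0 (f x)) (normr_ge0 (g x))).
    apply: ge0_ler_powR; rewrite ?nnegrE ?addr_ge0//; first exact: ltW.
    exact: ler_normD.
- by apply: emeasurable_funD; exact: measurable_normp.
- by move=> x _; rewrite -EFinD lee_fin addr_ge0 ?powR_ge0.
Qed.

Lemma memLp_le p f g : 0 <= p -> memLp p f -> measurable_fun [set: R] g ->
  (forall x, `|g x| <= `|f x|) -> memLp p g.
Proof.
move=> p0 [mf fi] mg gf; split; first exact: mg.
apply: le_lt_trans fi.
apply: ge0_le_integral => //; try exact: measurable_normp.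
by move=> x _; rewrite lee_fin ge0_ler_powR ?nnegrE.
Qed.

Lemma memLpD p f g : 0 < p -> memLp p f -> memLp p g -> memLp p (fun x => f x + g x).
Proof.
move=> p0 [mf fi] [mg gi]; split; first exact: measurable_funD.
apply: le_lt_trans (integral_normpD p f g p0 mf mg) _.
apply: lte_mul_pinfty; [by rewrite lee_fin powR_ge0|by []|].
by apply: lte_add_pinfty; [exact: fi|exact: gi].
Qed.

Lemma memLpZ p (a : R) f : 0 <= p -> memLp p f -> memLp p (fun x => a * f x).
Proof.
move=> p0 [mf fi]; split; first exact: measurable_funM.
have -> : (\int[mu]_x (`|a * f x| `^ p)%:E = (`|a| `^ p)%:E * \int[mu]_x (`|f x| `^ p)%:E)%E.
  rewrite -ge0_integralZl//; last exact: measurable_normp.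
  by apply: eq_integral => x _; rewrite normrM powRM// EFinM.
by rewrite lte_mul_pinfty ?lee_fin ?powR_ge0.
Qed.

Lemma memLpN p f : memLp p f -> memLp p (fun x => - f x).
Proof.
move=> [mf fi]; split; first exact: measurable_funN.
by under eq_integral do rewrite normrN.
Qed.

Lemma memLpB p f g : 0 < p -> memLp p f -> memLp p g -> memLp p (fun x => f x - g x).
Proof. by move=> p0 lf lg; apply: (memLpD p f (fun x => - g x) p0 lf (memLpN p g lg)). Qed.

Lemma funrposneg_le_norm f x : f^\+ x <= `|f x| /\ f^\- x <= `|f x|.
Proof.
have /= <- := congr1 (fun g => g x) (funrposDneg f).
by split; [rewrite lerDl funrneg_ge0|rewrite lerDr funrpos_ge0].
Qed.

Lemma memLp_posneg p f : 0 < p -> memLp p f -> memLp p f^\+ /\ memLp p f^\-.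
Proof.
move=> p0 lf; split; apply: (memLp_le p f _ (ltW p0) lf) => [|x].
- exact: measurable_funrpos lf.1.
- by rewrite ger0_norm ?funrpos_ge0//; exact: (funrposneg_le_norm f x).1.
- exact: measurable_funrneg lf.1.
- by rewrite ger0_norm ?funrneg_ge0//; exact: (funrposneg_le_norm f x).2.
Qed.

Lemma integral_trunc_kernel_powR e q : 0 < e -> 1 < q ->
  (\int[mu]_s (`|trunc_kernel e s| `^ q)%:E < +oo)%E.
Proof.
move=> e0 q1.
pose h (s : R) : R := \1_`[e, +oo[ s * s `^ (- (q - 1) - 1).
have h0 s : 0 <= h s by rewrite /h mulr_ge0 ?powR_ge0// indicE.
have mh : measurable_fun setT h.
  by apply: measurable_funM; [exact: measurable_indic|exact: measurable_fun_powR].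
have ih : (\int[mu]_s (h s)%:E = (e `^ (- (q - 1)) / (q - 1))%:E)%E.
  rewrite -integral_powR_tail//; last lra.
  rewrite [RHS]integral_mkcond/=; apply: eq_integral => s _.
  by rewrite /h indicE patchE; case: ifP => _; rewrite ?mul1r ?mul0r.
have mhN : measurable_fun [set: R] (fun s : R => h (- s)).
  by apply: (measurableT_comp mh); exact: oppr_measurable.
have ihN : (\int[mu]_s (h (- s)%R)%:E = (e `^ (- (q - 1)) / (q - 1))%:E)%E.
  rewrite -ih -(integral_reflect (EFin \o h) 0); last exact/measurable_EFinP.
  by apply: eq_integral => s _; rewrite /= sub0r.
apply: (@le_lt_trans _ _ (\int[mu]_s ((h s)%:E + (h (- s)%R)%:E))%E).
  apply: ge0_le_integral => //.
  - by apply: measurable_normp; exact: measurable_trunc_kernel.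
  - by apply: emeasurable_funD; exact/measurable_EFinP.
  - move=> s _; rewrite -EFinD lee_fin /trunc_kernel; case: ifPn => es; last first.
      by rewrite normr0 powR0 ?addr_ge0//; apply/eqP; lra.
    have key (r : R) : e < r -> `|r^-1| `^ q <= h r.
      move=> er; rewrite /h indicE mem_setE in_itv/= (ltW er)/= mul1r.
      rewrite ger0_norm ?invr_ge0; last lra.
      rewrite powRV; last lra.
      by rewrite -powRN (_ : - (q - 1) - 1 = - q)//; ring.
    have [s0|s0] := leP 0 s.
      by move: es; rewrite ger0_norm// => /key /le_trans; apply; rewrite lerDl.
    move: es; rewrite ltr0_norm// => /key.
    by rewrite invrN normrN => /le_trans; apply; rewrite lerDr.
rewrite ge0_integralD//; try (by move=> s _; rewrite lee_fin); try exact/measurable_EFinP.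
by rewrite ih ihN -EFinD ltry.
Qed.

(** Young's inequality, since the truncated kernel has an integrable power of order
    [q > 1]. *)
Lemma integrable_truncLp p f e x : 1 < p -> 0 < e -> memLp p f ->
  mu.-integrable setT (fun y => (f y * trunc_kernel e (x - y))%:E).
Proof.
move=> p1 e0 [mf fi]; pose q := p / (p - 1).
have p10 : 0 < p - 1 by rewrite subr_gt0.
have q1 : 1 < q by rewrite /q ltr_pdivlMr// mul1r; lra.
have mk : measurable_fun [set: R] (fun y : R => trunc_kernel e (x - y)).
  by apply: (measurableT_comp (measurable_trunc_kernel e)); exact: measurable_funB.
apply/integrableP; split; first by apply/measurable_EFinP; exact: measurable_funM.
apply: (@le_lt_trans _ _ (\int[mu]_y ((`|f y| `^ p)%:E + (`|trunc_kernel e (x - y)| `^ q)%:E))%E).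
  apply: ge0_le_integral => //.
  - apply: (measurableT_comp (@abse_measurable R setT)).
    by apply/measurable_EFinP; exact: measurable_funM.
  - by apply: emeasurable_funD; exact: measurable_normp.
  - move=> y _; rewrite /= lee_fin normrM.
    have h : p^-1 + q^-1 = 1 by rewrite /q invf_div; field; rewrite gt_eqF//; lra.
    apply: le_trans (conjugate_powR (normr_ge0 _) (normr_ge0 _) _ _ h) _; try lra.
    apply: lerD; rewrite ler_pdivrMr ?ler_peMr ?powR_ge0 ?ltW//; lra.
rewrite ge0_integralD//; try (by move=> s _; rewrite lee_fin powR_ge0); try exact: measurable_normp.
apply: lte_add_pinfty; first exact: fi.
rewrite (integral_reflect (fun s => (`|trunc_kernel e s| `^ q)%:E) x).
- exact: integral_trunc_kernel_powR.
- by apply: measurable_normp; exact: measurable_trunc_kernel.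
Qed.

Lemma truncD p f g e x : 1 < p -> 0 < e -> memLp p f -> memLp p g ->
  trunc (fun y => f y + g y) e x = trunc f e x + trunc g e x.
Proof.
move=> p1 e0 lf lg; rewrite !truncE -RintegralD//; try exact: (integrable_truncLp p).
by apply: eq_Rintegral => y _; rewrite mulrDl.
Qed.

Lemma truncZ p (a : R) f e x : 1 < p -> 0 < e -> memLp p f ->
  trunc (fun y => a * f y) e x = a * trunc f e x.
Proof.
move=> p1 e0 lf; rewrite !truncE -RintegralZl//; last exact: (integrable_truncLp p).
by apply: eq_Rintegral => y _; rewrite mulrA.
Qed.

Lemma truncBLp p f g e x : 1 < p -> 0 < e -> memLp p f -> memLp p g ->
  trunc (fun y => f y - g y) e x = trunc f e x - trunc g e x.
Proof.
move=> p1 e0 lf lg; rewrite !truncE -RintegralB//; try exact: (integrable_truncLp p).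
by apply: eq_Rintegral => y _; rewrite mulrBl.
Qed.

End MemLp.

(** * Strong-type bounds on functions *)

Section StrongType.
Context {R : realType}.
Local Notation mu := (@lebesgue_measure R).
Implicit Types (f g : R -> R) (p e x : R).

Lemma fubini_real (F : R * R -> R) : measurable_fun setT F ->
  (\int[mu]_x \int[mu]_y `|F (x, y)|%:E < +oo)%E ->
  (\int[mu]_x \int[mu]_y (F (x, y))%:E = \int[mu]_y \int[mu]_x (F (x, y))%:E)%E.
Proof.
move=> mF iF; apply: (@Fubini _ _ (measurableTypeR R) (measurableTypeR R) R mu mu (EFin \o F)).
by apply/integrable12ltyP => //; exact/measurable_EFinP.
Qed.

Lemma measurable_integral2 (F : R * R -> R) : measurable_fun setT F ->
  (\int[mu]_x \int[mu]_y `|F (x, y)|%:E < +oo)%E ->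
  measurable_fun setT (fun x => \int[mu]_y (F (x, y))%:E)%E.
Proof.
move=> mF iF; apply: (@measurable_fubini_F _ _ (measurableTypeR R) (measurableTypeR R) R mu mu (EFin \o F)).
by apply/integrable12ltyP => //; exact/measurable_EFinP.
Qed.

Lemma integral_level (a : R) : 0 <= a ->
  (\int[mu]_s (\1_`]0%R, +oo[ s * (s <= a)%R%:R)%:E = a%:E)%E.
Proof.
move=> a0; have := integral_head_indic 1 a ltr01 a0; rewrite powRr1// => <-.
rewrite [RHS]integral_mkcond/=; apply: eq_integral => s _.
rewrite indicE patchE; case: ifP => _; rewrite ?mul1r ?mul0r//.
by rewrite subrr powRr0 mul1r.
Qed.

Lemma measurable_level1 (a : R) :
  measurable_fun [set: R] (fun s : R => \1_`]0%R, +oo[ s * (s <= a)%R%:R : R).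
Proof.
apply: measurable_funM; first exact: measurable_indic.
by apply: measurable_natr_bool; apply: measurable_ler.
Qed.

Lemma integrable_level (a : R) : 0 <= a ->
  mu.-integrable setT (fun s => (\1_`]0%R, +oo[ s * (s <= a)%R%:R)%:E).
Proof.
move=> a0; apply/integrableP; split; first by apply/measurable_EFinP; exact: measurable_level1.
under eq_integral do rewrite /= ger0_norm ?mulr_ge0//.
by rewrite integral_level// ltry.
Qed.

Definition level f (s : R) : R -> R := \1_[set y | s <= f y].

Lemma levelE f s y : level f s y = (s <= f y)%R%:R.
Proof. by rewrite /level indicE mem_setE. Qed.

Lemma memLp_level p f s : 0 < p -> 0 < s -> (forall y, 0 <= f y) -> memLp p f ->
  memLp p (level f s).
Proof.
move=> p0 s0 f0 lf; have mf := lf.1.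
apply: (memLp_le p (fun y => s^-1 * f y)); first exact: ltW.
- exact: (memLpZ p s^-1 f (ltW p0) lf).
- by apply: measurable_indic; exact: measurable_ge.
- move=> y; rewrite levelE normrM !ger0_norm ?invr_ge0 ?(ltW s0)//.
  rewrite ler_pdivlMl//; case: (leP s (f y)) => h; first by rewrite mulr1.
  by rewrite mulr0.
Qed.

Lemma level_finite p f s : 0 < p -> 0 < s -> (forall y, 0 <= f y) -> memLp p f ->
  (mu [set y | (s <= f y)%R] < +oo)%E.
Proof.
move=> p0 s0 f0 lf; have [_] := memLp_level p f s p0 s0 f0 lf.
have mE : measurable [set y | s <= f y] by exact: measurable_ge lf.1.
have -> : (\int[mu]_y (`|level f s y| `^ p)%:E = \int[mu]_y (\1_[set y | (s <= f y)%R] y)%:E)%E.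
  apply: eq_integral => y _; rewrite -/(level f s y) levelE.
  case: (s <= f y); first by rewrite normr1 powR1.
  by rewrite normr0 powR0// gt_eqF.
by rewrite integral_indic// setIT.
Qed.

(** [f] is the integral of [level f s] over [s > 0]; Fubini's theorem. *)
Lemma trunc_layer p f e x : 1 < p -> 0 < e -> memLp p f -> (forall y, 0 <= f y) ->
  (`|trunc f e x|%:E <=
   \int[mu]_(s in `]0%R, +oo[) `|trunc (level f s) e x|%:E)%E.
Proof.
move=> p1 e0 lf f0; have mf := lf.1; have p0 : 0 < p by lra.
pose F (z : R * R) : R := \1_`]0%R, +oo[ z.1 * (z.1 <= f z.2)%R%:R * trunc_kernel e (x - z.2).
have mF : measurable_fun setT F.
  apply: measurable_funM; last first.
    apply: (measurableT_comp (measurable_trunc_kernel e)).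
    by apply: measurable_funB => //; exact: measurable_snd.
  apply: measurable_funM.
    by apply: measurable_fun_indic; [exact: measurable_itv|exact: measurable_fst].
  apply: measurable_natr_bool; apply: measurable_ler; first exact: measurable_fst.
  by apply: measurableT_comp => //; exact: measurable_snd.
have inner (c : R) y : (\int[mu]_s (\1_`]0%R, +oo[ s * (s <= f y)%R%:R * c)%:E = (f y * c)%:E)%E.
  under eq_integral do rewrite EFinM.
  by rewrite integralZr//; [rewrite integral_level// -EFinM|exact: integrable_level].
have iK := integrable_truncLp p f e x p1 e0 lf.
have iF : (\int[mu]_s \int[mu]_y `|F (s, y)|%:E < +oo)%E.
  rewrite (tonelli_real (fun z => `|F z|)) => [|//|//]; last exact: measurable_fun_normr.
  have -> : (\int[mu]_y \int[mu]_s `|F (s, y)|%:E = \int[mu]_y `|(f y * trunc_kernel e (x - y))%:E|)%E; last first.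
    by have /integrableP[] := iK.
  apply: eq_integral => y _; rewrite /= normrM (ger0_norm (f0 y)) -inner.
  by apply: eq_integral => s _; rewrite /F/= normrM ger0_norm ?mulr_ge0// indicE.
have tE : (trunc f e x)%:E = (\int[mu]_s \int[mu]_y (F (s, y))%:E)%E.
  rewrite (fubini_real F mF iF) truncE /Rintegral fineK.
    by apply: eq_integral => y _; rewrite -inner.
  exact: integrable_fin_num.
rewrite -[leLHS]/(`|(trunc f e x)%:E|)%E tE.
apply: le_trans (@le_abse_integral _ (measurableTypeR R) R mu setT _ measurableT (measurable_integral2 F mF iF)) _.
rewrite [leRHS]integral_mkcond/= le_eqVlt; apply/orP; left; apply/eqP.
apply: eq_integral => s _; rewrite patchE; case: ifPn => [/set_mem/= s0|s0].
  rewrite in_itv/= andbT in s0.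
  have := integrable_truncLp p (level f s) e x p1 e0 (memLp_level p f s p0 s0 f0 lf).
  move=> /(integrable_fin_num measurableT) h.
  rewrite truncE /Rintegral -abse_EFin fineK//; congr (`|_|)%E; apply: eq_integral => y _.
  by rewrite /F/= levelE indicE mem_setE in_itv/= s0 mul1r.
rewrite (_ : (\int[mu]_y _ = 0)%E) ?normr0 ?abse0//.
by rewrite integral0_eq// => y _; rewrite /F/= indicE (negbTE s0) !mul0r.
Qed.

Lemma measurable_trunc_level f e : measurable_fun [set: R] f ->
  measurable_fun setT (fun z : R * R => trunc (level f z.2) e z.1).
Proof.
move=> mf; under eq_fun do rewrite truncE.
apply: (measurable_Rintegral2 _ (measurableTypeR R * measurableTypeR R)%type
  (fun w => level f w.1.2 w.2 * trunc_kernel e (w.1.1 - w.2))).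
apply: measurable_funM.
  under eq_fun do rewrite levelE.
  apply: measurable_natr_bool; apply: measurable_ler.
    exact: (measurableT_comp measurable_snd measurable_fst).
  exact: (measurableT_comp mf measurable_snd).
apply: (measurableT_comp (measurable_trunc_kernel e)).
apply: measurable_funB; last exact: measurable_snd.
exact: (measurableT_comp measurable_fst measurable_fst).
Qed.

Lemma maxtrunc_layer p f (s : seq R) x : 1 < p -> all (fun e => 0 < e) s ->
  memLp p f -> (forall y, 0 <= f y) ->
  ((maxtrunc s f x)%:E <=
   \int[mu]_(l in `]0%R, +oo[) (maxtrunc s (level f l) x)%:E)%E.
Proof.
move=> p1 + lf f0; have mf := lf.1.
have mlev e : measurable_fun setT (fun l : R => `|trunc (level f l) e x|).
  apply: measurable_fun_normr.
  have := measurable_trunc_level f e mf.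
  move=> /measurableT_comp /(_ (pair1_measurable x)).
  exact.
have mmax : measurable_fun setT (fun l : R => maxtrunc s (level f l) x).
  exact: (measurable_bigmax _ R s (fun e l => `|trunc (level f l) e x|)).
have key e : 0 < e -> e \in s -> (`|trunc f e x|%:E <=
    \int[mu]_(l in `]0%R, +oo[) (maxtrunc s (level f l) x)%:E)%E.
  move=> e0 es; apply: (le_trans (trunc_layer p f e x p1 e0 lf f0)).
  apply: ge0_le_integral => //.
  - by apply/measurable_EFinP; apply: measurable_funTS; exact: mlev.
  - by apply/measurable_EFinP; apply: measurable_funTS; exact: mmax.
  - by move=> l _; rewrite lee_fin; exact: le_maxtrunc.
have i0 : (0 <= \int[mu]_(l in `]0%R, +oo[) (maxtrunc s (level f l) x)%:E)%E.
  by apply: integral_ge0 => l _; rewrite lee_fin maxtrunc_ge0.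
move=> /allP s0; move: i0 key; case: (\int[mu]_(l in _) _)%E => [r| |] // r0 key.
  rewrite lee_fin; apply: maxtrunc_le => // e es.
  by have := key e (s0 e es) es; rewrite lee_fin.
by rewrite leey.
Qed.

Lemma maxtrunc_strong_ge0 p : 1 < p -> exists2 C : R, 0 <= C &
  forall f (s : seq R), all (fun e => 0 < e) s -> memLp p f -> (forall y, 0 <= f y) ->
    (\int[mu]_x (maxtrunc s f x `^ p)%:E <= C%:E * \int[mu]_x (f x `^ p)%:E)%E.
Proof.
move=> p1; have [C C0 hC] := @strong_set R p p1.
exists (4 `^ p * (2 * C / p)); first by rewrite !mulr_ge0 ?powR_ge0 ?invr_ge0//; lra.
move=> f s s0 lf f0; have mf := lf.1; have p0 : 0 < p by lra.
apply: (interpolation p C f (maxtrunc s f) (fun l x => maxtrunc s (level f l) x)) => //.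
- exact: measurable_maxtrunc.
- exact: maxtrunc_ge0.
- by move=> x; exact: (maxtrunc_layer p).
- apply: (measurable_bigmax _ (R * R)%type s (fun e z => `|trunc (level f z.2) e z.1|)) => e.
  by apply: measurable_fun_normr; exact: measurable_trunc_level.
- by move=> l x; exact: maxtrunc_ge0.
- move=> l a l0 ha; apply: hC => //; first exact: measurable_ge.
  exact: (level_finite p).
Qed.

Lemma maxtruncB p f g (s : seq R) x : 1 < p -> all (fun e => 0 < e) s -> memLp p f ->
  memLp p g -> maxtrunc s (fun y => f y - g y) x <= maxtrunc s f x + maxtrunc s g x.
Proof.
move=> p1 /allP s0 lf lg; apply: maxtrunc_le; first by rewrite addr_ge0 ?maxtrunc_ge0.
move=> e es; rewrite (truncBLp p)//; last exact: s0.
by apply: le_trans (ler_normB _ _) _; apply: lerD; exact: le_maxtrunc.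
Qed.

Lemma maxtrunc_strong p : 1 < p -> exists2 C : R, 0 <= C &
  forall f (s : seq R), all (fun e => 0 < e) s -> memLp p f ->
    (\int[mu]_x (maxtrunc s f x `^ p)%:E <= C%:E * \int[mu]_x (`|f x| `^ p)%:E)%E.
Proof.
move=> p1; have [C C0 hC] := maxtrunc_strong_ge0 p p1; have p0 : 0 < p by lra.
exists (2 `^ p * (C + C)); first by rewrite mulr_ge0 ?powR_ge0 ?addr_ge0.
move=> f s s0 lf; have [lp ln] := memLp_posneg p f p0 lf.
have half h : memLp p h -> (forall x, 0 <= h x) -> (forall x, h x <= `|f x|) ->
    (\int[mu]_x (`|maxtrunc s h x| `^ p)%:E <= C%:E * \int[mu]_x (`|f x| `^ p)%:E)%E.
  move=> lh h0 hf; under eq_integral do rewrite ger0_norm ?maxtrunc_ge0//.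
  apply: (le_trans (hC h s s0 lh h0)); apply: lee_wpmul2l; first by rewrite lee_fin.
  apply: ge0_le_integral => //.
  - by move=> x _; rewrite lee_fin powR_ge0.
  - by apply/measurable_EFinP; apply: measurable_fun_powR; exact: lh.1.
  - by apply: measurable_normp; exact: lf.1.
  - by move=> x _; rewrite lee_fin; apply: ge0_ler_powR; rewrite ?nnegrE ?(ltW p0).
have mT h : memLp p h -> measurable_fun setT (maxtrunc s h).
  by move=> lh; apply: measurable_maxtrunc; exact: lh.1.
apply: (@le_trans _ _ (\int[mu]_x (`|maxtrunc s f^\+ x + maxtrunc s f^\- x| `^ p)%:E)%E).
  apply: ge0_le_integral => //.
  - by move=> x _; rewrite lee_fin powR_ge0.
  - by apply/measurable_EFinP; apply: measurable_fun_powR; exact: mT.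
  - by apply: measurable_normp; apply: measurable_funD; exact: mT.
  - move=> x _; rewrite lee_fin; apply: ge0_ler_powR; rewrite ?nnegrE ?maxtrunc_ge0 ?(ltW p0)//.
    apply: le_trans (ler_norm _); rewrite -{1}(funrposBneg f); exact: (maxtruncB p).
apply: (le_trans (integral_normpD p _ _ p0 (mT _ lp) (mT _ ln))).
rewrite EFinM -muleA; apply: lee_wpmul2l; first by rewrite lee_fin powR_ge0.
rewrite EFinD ge0_muleDl ?lee_fin//; apply: leeD; apply: half => // x.
  exact: (funrposneg_le_norm f x).1.
exact: (funrposneg_le_norm f x).2.
Qed.

End StrongType.

(** * The maximal truncation *)

Section MaximalTruncation.
Context {R : realType}.
Local Notation mu := (@lebesgue_measure R).
Implicit Types (f g : R -> R) (p e x : R).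

(** Radii decreasing to [e] exhaust the region [e < `|x - y|]; the kernel of radius
    [e] dominates. *)
Lemma trunc_right_continuous p f e x : 1 < p -> 0 < e -> memLp p f ->
  trunc f d x @[d --> e^'+] --> trunc f e x.
Proof.
move=> p1 e0 lf; apply/cvg_at_rightP => u [ue uc].
have iK := integrable_truncLp p f e x p1 e0 lf.
have mK d : 0 < d -> measurable_fun setT (fun y => (f y * trunc_kernel d (x - y))%:E).
  by move=> d0; have /integrableP[] := integrable_truncLp p f d x p1 d0 lf.
have u0 n : 0 < u n by exact: lt_trans e0 (ue n).
have := @dominated_convergence _ _ R mu setT measurableT
  (fun n y => (f y * trunc_kernel (u n) (x - y))%:E)
  (fun y => (f y * trunc_kernel e (x - y))%:E)
  (fun y => `|(f y * trunc_kernel e (x - y))%:E|%E)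
  (fun n => mK (u n) (u0 n)) (mK e e0).
case.
- apply/aeW => y _; apply: cvg_near_cst.
  have [h|h] := leP `|x - y| e.
    by apply: nearW => n; rewrite /trunc_kernel !ltNge h (le_trans h (ltW (ue n))).
  have : \forall n \near \oo, u n < `|x - y| by exact: cvgr_lt uc _ h.
  by apply: filterS => n hn; rewrite /trunc_kernel h hn.
- exact: integrable_abse.
- apply/aeW => y n _ /=; rewrite !lee_fin !normrM ler_wpM2l//.
  rewrite /trunc_kernel; case: ifPn => h; last by rewrite normr0.
  by rewrite (lt_trans (ue n) h).
move=> _ _ h; rewrite truncE.
under eq_fun do rewrite truncE.
apply: fine_cvg; rewrite fineK; first exact: h.
exact: integrable_fin_num.
Qed.

Lemma trunc_rat_approx p f (e b x eps : R) : 1 < p -> 0 < e -> e < b -> 0 < eps -> memLp p f ->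
  exists q : rat, [/\ e < ratr q, ratr q < b & `|trunc f e x - trunc f (ratr q) x| <= eps].
Proof.
move=> p1 e0 eb eps0 lf.
have := trunc_right_continuous p f e x p1 e0 lf.
move/cvgrPdist_le => /(_ eps eps0) [d /= d0 hd].
have em : e < Num.min b (e + d) by rewrite lt_min eb ltrDl.
have [q] := rat_in_itvoo em; rewrite in_itv/= => /andP[q1].
rewrite lt_min => /andP[qb qd]; exists q; split => //.
by apply: hd => //; rewrite /ball/= ltr0_norm ?subr_lt0// opprB; lra.
Qed.

(** Finite sets of positive rationals, increasing with [n] and exhausting them all. *)
Definition rat_radii (n : nat) : seq R :=
  [seq e <- [seq (ratr (odflt 0 (unpickle k : option rat)) : R) | k <- iota 0 n] | 0 < e].

Lemma rat_radii_gt0 n : all (fun e => 0 < e) (rat_radii n).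
Proof. by rewrite /rat_radii filter_all. Qed.

Lemma rat_radii_sub n m : (n <= m)%N -> {subset rat_radii n <= rat_radii m}.
Proof.
move=> nm e; rewrite !mem_filter => /andP[-> /mapP[k]] /=.
rewrite mem_iota => /= kn ->; apply/mapP; exists k => //.
by rewrite mem_iota/= (leq_trans kn).
Qed.

Lemma mem_rat_radii (q : rat) : 0 < (ratr q : R) -> exists n, ratr q \in rat_radii n.
Proof.
move=> q0; exists (pickle q).+1; rewrite mem_filter q0 andTb.
have -> : (ratr q : R) = ratr (odflt 0 (unpickle (pickle q) : option rat)) by rewrite pickleK.
by apply: (map_f (fun k => ratr (odflt 0 (unpickle k : option rat)) : R)); rewrite mem_iota/=.
Qed.

(** By right continuity in the radius, the supremum over all radii is the one over
    the positive rationals, that is, the limit of an increasing sequence of maxima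
    over finite lists, which obey [maxtrunc_strong] with one constant. *)
Lemma maximal_truncation p : 1 < p -> exists2 C : R, 0 <= C &
  forall f, memLp p f -> exists M : R -> \bar R,
    [/\ measurable_fun setT M, forall x, (0 <= M x)%E,
        forall e x, 0 < e -> ((`|trunc f e x| `^ p)%:E <= M x)%E &
        (\int[mu]_x M x <= C%:E * \int[mu]_x (`|f x| `^ p)%:E)%E].
Proof.
move=> p1; have [C C0 hC] := maxtrunc_strong p p1; have p0 : 0 < p by lra.
exists C => // f lf.
pose G n x := (maxtrunc (rat_radii n) f x `^ p)%:E.
have mG n : measurable_fun setT (G n).
  apply/measurable_EFinP; apply: measurable_fun_powR.
  by apply: measurable_maxtrunc; exact: lf.1.
have G0 n x : (0 <= G n x)%E by rewrite lee_fin powR_ge0.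
have ndG x : {homo G^~ x : n m / (n <= m)%N >-> (n <= m)%E}.
  move=> n m nm; rewrite lee_fin; apply: ge0_ler_powR; rewrite ?nnegrE ?maxtrunc_ge0 ?(ltW p0)//.
  apply: maxtrunc_le; first exact: maxtrunc_ge0.
  by move=> e en; apply: le_maxtrunc; exact: rat_radii_sub nm _ en.
have GM n x : (G n x <= limn (G^~ x))%E.
  rewrite (cvg_lim (@ereal_hausdorff R) (ereal_nondecreasing_cvgn (ndG x))).
  by apply: ereal_sup_ubound; exists n.
have M0 x : (0 <= limn (G^~ x))%E by exact: le_trans (G0 0%N x) (GM 0%N x).
exists (fun x => limn (G^~ x)); split => //.
- apply: (emeasurable_fun_cvg G) => // x _.
  exact: (ereal_nondecreasing_is_cvgn (ndG x)).
- move=> e x e0; have := M0 x; have := GM ^~ x.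
  case: (limn _) => [r| |] // hr; last by move=> _; exact: leey.
  rewrite lee_fin => r0; rewrite lee_fin.
  have rat_le (q : rat) : 0 < (ratr q : R) -> `|trunc f (ratr q) x| <= r `^ p^-1.
    move=> q0; have [n qn] := mem_rat_radii q q0.
    have := hr n; rewrite lee_fin => hn.
    apply: (le_trans (le_maxtrunc _ f x _ qn)).
    by rewrite -powR_le_root ?maxtrunc_ge0.
  rewrite powR_le_root//; apply/ler_addgt0Pr => eta eta0.
  have [q [q1 _ qe]] := trunc_rat_approx p f e (e + 1) x eta p1 e0 (ltac:(lra)) eta0 lf.
  have := rat_le q (lt_trans e0 q1).
  have := ler_normD (trunc f e x - trunc f (ratr q) x) (trunc f (ratr q) x).
  rewrite subrK; lra.
- rewrite monotone_convergence//.
  apply: lime_le.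
    apply: ereal_nondecreasing_is_cvgn => n m nm; apply: ge0_le_integral => //; try exact: mG.
    by move=> x _; exact: ndG.
  by apply: nearW => n; apply: hC => //; exact: rat_radii_gt0.
Qed.

Lemma memLp_indic p (E : set R) : 0 < p -> measurable E -> (mu E < +oo)%E ->
  memLp p (\1_E : R -> R).
Proof.
move=> p0 mE Efin; split; first exact: measurable_indic.
have -> : (\int[mu]_y (`|\1_E y : R| `^ p)%:E = \int[mu]_y (\1_E y)%:E)%E.
  apply: eq_integral => y _; rewrite indicE; case: (y \in E); first by rewrite normr1 powR1.
  by rewrite normr0 powR0// gt_eqF.
by rewrite integral_indic// setIT.
Qed.

(** The interval is centred at [x] and the kernel is odd. *)
Lemma trunc_indic_ball x (r : R) e : 0 < e -> trunc (\1_`[x - r, x + r] : R -> R) e x = 0.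
Proof.
move=> e0; rewrite truncE.
pose h (s : R) : R := \1_`[- r, r] s * trunc_kernel e s.
have mh : measurable_fun setT h.
  by apply: measurable_funM; [exact: measurable_indic|exact: measurable_trunc_kernel].
have E : \int[mu]_y h y = \int[mu]_y (\1_`[x - r, x + r] y * trunc_kernel e (x - y)).
  rewrite /Rintegral -(integral_reflect (EFin \o h) x); last exact/measurable_EFinP.
  congr fine; apply: eq_integral => y _; rewrite /h/= !indicE.
  rewrite !mem_setE !in_itv/=; congr (((_ : bool)%:R * _)%:E).
  by apply/idP/idP => /andP[h1 h2]; apply/andP; split; lra.
rewrite -E.
have : \int[mu]_y h (- y) = - \int[mu]_y h y.
  have Efin : (mu `[(- r)%R, r]%classic < +oo)%E.
    by rewrite lebesgue_measure_itv/=; case: ifP => _; rewrite -?EFinB ltry.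
  have hi : mu.-integrable setT (EFin \o h).
    have := integrable_trunc (\1_`[- r, r] : R -> R) e 0 e0
      (integrable_indic_fin _ (measurable_itv _) Efin).
    move=> /integrableN; apply: eq_integrable => // y _ /=.
    by rewrite sub0r trunc_kernelN mulrN opprK.
  rewrite -mulN1r -RintegralZl//; apply: eq_Rintegral => y _.
  rewrite /h !indicE !mem_setE !in_itv/= trunc_kernelN mulrN mulN1r.
  congr (- ((_ : bool)%:R * _)).
  by apply/idP/idP => /andP[h1 h2]; apply/andP; split; lra.
rewrite Rintegral_opp//; move: (\int[mu]_y h y) => J hJ; lra.
Qed.

(** Within distance [r] of [x], [f] is a multiple of the indicator of a centred
    interval, whose truncations vanish; beyond, the two kernels coincide. *)
Lemma trunc_local_cst p f x (r e1 e2 : R) : 1 < p -> memLp p f ->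
  (forall y, `|x - y| <= r -> f y = f x) -> 0 < e1 -> e1 <= r -> 0 < e2 -> e2 <= r ->
  trunc f e1 x = trunc f e2 x.
Proof.
move=> p1 lf fr e10 e1r e20 e2r; have p0 : 0 < p by lra.
pose g : R -> R := \1_`[x - r, x + r].
have lg : memLp p g.
  apply: memLp_indic => //.
  by rewrite lebesgue_measure_itv/=; case: ifP => _; rewrite -?EFinB ltry.
have i1 := integrable_truncLp p f e1 x p1 e10 lf.
have i2 := integrable_truncLp p f e2 x p1 e20 lf.
have j1 := integrable_truncLp p g e1 x p1 e10 lg.
have j2 := integrable_truncLp p g e2 x p1 e20 lg.
apply/eqP; rewrite -subr_eq0; apply/eqP.
transitivity (f x * (trunc g e1 x - trunc g e2 x)); last first.
  by rewrite !trunc_indic_ball// subrr mulr0.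
rewrite !truncE -!RintegralB// -RintegralZl//; last exact: (integrableB measurableT j1 j2).
apply: eq_Rintegral => y _; rewrite -!mulrBr mulrA /g indicE mem_setE in_itv/=.
have [h|h] := leP `|x - y| r.
  rewrite fr//; move: h; rewrite ler_norml => /andP[h1 h2].
  by rewrite (_ : (_ <= _ <= _) = true) ?mulr1//; apply/andP; split; lra.
rewrite /trunc_kernel (lt_le_trans (le_lt_trans e1r h))//.
by rewrite (le_lt_trans e2r h) subrr !mulr0.
Qed.

End MaximalTruncation.

(** * Almost everywhere existence of principal values *)

Section AeConvergence.
Import HBNNSimple.
Context {R : realType}.
Local Notation mu := (@lebesgue_measure R).
Implicit Types (f g : R -> R) (p e x : R).

Lemma cvg_at_right0_cauchy (h : R -> R) : cvg (h e @[e --> 0^'+]) <->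
  (forall eta : R, 0 < eta -> exists2 d : R, 0 < d & forall e1 e2 : R,
     0 < e1 -> e1 < d -> 0 < e2 -> e2 < d -> `|h e1 - h e2| <= eta).
Proof.
split=> [/cvg_ex[l]/= hl eta eta0|H].
  have : 0 < eta / 2 by rewrite divr_gt0.
  move: hl => /cvgrPdist_le hl /hl [d /= d0 hd].
  exists d => // e1 e2 e10 e1d e20 e2d.
  have b e : 0 < e -> e < d -> `|l - h e| <= eta / 2.
    by move=> e0 ed; apply: hd => //=; rewrite sub0r normrN gtr0_norm.
  rewrite (_ : h e1 - h e2 = (l - h e2) - (l - h e1)); last by ring.
  apply: le_trans (ler_normB _ _) _.
  have := b e1 e10 e1d; have := b e2 e20 e2d; lra.
apply/cauchy_cvgP/cauchyP => eta eta0.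
have eta2 : 0 < eta / 2 by rewrite divr_gt0.
have [d d0 hd] := H _ eta2.
exists (h (d / 2)); exists d => //= e /=; rewrite sub0r normrN => ed e0.
rewrite /ball/=; apply: (@le_lt_trans _ _ (eta / 2)); last by lra.
by apply: hd => //; [lra|lra|move: ed; rewrite gtr0_norm].
Qed.

Lemma cvg_right0_eq (T : topologicalType) (h k : R -> T) (l : T) :
  (forall e : R, 0 < e -> h e = k e) ->
  k e @[e --> 0^'+] --> l -> h e @[e --> 0^'+] --> l.
Proof.
move=> hk; apply: cvg_trans; apply: near_eq_cvg.
by near=> e; rewrite hk//; near: e; exact: nbhs_right_gt.
Unshelve. all: by end_near. Qed.

Lemma cvg0_powR (a : nat -> R) (p : R) : 1 <= p -> (forall n, 0 <= a n) ->
  a n @[n --> \oo] --> 0 -> a n `^ p @[n --> \oo] --> 0.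
Proof.
move=> p1 a0 /cvgr0Pnorm_le ha; apply/cvgr0Pnorm_le => eps eps0.
have m0 : 0 < Num.min eps 1 by rewrite lt_min eps0 ltr01.
apply: filterS (ha _ m0) => n; rewrite ger0_norm// le_min => /andP[h1 h2].
rewrite ger0_norm ?powR_ge0//; apply: le_trans h1.
have [->|hn] := eqVneq (a n) 0; first by rewrite powR0// gt_eqF//; lra.
by apply: ge1r_powR => //; rewrite lt0r hn a0.
Qed.

Lemma negligible_small (A : set R) :
  (forall eta : R, 0 < eta -> exists B : set R, [/\ measurable B, A `<=` B & (mu B <= eta%:E)%E]) ->
  mu.-negligible A.
Proof.
move=> H.
have H' n : exists B : set R, [/\ measurable B, A `<=` B & (mu B <= (n.+1%:R^-1)%:E)%E].
  by apply: H; rewrite invr_gt0.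
pose B n := sval (cid (H' n)).
have hB n : [/\ measurable (B n), A `<=` B n & (mu (B n) <= (n.+1%:R^-1)%:E)%E].
  by rewrite /B; case: cid.
have mI : measurable (\bigcap_n B n) by apply: bigcap_measurable => // n _; have [] := hB n.
exists (\bigcap_n B n); split => //; last by move=> x Ax n _; have [_ + _] := hB n; apply.
apply/eqP; rewrite eq_le measure_ge0 andbT; apply/lee_addgt0Pr => eta eta0.
rewrite add0e.
have [n] := ltr_add_invr eta0; rewrite add0r => hn.
have [mB _ hmB] := hB n.
apply: (@le_trans _ _ (mu (B n))).
  by apply: le_measure; rewrite ?inE//; exact: bigcap_inf.
by apply: le_trans hmB _; rewrite lee_fin ltW.
Qed.

Definition trunc_cvg f := {ae mu, forall x, cvg (trunc f e x @[e --> 0^'+])}.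

Lemma trunc_cvgD p f g : 1 < p -> memLp p f -> memLp p g -> trunc_cvg f -> trunc_cvg g ->
  trunc_cvg (fun y => f y + g y).
Proof.
move=> p1 lf lg cf cg; apply: (ae_imply2 _ _ _ _ cf cg) => x {}cf {}cg.
apply: (@cvgP _ _ (lim (trunc f e x @[e --> 0^'+]) + lim (trunc g e x @[e --> 0^'+]))).
apply: cvg_right0_eq (cvgD cf cg) => e e0; exact: (truncD p).
Qed.

Lemma trunc_cvgZ p a f : 1 < p -> memLp p f -> trunc_cvg f -> trunc_cvg (fun y => a * f y).
Proof.
move=> p1 lf cf; apply: (ae_imply _ _ _ cf) => x {}cf.
apply: (@cvgP _ _ (a * lim (trunc f e x @[e --> 0^'+]))).
apply: cvg_right0_eq (cvgM (cvg_cst a) cf) => e e0; exact: (truncZ p).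
Qed.

(** Banach's principle. The truncations of [f] oscillate by more than [eta] near 0
    only where those of [g] diverge, a null set, or where the maximal truncation of
    [f - g] exceeds [eta / 3], a set of small measure. *)
Lemma trunc_cvg_closed p f : 1 < p -> memLp p f ->
  (forall eta : R, 0 < eta -> exists g, [/\ memLp p g, trunc_cvg g &
     (\int[mu]_x (`|f x - g x| `^ p)%:E <= eta%:E)%E]) ->
  trunc_cvg f.
Proof.
move=> p1 lf H; have p0 : 0 < p by lra.
have [C C0 hC] := @maximal_truncation R p p1.
pose good (eta : R) x := exists2 d : R, 0 < d & forall e1 e2 : R,
   0 < e1 -> e1 < d -> 0 < e2 -> e2 < d -> `|trunc f e1 x - trunc f e2 x| <= eta.
suff main (eta : R) : 0 < eta -> {ae mu, forall x, good eta x}.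
  have /ae_foralln : forall n : nat, {ae mu, forall x, good (n.+1%:R^-1) x}.
    by move=> n; apply: main; rewrite invr_gt0.
  apply: filterS => x hx; apply/cvg_at_right0_cauchy => eta eta0.
  have [n] := ltr_add_invr eta0; rewrite add0r => hn.
  have [d d0 hd] := hx n; exists d => // e1 e2 h1 h2 h3 h4.
  exact: le_trans (hd _ _ h1 h2 h3 h4) (ltW hn).
move=> eta0; apply: negligible_small => eps eps0.
pose lam := (eta / 3) `^ p.
have lam0 : 0 < lam by rewrite powR_gt0// divr_gt0.
have C1 : 0 < C + 1 by rewrite ltr_wpDl.
have [g [lg cg fg]] := H (eps * lam / (C + 1)) (divr_gt0 (mulr_gt0 eps0 lam0) C1).
have [M [mM M0 hM iM]] := hC _ (memLpB p f g p0 lf lg).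
have [N [mN N0 cN]] := cg.
have mB : measurable [set x | (lam%:E <= M x)%E].
  by rewrite -[X in measurable X]setTI; exact: emeasurable_fun_c_infty.
exists (N `|` [set x | (lam%:E <= M x)%E]); split; first exact: measurableU.
- move=> x bad; apply: contrapT => /not_orP[xN xM]; apply: bad.
  have /cvg_at_right0_cauchy cx : cvg (trunc g e x @[e --> 0^'+]).
    by apply: contrapT => h; apply: xN; apply: cN.
  have eta3 : 0 < eta / 3 by rewrite divr_gt0.
  have [d d0 hd] := cx _ eta3; exists d => // e1 e2 h1 h2 h3 h4.
  have small e : 0 < e -> `|trunc f e x - trunc g e x| <= eta / 3.
    move=> e0; rewrite -(truncBLp p)// leNgt; apply/negP => h; apply: xM => /=.
    apply: le_trans (hM e x e0); rewrite lee_fin.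
    by apply: ge0_ler_powR; rewrite ?nnegrE// ltW.
  have := small _ h1; have := small _ h3; have := hd _ _ h1 h2 h3 h4.
  rewrite !ler_norml => /andP[a1 a2] /andP[b1 b2] /andP[c1 c2].
  by apply/andP; split; lra.
apply: (le_trans (measureU2 mu mN mB)); rewrite -[leRHS]add0e; apply: leeD.
  by rewrite le_eqVlt; apply/orP; left; apply/eqP; exact: N0.
have := @le_integral_comp_abse _ _ R mu setT measurableT M lam id (@measurable_id _ _ _)
  (fun _ h => h) (fun _ _ _ _ h => h) mM lam0.
rewrite setTI.
under [in X in (_ <= X -> _)%E]eq_integral do rewrite /= gee0_abs//.
rewrite (_ : [set x | (lam%:E <= `|M x|)%E] = [set x | (lam%:E <= M x)%E]); last first.
  by apply/funext => x /=; rewrite gee0_abs.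
move=> h; rewrite -(@lee_pmul2l _ lam%:E)//.
apply: (le_trans h); apply: (le_trans iM).
apply: (@le_trans _ _ (C%:E * (eps * lam / (C + 1))%:E)%E).
  by apply: lee_wpmul2l => //; rewrite lee_fin.
rewrite -!EFinM lee_fin mulrA ler_pdivrMr// mulrC (mulrC lam) ler_wpM2l ?mulr_ge0 ?(ltW eps0) ?(ltW lam0)//.
by rewrite lerDl.
Qed.

(** Off the endpoints the indicator is locally constant, so the truncations do not
    vary for small radii. *)
Lemma trunc_cvg_itv p (a b : R) : 1 < p -> a < b -> trunc_cvg (\1_`[a, b] : R -> R).
Proof.
move=> p1 ab; have p0 : 0 < p by lra.
have lp : memLp p (\1_`[a, b] : R -> R).
  by apply: memLp_indic => //; rewrite lebesgue_measure_itv/= lte_fin ab -EFinB ltry.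
apply: (@negligibleS _ _ _ mu [set a; b]); last first.
  apply/negligibleP => //; first exact: measurableU.
  apply/eqP; rewrite eq_le measure_ge0 andbT; apply: le_trans (measureU2 mu _ _) _ => //.
  have s1 (c : R) : (mu [set c] <= 0)%E by rewrite lebesgue_measure_set1.
  by have := leeD (s1 a) (s1 b); rewrite adde0.
move=> x /= nc; apply: contrapT => /not_orP[xa xb]; apply: nc.
pose r := Num.min `|x - a| `|x - b| / 2.
have r0 : 0 < r.
  by rewrite divr_gt0// lt_min !normr_gt0 !subr_eq0; apply/andP; split; apply/eqP.
have ra : r < `|x - a|.
  apply: (@lt_le_trans _ _ (Num.min `|x - a| `|x - b|)); last by rewrite ge_min lexx.
  by rewrite ltr_pdivrMr// ltr_pMr ?ltr1n// -(@pmulr_lgt0 _ 2^-1) ?invr_gt0.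
have rb : r < `|x - b|.
  apply: (@lt_le_trans _ _ (Num.min `|x - a| `|x - b|)); last by rewrite ge_min lexx orbT.
  by rewrite ltr_pdivrMr// ltr_pMr ?ltr1n// -(@pmulr_lgt0 _ 2^-1) ?invr_gt0.
have loc y : `|x - y| <= r -> \1_`[a, b] y = \1_`[a, b] x :> R.
  rewrite ler_norml !indicE !mem_setE !in_itv/= => /andP[y1 y2].
  congr ((_ : bool)%:R); move: ra rb; rewrite !ltr_normr => /orP[] h1 /orP[] h2;
    by apply/idP/idP => /andP[h3 h4]; apply/andP; split; lra.
apply/cvg_at_right0_cauchy => eta eta0; exists r => // e1 e2 h1 h2 h3 h4.
by rewrite (trunc_local_cst p _ x r e1 e2)// ?subrr ?normr0// ltW.
Qed.

Lemma memLp_sum p (I : Type) (s : seq I) (F : I -> R -> R) : 0 < p ->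
  (forall i, memLp p (F i)) -> memLp p (fun x => \sum_(i <- s) F i x).
Proof.
move=> p0 lF; elim: s => [|i s IH].
  under eq_fun do rewrite big_nil; split; first exact: measurable_cst.
  by under eq_integral do rewrite normr0 powR0 ?gt_eqF//; rewrite integral0.
under eq_fun do rewrite big_cons.
exact: (memLpD p (F i) (fun x => \sum_(j <- s) F j x) p0 (lF i) IH).
Qed.

Lemma trunc_cvg_sum p (I : Type) (s : seq I) (F : I -> R -> R) : 1 < p ->
  (forall i, memLp p (F i)) -> (forall i, trunc_cvg (F i)) ->
  trunc_cvg (fun x => \sum_(i <- s) F i x).
Proof.
move=> p1 lF cF; have p0 : 0 < p by lra.
elim: s => [|i s IH].
  apply/aeW => x; apply: (@cvgP _ _ (0 : R)).
  apply: (@cvg_trans _ ((fun=> 0 : R) @ 0^'+)); last exact: cvg_cst.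
  apply: near_eq_cvg; near=> e; rewrite truncE (_ : \int[mu]_y _ = 0)//.
  under eq_Rintegral do rewrite big_nil mul0r.
  by rewrite /Rintegral integral0.
under eq_fun do rewrite big_cons.
exact: (trunc_cvgD p (F i) (fun x => \sum_(j <- s) F j x) p1 (lF i) (memLp_sum p I s F p0 lF) (cF i) IH).
Unshelve. all: by end_near. Qed.

(** Approximation by step functions in L^1 is approximation in L^p, as the
    differences are at most 1. *)
Lemma trunc_cvg_indic p (E : set R) : 1 < p -> measurable E -> (mu E < +oo)%E ->
  trunc_cvg (\1_E : R -> R).
Proof.
move=> p1 mE Efin; have p0 : 0 < p by lra.
have lE := memLp_indic p E p0 mE Efin.
apply: (trunc_cvg_closed p) => // eta eta0.
have [n [a [b [iab h]]]] := approx_steps E eta mE Efin eta0.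
have lst i : memLp p (\1_`[a i, b i] : R -> R).
  apply: memLp_indic => //; rewrite lebesgue_measure_itv/=.
  by case: ifP => _; rewrite -?EFinB ltry.
exists (steps n a b); split.
- exact: (memLp_sum p 'I_n (index_enum 'I_n) (fun i => \1_`[a i, b i]) p0 (fun i => lst i)).
- apply: (trunc_cvg_sum p 'I_n (index_enum 'I_n) (fun i => \1_`[a i, b i]) p1 (fun i => lst i)).
  by move=> i; apply: (trunc_cvg_itv p) => //; exact: iab.1.
apply: le_trans h; apply: ge0_le_integral => //.
- by apply: measurable_normp; apply: measurable_funB; [exact: lE.1|exact: measurable_steps].
- apply/measurable_EFinP; apply: measurable_fun_normr; apply: measurable_funB;
    [exact: lE.1|exact: measurable_steps].
- move=> t _; rewrite lee_fin; have t1 := steps_le1 n a b t iab; have t0 := steps_ge0 n a b t.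
  have h1 : `|\1_E t - steps n a b t| <= 1.
    by rewrite ler_norml indicE; case: (t \in E) => /=; apply/andP; split; lra.
  have [->|hn] := eqVneq `|\1_E t - steps n a b t| 0; first by rewrite powR0 ?gt_eqF.
  by apply: ge1r_powR; [rewrite lt0r hn normr_ge0|exact: ltW].
Qed.

(** Simple functions below [f] converge to it in L^p by dominated convergence. *)
Lemma trunc_cvg_ge0 p f : 1 < p -> memLp p f -> (forall x, 0 <= f x) -> trunc_cvg f.
Proof.
move=> p1 lf f0; have p0 : 0 < p by lra.
have mf := lf.1.
have mEf : measurable_fun setT (EFin \o f) by exact/measurable_EFinP.
pose h n := nnsfun_approx measurableT mEf n.
have hle n x : h n x <= f x.
  by rewrite -lee_fin /h nnsfun_approxE; apply: le_approx => // y _; rewrite lee_fin.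
have h0 n x : 0 <= h n x by [].
have mh n : measurable_fun setT (h n) by [].
have hcvg x : (h n x)%:E @[n --> \oo] --> (f x)%:E.
  by apply: cvg_nnsfun_approx => // y _; rewrite lee_fin.
have lh n : memLp p (h n).
  by apply: (memLp_le p f (h n) (ltW p0) lf (mh n)) => x; rewrite !ger0_norm.
have ch n : trunc_cvg (h n).
  pose s := finmap.enum_fset (fset_set (range (h n))).
  have hE : (h n : R -> R) = (fun x => \sum_(i < size s) s`_i * \1_(h n @^-1` [set s`_i]) x).
    by apply/funext => x; rewrite -fimfunEord.
  rewrite hE.
  have mE i : measurable (h n @^-1` [set s`_i]) by rewrite -[X in measurable X]setTI; exact: mh.
  have term i : memLp p (fun x => s`_i * \1_(h n @^-1` [set s`_i]) x) /\
                trunc_cvg (fun x => s`_i * \1_(h n @^-1` [set s`_i]) x).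
    (* [h n] is nonnegative, so the terms with a value [<= 0] vanish; the others have a
       support of finite measure *)
    have [v0|v0] := leP s`_i 0.
      have -> : (fun x => s`_i * \1_(h n @^-1` [set s`_i]) x) =
                (fun x => 0 * (\1_`[0, 1] : R -> R) x).
        apply/funext => x; rewrite mul0r indicE; case: (boolP (x \in _)) => [/set_mem/= e|_].
          have -> : s`_i = 0 by apply/eqP; rewrite eq_le v0 -e h0.
          by rewrite mul0r.
        by rewrite mulr0.
      have l1 : memLp p (\1_`[0, 1] : R -> R).
        by apply: memLp_indic => //; rewrite lebesgue_measure_itv/= lte_fin ltr01 -EFinB ltry.
      split; first exact: (memLpZ p 0 _ (ltW p0) l1).
      exact: (trunc_cvgZ p 0 _ p1 l1 (trunc_cvg_itv p 0 1 p1 ltr01)).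
    have Ef : (mu (h n @^-1` [set s`_i]) < +oo)%E.
      apply: le_lt_trans (level_finite p f s`_i p0 v0 f0 lf).
      by apply: le_outer_measure => x /= <-; exact: hle.
    have lE := memLp_indic p _ p0 (mE i) Ef.
    split; first exact: (memLpZ p _ _ (ltW p0) lE).
    exact: (trunc_cvgZ p _ _ p1 lE (trunc_cvg_indic p _ p1 (mE i) Ef)).
  apply: (trunc_cvg_sum p 'I_(size s) (index_enum 'I_(size s))
    (fun i x => s`_i * \1_(h n @^-1` [set s`_i]) x) p1) => i; by have [] := term i.
apply: (trunc_cvg_closed p f p1 lf) => eta eta0.
have := @dominated_convergence _ _ R mu setT measurableT
  (fun n x => (`|f x - h n x| `^ p)%:E) (fun=> 0%E) (fun x => (`|f x| `^ p)%:E).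
case.
- by move=> n; apply: measurable_normp; exact: measurable_funB.
- exact: measurable_cst.
- apply/aeW => x _; apply: cvg_EFin; first by apply: nearW.
  apply: cvg0_powR; [exact: ltW|by []|].
  have /fine_cvg h1 := hcvg x.
  apply/norm_cvg0P; rewrite -(subrr (f x)); apply: cvgB; first exact: cvg_cst.
  exact: h1.
- apply/integrableP; split; first exact: measurable_normp.
  by under eq_integral do rewrite /= ger0_norm ?powR_ge0//; exact: lf.2.
- apply/aeW => x n _ /=; rewrite lee_fin ger0_norm ?powR_ge0//.
  apply: ge0_ler_powR; rewrite ?nnegrE ?(ltW p0)//.
  have := hle n x; have := h0 n x; rewrite (ger0_norm (f0 x)) => a b.
  by rewrite ger0_norm ?subr_ge0//; lra.
move=> _ _; rewrite integral0 => /fine_cvgP[fin /cvgr0Pnorm_le fc].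
have [N _ hN] := filterI fin (fc _ eta0).
have [fN hfN] := hN N (leqnn N).
exists (h N); split; [exact: lh|exact: ch|].
rewrite /= in fN hfN.
rewrite -(fineK fN) lee_fin; apply: le_trans hfN; exact: ler_norm.
Qed.

Lemma trunc_cvg_memLp p f : 1 < p -> memLp p f -> trunc_cvg f.
Proof.
move=> p1 lf; have p0 : 0 < p by lra.
have [lp ln] := memLp_posneg p f p0 lf.
have -> : f = (fun x => f^\+ x + -1 * f^\- x) 
  by rewrite -{1}(funrposBneg f); apply/funext => x; rewrite mulN1r.
have lnN := memLpZ p (-1) _ (ltW p0) ln.
apply: (trunc_cvgD p _ _ p1 lp lnN); first exact: (trunc_cvg_ge0 p).
by apply: (trunc_cvgZ p (-1) _ p1 ln); exact: (trunc_cvg_ge0 p).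
Qed.

End AeConvergence.

(** * Averages of dilations *)

Section DilationAverage.
Context {R : realType}.
Local Notation mu := (@lebesgue_measure R).
Implicit Types (f g G : R -> R) (p e x : R).
Variables (w : R -> R) (p i : R).
Hypothesis p1 : 1 < p.
Hypothesis mw : measurable_fun [set: R] w.
Hypothesis w0 : forall t, 0 <= w t.
Hypothesis wneg : forall t, t <= 0 -> w t = 0.
Hypothesis i0 : 0 <= i.
Hypothesis wi : (\int[mu]_t (t `^ p^-1 * w t)%:E = i%:E)%E.

Let p0 : 0 < p. Proof. exact: lt_trans ltr01 p1. Qed.
Let q : R := p / (p - 1).
Let q0 : 0 < q. Proof. by apply: divr_gt0; [exact: p0|rewrite subr_gt0]. Qed.
Let pq : p^-1 + q^-1 = 1.
Proof. by rewrite /q invf_div; field; exact: lt0r_neq0 p0. Qed.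

Definition dil f x : R := \int[mu]_t (f (x / t) * w t).

Lemma measurable_dil2 f : measurable_fun [set: R] f ->
  measurable_fun setT (fun z : R * R => f (z.1 / z.2) * w z.2).
Proof.
move=> mf; apply: measurable_funM; last exact: (measurableT_comp mw measurable_snd).
apply: (measurableT_comp mf); apply: measurable_funM; first exact: measurable_fst.
by apply: measurable_funV; exact: measurable_snd.
Qed.

Lemma measurable_dil1 f x : measurable_fun [set: R] f ->
  measurable_fun [set: R] (fun t : R => f (x / t) * w t).
Proof.
move=> mf; apply: measurable_funM => //; apply: (measurableT_comp mf).
by apply: measurable_funM => //; exact: measurable_inv.
Qed.

Lemma measurable_dil f : measurable_fun [set: R] f -> measurable_fun [set: R] (dil f).
Proof.
move=> mf; apply: (measurable_Rintegral2 _ (measurableTypeR R) (fun z : R * R => f (z.1 / z.2) * w z.2)).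
exact: measurable_dil2.
Qed.

(** Hoelder's inequality for the measure [u t dt], [u t = t `^ p^-1 * w t], of total
    mass [i]. *)
Lemma dil_pointwise G x : measurable_fun [set: R] G -> (forall y, 0 <= G y) ->
  ((\int[mu]_t (G (x / t) * w t)%:E) `^ p <=
   \int[mu]_t (G (x / t) `^ p * (t `^ (p^-1 - 1) * w t))%:E * (i `^ (p - 1))%:E)%E.
Proof.
move=> mG G0.
pose u t := t `^ p^-1 * w t.
have mu_ : measurable_fun [set: R] u by apply: measurable_funM => //; exact: measurable_fun_powR.
have u0 t : 0 <= u t by rewrite mulr_ge0 ?powR_ge0.
have mGx : measurable_fun [set: R] (fun t : R => G (x / t)).
  by apply: (measurableT_comp mG); apply: measurable_funM => //; exact: measurable_inv.
(* [f1 * f2] is the integrand, as [t `^ (- p^-1) * u t = w t] for [t > 0] *)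
pose f1 t := G (x / t) * t `^ (- p^-1) * u t `^ p^-1.
pose f2 t := u t `^ q^-1.
have f10 t : 0 <= f1 t by rewrite !mulr_ge0 ?powR_ge0.
have f20 t : 0 <= f2 t by rewrite powR_ge0.
have mf1 : measurable_fun [set: R] f1.
  apply: measurable_funM; last exact: measurable_fun_powR.
  by apply: measurable_funM => //; exact: measurable_fun_powR.
have mf2 : measurable_fun [set: R] f2 by exact: measurable_fun_powR.
have f12 t : f1 t * f2 t = G (x / t) * w t.
  rewrite /f1 /f2 -mulrA -(@powRD _ (u t)) ?pq ?oner_eq0// powRr1//.
  have [t0|t0] := ltP 0 t; last by rewrite /u wneg// !mulr0.
  rewrite /u mulrA -[_ * _ * t `^ p^-1]mulrA -powRD; last by rewrite (lt0r_neq0 t0) implybT.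
  by rewrite addNr powRr0 mulr1.
have H := hoelder mu mf1 mf2 p0 q0 pq.
have E1 : ('N[mu]_1[EFin \o (f1 \* f2)%R] = \int[mu]_t (G (x / t) * w t)%:E)%E.
  rewrite Lnorm1; apply: eq_integral => t _ /=.
  by rewrite -f12 ger0_norm//; exact: mulr_ge0.
have Ep : ('N[mu]_p%:E[EFin \o f1] = (\int[mu]_t (G (x / t) `^ p * (t `^ (p^-1 - 1) * w t))%:E) `^ p^-1)%E.
  rewrite unlock; congr (_ `^ _)%E; apply: eq_integral => t _.
  rewrite [(EFin \o f1) t]/= gee0_abs ?lee_fin// poweR_EFin; congr (_%:E).
  rewrite /f1 powRM ?mulr_ge0 ?powR_ge0// powRM ?powR_ge0// -!powRrM mulNr mulVf ?gt_eqF// powRr1//.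
  rewrite -mulrA; congr (_ * _).
  have [t0|t0] := ltP 0 t; last by rewrite /u wneg// !mulr0.
  by rewrite /u mulrA -powRD ?(lt0r_neq0 t0) ?implybT// addrC.
have Eq : ('N[mu]_q%:E[EFin \o f2] = (i `^ q^-1)%:E)%E.
  rewrite unlock -poweR_EFin -wi; congr (_ `^ _)%E; apply: eq_integral => t _.
  by rewrite [(EFin \o f2) t]/= gee0_abs ?lee_fin// poweR_EFin /f2 -powRrM mulVf ?gt_eqF// powRr1.
rewrite E1 Ep Eq in H.
have J0 : (0 <= \int[mu]_t (G (x / t) `^ p * (t `^ (p^-1 - 1) * w t))%:E)%E.
  by apply: integral_ge0 => t _; rewrite lee_fin !mulr_ge0 ?powR_ge0.
have L0 : (0 <= \int[mu]_t (G (x / t) * w t)%:E)%E.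
  by apply: integral_ge0 => t _; rewrite lee_fin mulr_ge0.
have := gt0_ler_poweR (ltW p0) _ _ H.
rewrite !in_itv/= !leey !andbT L0 mule_ge0 ?poweR_ge0 ?lee_fin ?powR_ge0// => /(_ isT isT).
rewrite poweRM ?poweR_ge0 ?lee_fin ?powR_ge0// -poweRrM mulVf ?gt_eqF// poweRe1//.
rewrite poweR_EFin -powRrM (_ : q^-1 * p = p - 1)//.
by rewrite /q invf_div divfK// gt_eqF.
Qed.

(** In [dil_pointwise] the integral over [x] of the dilate by [t] brings out a factor
    [t], which turns the weight [t `^ (p^-1 - 1) * w t] into the one of mass [i]; and
    [i `^ (p - 1) * i = i `^ p]. No constant is lost, which gives the exact norm. *)
Lemma dil_strong G : measurable_fun [set: R] G -> (forall y, 0 <= G y) ->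
  (\int[mu]_x (\int[mu]_t (G (x / t) * w t)%:E) `^ p <=
   (i `^ p)%:E * \int[mu]_x (G x `^ p)%:E)%E.
Proof.
move=> mG G0.
have mv : measurable_fun [set: R] (fun t => t `^ (p^-1 - 1) * w t).
  by apply: measurable_funM => //; exact: measurable_fun_powR.
have mGp : measurable_fun [set: R] (fun x => G x `^ p) by exact: measurable_fun_powR.
pose F (z : R * R) := G (z.1 / z.2) `^ p * (z.2 `^ (p^-1 - 1) * w z.2).
have mF : measurable_fun setT F.
  apply: measurable_funM; last exact: (measurableT_comp mv measurable_snd).
  apply: (measurableT_comp mGp); apply: measurable_funM; first exact: measurable_fst.
  by apply: measurable_funV; exact: measurable_snd.
have F0 z : 0 <= F z by rewrite !mulr_ge0 ?powR_ge0.
have mI := measurable_ge0_integral F mF F0.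
have mL : measurable_fun [set: R] (fun x => \int[mu]_t (G (x / t) * w t)%:E)%E.
  apply: (measurable_ge0_integral (fun z => G (z.1 / z.2) * w z.2)); first exact: measurable_dil2.
  by move=> z; rewrite mulr_ge0.
apply: (@le_trans _ _ (\int[mu]_x (\int[mu]_t (F (x, t))%:E * (i `^ (p - 1))%:E))%E).
  apply: ge0_le_integral => //.
  - by move=> x _; exact: poweR_ge0.
  - exact: (measurableT_comp (measurable_poweR p)).
  - by apply: emeasurable_funM => //; exact: measurable_cst.
  - by move=> x _; exact: dil_pointwise.
rewrite ge0_integralZr//; last 2 first.
- by move=> x _; apply: integral_ge0 => t _; rewrite lee_fin.
- by rewrite lee_fin powR_ge0.
rewrite (tonelli_real F mF F0).
have -> : (\int[mu]_t \int[mu]_x (F (x, t))%:E =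
   \int[mu]_t ((t `^ p^-1 * w t)%:E * \int[mu]_x (G x `^ p)%:E))%E.
  apply: eq_integral => t _; rewrite /F/=.
  have [t0|t0] := ltP 0 t; last first.
    rewrite wneg// !mulr0 mul0e; under eq_integral do rewrite mulr0.
    exact: integral0.
  under eq_integral do rewrite EFinM.
  rewrite ge0_integralZr//; last 3 first.
  - apply/measurable_EFinP; apply: (measurableT_comp mGp).
    exact: measurable_funM.
  - by move=> y _; rewrite lee_fin powR_ge0.
  - by rewrite lee_fin mulr_ge0 ?powR_ge0.
  rewrite (integral_dilate (fun y => (G y `^ p)%:E) t t0)//; last exact/measurable_EFinP.
  rewrite muleAC -EFinM; congr (_%:E * _)%E.
  rewrite mulrA; congr (_ * _); rewrite -{1}(powRr1 (ltW t0)) -powRD ?(lt0r_neq0 t0) ?implybT//.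
  by congr (_ `^ _); ring.
rewrite ge0_integralZr//; last 3 first.
- apply/measurable_EFinP; apply: measurable_funM => //; exact: measurable_fun_powR.
- by move=> t _; rewrite lee_fin mulr_ge0 ?powR_ge0.
- by apply: integral_ge0 => x _; rewrite lee_fin powR_ge0.
rewrite wi muleAC -EFinM le_eqVlt; apply/orP; left; apply/eqP; congr (_%:E * _)%E.
have [->|hi] := eqVneq i 0; first by rewrite mul0r powR0// gt_eqF.
by rewrite -{1}(powRr1 i0) -powRD ?hi ?implybT//; congr (_ `^ _); ring.
Qed.

Lemma dil_strong_norm f : memLp p f ->
  (\int[mu]_x (\int[mu]_t `|f (x / t) * w t|%:E) `^ p <=
   (i `^ p)%:E * \int[mu]_x (`|f x| `^ p)%:E)%E.
Proof.
move=> [mf _].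
have E x : (\int[mu]_t `|f (x / t) * w t|%:E = \int[mu]_t (`|f (x / t)| * w t)%:E)%E.
  by apply: eq_integral => t _; rewrite normrM (ger0_norm (w0 t)).
under eq_integral do rewrite E.
exact: dil_strong (fun x => `|f x|) (measurable_fun_normr _ _ _ _ mf) (fun y => normr_ge0 _).
Qed.

Lemma measurable_dil_abs f : measurable_fun [set: R] f ->
  measurable_fun [set: R] (fun x => \int[mu]_t `|f (x / t) * w t|%:E)%E.
Proof.
move=> mf; apply: (measurable_ge0_integral (fun z => `|f (z.1 / z.2) * w z.2|)) => //.
by apply: measurable_fun_normr; exact: measurable_dil2.
Qed.

Lemma dil_integrable f : memLp p f ->
  {ae mu, forall x, mu.-integrable setT (fun t => (f (x / t) * w t)%:E)}.
Proof.
move=> lf; have [mf fi] := lf.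
have mF := measurable_dil_abs f mf.
have : mu.-integrable setT (fun x => (\int[mu]_t `|f (x / t) * w t|%:E) `^ p)%E.
  apply/integrableP; split; first exact: (measurableT_comp (measurable_poweR p)).
  under eq_integral do rewrite gee0_abs ?poweR_ge0//.
  apply: le_lt_trans (dil_strong_norm f lf) _.
  by apply: lte_mul_pinfty => //; rewrite lee_fin powR_ge0.
move=> /(integrable_ae measurableT); apply: ae_imply => x /(_ I) h.
apply/integrableP; split; first by apply/measurable_EFinP; exact: measurable_dil1.
by apply: (@lty_poweRy _ _ p); rewrite ?gt_eqF//= ltey_eq h.
Qed.

Lemma memLp_dil f : memLp p f -> memLp p (dil f).
Proof.
move=> lf; have [mf fi] := lf; have mF := measurable_dil_abs f mf.
split; first exact: measurable_dil.
apply: (@le_lt_trans _ _ (\int[mu]_x (\int[mu]_t `|f (x / t) * w t|%:E) `^ p)%E); last first.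
  apply: le_lt_trans (dil_strong_norm f lf) _.
  by apply: lte_mul_pinfty => //; rewrite lee_fin powR_ge0.
apply: ge0_le_integral => //.
- by apply: measurable_normp; exact: measurable_dil.
- exact: (measurableT_comp (measurable_poweR p)).
move=> x _; rewrite -poweR_EFin.
have F0 : (0 <= \int[mu]_t `|f (x / t) * w t|%:E)%E by exact: integral_ge0.
apply: gt0_ler_poweR; rewrite ?(ltW p0) ?in_itv/= ?leey ?andbT ?lee_fin//.
have := @le_abse_integral _ (measurableTypeR R) R mu setT (fun t => (f (x / t) * w t)%:E) measurableT.
have h : measurable_fun [set: R] (fun t : R => (f (x / t) * w t)%:E).
  by apply/measurable_EFinP; exact: measurable_dil1.
move=> /(_ h); apply: le_trans; rewrite /dil /Rintegral.
by case: (\int[mu]_t _)%E => [r| |]//=; rewrite normr0 leey.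
Qed.

(** For each [t > 0] the set of [x] with [N (x / t)] is null; Tonelli's theorem
    exchanges the two quantifiers. *)
Lemma ae_dilate (N : set R) : measurable N -> mu N = 0 ->
  {ae mu, forall x, {ae mu, forall t, 0 < t -> ~ N (x / t)}}.
Proof.
move=> mN N0.
pose F (z : R * R) : R := \1_`]0%R, +oo[ z.2 * \1_N (z.1 / z.2).
have mF : measurable_fun setT F.
  apply: measurable_funM.
    by apply: measurable_fun_indic; [exact: measurable_itv|exact: measurable_snd].
  apply: measurable_fun_indic => //; apply: measurable_funM; first exact: measurable_fst.
  by apply: measurable_funV; exact: measurable_snd.
have F0 z : 0 <= F z by rewrite mulr_ge0 ?indicE.
have : (\int[mu]_x `|\int[mu]_t (F (x, t))%:E| = 0)%E.
  have -> : (\int[mu]_x `|\int[mu]_t (F (x, t))%:E| = \int[mu]_x \int[mu]_t (F (x, t))%:E)%E.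
    by apply: eq_integral => x _; rewrite gee0_abs//; apply: integral_ge0 => t _; rewrite lee_fin.
  rewrite (tonelli_real F mF F0).
  apply: integral0_eq => t _; rewrite /F/=.
  have [t0|t0] := ltP 0 t; last first.
    apply: integral0_eq => x _; rewrite indicE mem_setE in_itv/= ltNge t0 mul0r//.
  rewrite indicE mem_setE in_itv/= t0.
  under eq_integral do rewrite mul1r.
  rewrite (integral_dilate (fun y : R => (\1_N y)%:E) t t0).
  - have -> : (\int[mu]_x (\1_N x)%:E = 0)%E by rewrite integral_indic// setIT; exact: N0.
    by rewrite mule0.
  - by apply/measurable_EFinP; exact: measurable_indic.
have mI := measurable_ge0_integral F mF F0.
move=> /(ae_eq_integral_abs mu measurableT mI).1.
apply: ae_imply => x /(_ I) h.
have mFx : measurable_fun [set: R] (fun t => (F (x, t))%:E).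
  by apply/measurable_EFinP; have := measurableT_comp mF (pair1_measurable x).
have : (\int[mu]_t `|(F (x, t))%:E| = 0)%E.
  transitivity (\int[mu]_t (F (x, t))%:E)%E; last exact: h.
  by apply: eq_integral => t _; rewrite gee0_abs ?lee_fin.
move=> /(ae_eq_integral_abs mu measurableT mFx).1.
apply: ae_imply => t /(_ I) + t0 Nxt.
rewrite /F/= !indicE mem_setE in_itv/= t0 mem_set// mulr1 => /eqP.
by rewrite eqe oner_eq0.
Qed.

End DilationAverage.

(** * Dilations and truncations *)

Section Commutation.
Context {R : realType}.
Local Notation mu := (@lebesgue_measure R).
Implicit Types (f g G : R -> R) (p e x : R).
Variables (w : R -> R) (p i : R).
Hypothesis p1 : 1 < p.
Hypothesis mw : measurable_fun [set: R] w.
Hypothesis w0 : forall t, 0 <= w t.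
Hypothesis wneg : forall t, t <= 0 -> w t = 0.
Hypothesis i0 : 0 <= i.
Hypothesis wi : (\int[mu]_t (t `^ p^-1 * w t)%:E = i%:E)%E.

Let p0 : 0 < p. Proof. exact: lt_trans ltr01 p1. Qed.

(** The Hilbert kernel is homogeneous of degree -1. *)
Lemma trunc_kernel_dilate (e t s : R) : 0 < t ->
  t * trunc_kernel e (t * s) = trunc_kernel (e / t) s.
Proof.
move=> t0; rewrite /trunc_kernel normrM (gtr0_norm t0) ltr_pdivrMr// (mulrC `|s|).
case: ifP => _; last by rewrite mulr0.
have [->|s0] := eqVneq s 0; first by rewrite mulr0 invr0 mulr0.
by rewrite invfM mulrA mulfV ?mul1r ?gt_eqF.
Qed.

Lemma integral_trunc_dilate f (e x t : R) : 0 < t -> 0 < e -> memLp p f ->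
  (\int[mu]_y (f (y / t) * trunc_kernel e (x - y))%:E =
   \int[mu]_y (f y * trunc_kernel (e / t) (x / t - y))%:E)%E.
Proof.
move=> t0 e0 lf; have mf := lf.1.
have et0 : 0 < e / t by rewrite divr_gt0.
have iK := integrable_truncLp p f (e / t) (x / t) p1 et0 lf.
pose h (y : R) : R := t^-1 * (f y * trunc_kernel (e / t) (x / t - y)).
have E (y : R) : f (y / t) * trunc_kernel e (x - y) = h (y / t).
  rewrite /h -(trunc_kernel_dilate e t _ t0).
  have -> : t * (x / t - y / t) = x - y by field; rewrite gt_eqF.
  by field; rewrite gt_eqF.
have mh : measurable_fun [set: R] (fun y : R => (h y)%:E).
  apply/measurable_EFinP; apply: measurable_funM => //; apply: measurable_funM => //.
  by apply: (measurableT_comp (measurable_trunc_kernel _)); exact: measurable_funB.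
transitivity (\int[mu]_y (h (y / t))%:E)%E; first by apply: eq_integral => y _; rewrite E.
rewrite (integral_dilate (fun y : R => (h y)%:E) t t0 mh).
have -> : (\int[mu]_y (h y)%:E =
   (t^-1)%:E * \int[mu]_y (f y * trunc_kernel (e / t) (x / t - y))%:E)%E.
  by rewrite -integralZl.
by rewrite muleA -EFinM mulfV ?mul1e// gt_eqF.
Qed.

(** The factor [t `^ p^-1] by which dilation multiplies the L^p norm is the one that
    the weight [w] integrates; this makes Fubini's theorem available. *)
Lemma holder_trunc f (e : R) : 0 < e -> memLp p f -> exists2 b : R, 0 <= b &
  forall x t : R, 0 < t ->
    (\int[mu]_y `|f (y / t) * trunc_kernel e (x - y)|%:E <= (b * t `^ p^-1)%:E)%E.
Proof.
move=> e0 lf; have [mf fi] := lf.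
pose q := p / (p - 1).
have p10 : 0 < p - 1 by rewrite subr_gt0.
have q1 : 1 < q by rewrite /q ltr_pdivlMr// mul1r; lra.
have pq : p^-1 + q^-1 = 1 by rewrite /q invf_div; field; rewrite gt_eqF.
have A0 : (0 <= \int[mu]_y (`|f y| `^ p)%:E)%E by apply: integral_ge0 => y _; rewrite lee_fin powR_ge0.
have B0 : (0 <= \int[mu]_s (`|trunc_kernel e s| `^ q)%:E)%E.
  by apply: integral_ge0 => y _; rewrite lee_fin powR_ge0.
have [A hA0 hA] : exists2 A : R, 0 <= A & (\int[mu]_y (`|f y| `^ p)%:E = A%:E)%E.
  by move: A0 fi; case: (\int[mu]_y _)%E => [A| |] // A0 _; exists A.
have [B hB] : exists B : R, (\int[mu]_s (`|trunc_kernel e s| `^ q)%:E = B%:E)%E.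
  move: B0 (integral_trunc_kernel_powR e q e0 q1).
  by case: (\int[mu]_s _)%E => [B| |] // _ _; exists B.
exists (A `^ p^-1 * B `^ q^-1); first by rewrite mulr_ge0 ?powR_ge0.
move=> x t t0.
have mft : measurable_fun [set: R] (fun y : R => f (y / t)).
  by apply: (measurableT_comp mf); exact: measurable_funM.
have mk : measurable_fun [set: R] (fun y : R => trunc_kernel e (x - y)).
  by apply: (measurableT_comp (measurable_trunc_kernel e)); exact: measurable_funB.
have H := hoelder mu mft mk p0 (lt_trans ltr01 q1) pq.
have E1 : ('N[mu]_1[EFin \o ((fun y : R => f (y / t)%R) \* (fun y : R => trunc_kernel e (x - y)%R))%R] =
   \int[mu]_y `|f (y / t) * trunc_kernel e (x - y)|%:E)%E by rewrite Lnorm1.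
have Ep : ('N[mu]_p%:E[EFin \o (fun y : R => f (y / t)%R)] = ((t * A) `^ p^-1)%:E)%E.
  rewrite unlock -poweR_EFin; congr (_ `^ _)%E.
  transitivity (\int[mu]_y (`|f (y / t)%R| `^ p)%:E)%E.
    by apply: eq_integral => y _; rewrite -poweR_EFin.
  rewrite (integral_dilate (fun y : R => (`|f y| `^ p)%:E) t t0).
  - by rewrite EFinM hA.
  - exact: measurable_normp.
have Eq : ('N[mu]_q%:E[EFin \o (fun y : R => trunc_kernel e (x - y)%R)] = (B `^ q^-1)%:E)%E.
  rewrite unlock -poweR_EFin; congr (_ `^ _)%E.
  transitivity (\int[mu]_y (`|trunc_kernel e (x - y)| `^ q)%:E)%E.
    by apply: eq_integral => y _; rewrite -poweR_EFin.
  rewrite (integral_reflect (fun s : R => (`|trunc_kernel e s| `^ q)%:E) x).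
  - exact: hB.
  - by apply: measurable_normp; exact: measurable_trunc_kernel.
rewrite E1 Ep Eq in H; apply: (le_trans H).
rewrite -EFinM lee_fin (powRM _ (ltW t0) hA0).
by rewrite -[leLHS]mulrA [leLHS]mulrC.
Qed.

Definition dil_kernel f (e x : R) (z : R * R) : R :=
  f (z.2 / z.1) * w z.1 * trunc_kernel e (x - z.2).

Lemma dil_kernelP f (e x : R) (F := dil_kernel f e x) : 0 < e -> memLp p f ->
  [/\ measurable_fun setT F, (\int[mu]_t \int[mu]_y `|F (t, y)|%:E < +oo)%E &
   forall t, (\int[mu]_y (F (t, y))%:E = (trunc f (e / t) (x / t) * w t)%:E)%E].
Proof.
move=> e0 lf; have mf := lf.1.
have [b b0 hb] := holder_trunc f e e0 lf.
have mF : measurable_fun setT F.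
  apply: measurable_funM.
    apply: measurable_funM; last exact: (measurableT_comp mw measurable_fst).
    apply: (measurableT_comp mf); apply: measurable_funM; first exact: measurable_snd.
    by apply: measurable_funV; exact: measurable_fst.
  apply: (measurableT_comp (measurable_trunc_kernel e)).
  by apply: measurable_funB => //; exact: measurable_snd.
have iD (t : R) : 0 < t ->
    mu.-integrable setT (fun y => (f (y / t) * trunc_kernel e (x - y))%:E).
  move=> t0; apply/integrableP; split; last by apply: le_lt_trans (hb x t t0) _; rewrite ltry.
  apply/measurable_EFinP; apply: measurable_funM.
    by apply: (measurableT_comp mf); exact: measurable_funM.
  by apply: (measurableT_comp (measurable_trunc_kernel e)); exact: measurable_funB.
have inner (t : R) : 0 < t -> (\int[mu]_y (F (t, y))%:E = (trunc f (e / t) (x / t) * w t)%:E)%E.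
  move=> t0; have et0 : 0 < e / t by rewrite divr_gt0.
  have iK := integrable_truncLp p f (e / t) (x / t) p1 et0 lf.
  have D := integral_trunc_dilate f e x t t0 e0 lf.
  rewrite truncE /Rintegral EFinM fineK; last exact: integrable_fin_num.
  rewrite -D -integralZr//.
    by apply: eq_integral => y _; rewrite /F /dil_kernel/= -EFinM mulrAC.
  exact: iD.
have iF : (\int[mu]_t \int[mu]_y `|F (t, y)|%:E < +oo)%E.
  apply: (@le_lt_trans _ _ (\int[mu]_t (b%:E * (t `^ p^-1 * w t)%:E))%E).
    apply: ge0_le_integral => //.
    - by move=> t _; apply: integral_ge0.
    - by apply: (measurable_ge0_integral (fun z => `|F z|)) => //; exact: measurable_fun_normr.
    - apply: measurable_funeM; apply/measurable_EFinP.
      apply: measurable_funM; [exact: measurable_fun_powR|exact: mw].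
    - move=> t _; have [t0|t0] := ltP 0 t; last first.
        rewrite wneg// mulr0 mule0; under eq_integral do rewrite /F /dil_kernel/= wneg// mulr0 mul0r normr0.
        by rewrite integral0.
      have -> : (\int[mu]_y `|F (t, y)|%:E =
          (w t)%:E * \int[mu]_y `|f (y / t) * trunc_kernel e (x - y)|%:E)%E.
        rewrite -ge0_integralZl//.
        - apply: eq_integral => y _; rewrite /F /dil_kernel/= -EFinM; congr (_%:E).
          by rewrite mulrAC normrM (ger0_norm (w0 t)) mulrC.
        - apply/measurable_EFinP; apply: measurable_fun_normr; apply: measurable_funM.
            by apply: (measurableT_comp mf); exact: measurable_funM.
          by apply: (measurableT_comp (measurable_trunc_kernel e)); exact: measurable_funB.
        - by rewrite lee_fin.
      apply: (@le_trans _ _ ((w t)%:E * (b * t `^ p^-1)%:E)%E).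
        by apply: lee_wpmul2l; [rewrite lee_fin|exact: hb].
      by rewrite -!EFinM lee_fin mulrC mulrA.
  rewrite ge0_integralZl//.
  - by rewrite wi -EFinM ltry.
  - apply/measurable_EFinP; apply: measurable_funM; [exact: measurable_fun_powR|exact: mw].
  - by move=> t _; rewrite lee_fin mulr_ge0 ?powR_ge0.
split=> // t; have [t0|t0] := ltP 0 t; first exact: inner.
rewrite wneg// mulr0; under eq_integral do rewrite /F /dil_kernel/= wneg// mulr0 mul0r.
by rewrite integral0.
Qed.

(** A truncation of a dilate is a truncation of the function at the radius [e / t];
    Fubini's theorem does the rest. *)
Lemma trunc_dil f (e x : R) : 0 < e -> memLp p f ->
  trunc (dil w f) e x = \int[mu]_t (trunc f (e / t) (x / t) * w t).
Proof.
move=> e0 lf; have mf := lf.1; have [mF iF inner] := dil_kernelP f e x e0 lf.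
pose F := dil_kernel f e x.
have LHS : (\int[mu]_y \int[mu]_t (F (t, y))%:E = \int[mu]_y (dil w f y * trunc_kernel e (x - y))%:E)%E.
  apply: ae_eq_integral => //.
  - apply: (measurable_integral2 (fun z => F (z.2, z.1))).
      apply: (measurableT_comp mF); apply: measurable_fun_pair.
        exact: measurable_snd.
      exact: measurable_fst.
    rewrite -(tonelli_real (fun z => `|F z|)) => [//|//|]; last by move=> z.
    exact: measurable_fun_normr.
  - apply/measurable_EFinP; apply: measurable_funM; first exact: measurable_dil.
    by apply: (measurableT_comp (measurable_trunc_kernel e)); exact: measurable_funB.
  have := dil_integrable w p i p1 mw w0 wneg i0 wi f lf.
  apply: ae_imply => y iy _.
  rewrite /F /dil_kernel/= EFinM /dil /Rintegral fineK; last exact: integrable_fin_num.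
  by rewrite -integralZr//; apply: eq_integral => t _; rewrite EFinM.
rewrite truncE /Rintegral -LHS -(fubini_real F mF iF); congr fine.
by apply: eq_integral => t _; rewrite inner.
Qed.

(** By [trunc_dil] the truncations of [dil w f] average those of [f], whose radii
    [e / t] tend to 0 with [e]. They are dominated by the maximal truncation [m] of
    [f], and [m (x / t) * w t] is integrable in [t] for almost every [x] because [m]
    is in L^p. *)
Lemma dil_commute f g : memLp p f -> memLp p g ->
  {ae mu, forall x, trunc f e x @[e --> 0^'+] --> g x} ->
  {ae mu, forall x, trunc (dil w f) e x @[e --> 0^'+] --> dil w g x}.
Proof.
move=> lf lg fg; have [mf _] := lf; have [mg _] := lg.
have [C C0 hC] := @maximal_truncation R p p1.
have [M [mM M0 hM iM]] := hC f lf.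
pose m x := fine (M x) `^ p^-1.
have iM' : mu.-integrable setT M.
  apply/integrableP; split; first exact: mM.
  under eq_integral do rewrite gee0_abs//.
  apply: le_lt_trans iM _; apply: lte_mul_pinfty; [by rewrite lee_fin|by []|exact: lf.2].
have Mfin := integrable_ae measurableT iM'.
have m0 x : 0 <= m x by exact: powR_ge0.
have mm : measurable_fun [set: R] m.
  by apply: measurable_fun_powR; exact: (measurableT_comp (fine_measurable measurableT)).
have lm : memLp p m.
  split; first exact: mm.
  apply: (@le_lt_trans _ _ (\int[mu]_x M x)%E).
    apply: ge0_le_integral => //; first exact: measurable_normp.
    move=> x _; rewrite ger0_norm// /m -powRrM mulVf ?gt_eqF// powRr1 ?fine_ge0//.
    by have := M0 x; case: (M x) => [r| |]//= _; rewrite leey.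
  by have /integrableP[_] := iM'; under eq_integral do rewrite gee0_abs//.
have good : {ae mu, forall x, (forall e : R, 0 < e -> `|trunc f e x| <= m x) /\
    trunc f e x @[e --> 0^'+] --> g x}.
  apply: (ae_imply2 _ _ _ _ Mfin fg) => x /(_ I) Mx fgx.
  split=> // e e0; rewrite /m -powR_le_root ?fine_ge0//.
  by rewrite -lee_fin fineK//; exact: hM.
have [N [mN N0 hN]] := good.
have bd := dil_integrable w p i p1 mw w0 wneg i0 wi m lm.
have aeN := ae_dilate N mN N0.
apply: (ae_imply2 _ _ _ _ bd aeN) => x im Nx.
apply/cvg_at_rightP => u [u0 uc].
have mT e : 0 < e -> measurable_fun [set: R] (fun t : R => (trunc f (e / t) (x / t) * w t)%:E).
  move=> e0; have [mF iF inner] := dil_kernelP f e x e0 lf.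
  have -> : (fun t : R => (trunc f (e / t) (x / t) * w t)%:E) =
    (fun t => \int[mu]_y (dil_kernel f e x (t, y))%:E)%E by apply/funext => t; rewrite inner.
  exact: measurable_integral2.
have := @dominated_convergence _ _ R mu setT measurableT
  (fun n t => (trunc f (u n / t) (x / t) * w t)%:E)
  (fun t => (g (x / t) * w t)%:E)
  (fun t => (m (x / t) * w t)%:E)
  (fun n => mT (u n) (u0 n)).
case.
- by apply/measurable_EFinP; exact: measurable_dil1.
- apply: (ae_imply _ _ _ Nx) => t Nt _.
  have [t0|t0] := ltP 0 t; last by rewrite wneg// mulr0; under eq_fun do rewrite mulr0; exact: cvg_cst.
  apply: cvg_EFin; first by apply: nearW.
  apply: cvgMl.
  have [_ fgx] : (forall e : R, 0 < e -> `|trunc f e (x / t)| <= m (x / t)) /\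
    trunc f e (x / t) @[e --> 0^'+] --> g (x / t).
    by apply: contrapT => h; exact: (Nt t0 (hN _ h)).
  move/cvg_at_rightP : fgx; apply; split; first by move=> n; rewrite divr_gt0.
  by rewrite -(mul0r t^-1); apply: cvgMl.
- exact: im.
- apply: (ae_imply _ _ _ Nx) => t Nt n _ /=.
  have [t0|t0] := ltP 0 t; last by rewrite wneg// !mulr0 normr0.
  rewrite lee_fin normrM (ger0_norm (w0 t)) ler_wpM2r//.
  have [fm _] : (forall e : R, 0 < e -> `|trunc f e (x / t)| <= m (x / t)) /\
    trunc f e (x / t) @[e --> 0^'+] --> g (x / t).
    by apply: contrapT => h; exact: (Nt t0 (hN _ h)).
  by apply: fm; rewrite divr_gt0.
move=> ig _ h.
under eq_fun => n do rewrite (trunc_dil f (u n) x (u0 n) lf).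
apply: fine_cvg; rewrite fineK; first exact: h.
exact: integrable_fin_num.
Qed.

End Commutation.

(** * Complex-valued L^p functions *)

#[local] Arguments Cmodulus {R} z : simpl never.

Section ComplexLp.
Context {R : realType}.
Local Notation mu := (@lebesgue_measure R).
Implicit Types (f g : R -> R[i]) (p x : R) (z : R[i]).

Lemma CmodulusE z : Cmodulus z = Num.sqrt (complex.Re z ^+ 2 + complex.Im z ^+ 2).
Proof. by case: z. Qed.

Lemma Cmodulus_ge0 z : 0 <= Cmodulus z.
Proof. by rewrite CmodulusE sqrtr_ge0. Qed.

Lemma sqr_Cmodulus z : Cmodulus z ^+ 2 = complex.Re z ^+ 2 + complex.Im z ^+ 2.
Proof. by rewrite CmodulusE sqr_sqrtr// addr_ge0 ?sqr_ge0. Qed.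

Lemma Re_le_Cmodulus z : `|complex.Re z| <= Cmodulus z.
Proof.
rewrite -(ler_pXn2r (n := 2))// ?nnegrE ?Cmodulus_ge0// sqr_Cmodulus real_normK ?num_real//.
by rewrite lerDl sqr_ge0.
Qed.

Lemma Im_le_Cmodulus z : `|complex.Im z| <= Cmodulus z.
Proof.
rewrite -(ler_pXn2r (n := 2))// ?nnegrE ?Cmodulus_ge0// sqr_Cmodulus real_normK ?num_real//.
by rewrite lerDr sqr_ge0.
Qed.

Lemma Cmodulus_le z : Cmodulus z <= `|complex.Re z| + `|complex.Im z|.
Proof.
rewrite -(ler_pXn2r (n := 2))// ?nnegrE ?Cmodulus_ge0 ?addr_ge0// sqr_Cmodulus.
rewrite sqrrD !real_normK ?num_real// addrAC lerDl mulrn_wge0// mulr_ge0.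
Qed.

Lemma Cmodulus_dot (a b : R[i]) :
  complex.Re a * complex.Re b + complex.Im a * complex.Im b <= Cmodulus a * Cmodulus b.
Proof.
apply: le_trans (ler_norm _) _.
rewrite -(ler_pXn2r (n := 2))// ?nnegrE ?mulr_ge0 ?Cmodulus_ge0//.
rewrite exprMn !sqr_Cmodulus real_normK ?num_real//.
case: a => a1 a2; case: b => b1 b2 /=.
rewrite -subr_ge0 (_ : _ - _ = (a1 * b2 - a2 * b1) ^+ 2) ?sqr_ge0//; ring.
Qed.

Lemma Re_mulC z (c : R) : complex.Re (z * c%:C)%C = complex.Re z * c.
Proof. by case: z => a b /=; rewrite mulr0 subr0. Qed.

Lemma Im_mulC z (c : R) : complex.Im (z * c%:C)%C = complex.Im z * c.
Proof. by case: z => a b /=; rewrite mulr0 add0r. Qed.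

Lemma CmodulusZ z (c : R) : Cmodulus (z * c%:C)%C = Cmodulus z * `|c|.
Proof.
rewrite !CmodulusE Re_mulC Im_mulC !exprMn -mulrDl sqrtrM ?addr_ge0 ?sqr_ge0//.
by rewrite sqrtr_sqr.
Qed.

Lemma measurable_Cmodulus f : Cmeasurable f -> measurable_fun [set: R] (fun x => Cmodulus (f x)).
Proof.
move=> [mr mi].
have -> : (fun x => Cmodulus (f x)) =
    (fun x => (complex.Re (f x) ^+ 2 + complex.Im (f x) ^+ 2) `^ 2^-1).
  by apply/funext => x; rewrite CmodulusE powR12_sqrt// addr_ge0 ?sqr_ge0.
by apply: measurable_fun_powR; apply: measurable_funD; apply: measurable_funX.
Qed.

Lemma LpNormE p f : LpNorm p f = ((\int[mu]_x (Cmodulus (f x) `^ p)%:E) `^ p^-1)%E.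
Proof.
have -> : (\int[mu]_x (Cmodulus (f x) `^ p)%:E =
    \int[mu]_x `|(EFin \o (Cmodulus \o f)) x| `^ p)%E.
  apply: eq_integral => x _.
  have h : (`|(Cmodulus (f x))%:E| = (Cmodulus (f x))%:E)%E by rewrite gee0_abs// lee_fin Cmodulus_ge0.
  by rewrite /comp h poweR_EFin.
by rewrite /LpNorm unlock.
Qed.

Lemma LpNorm_lty p f : 0 < p -> (LpNorm p f < +oo)%E ->
  (\int[mu]_x (Cmodulus (f x) `^ p)%:E < +oo)%E.
Proof.
by move=> p0; rewrite LpNormE; apply: lty_poweRy; rewrite invr_eq0 gt_eqF.
Qed.

Lemma LpP p f : 0 < p -> Lp p f <->
  memLp p (fun x => complex.Re (f x)) /\ memLp p (fun x => complex.Im (f x)).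
Proof.
move=> p0; split=> [[[mr mi] /(LpNorm_lty p f p0) fi]|[lr li]].
  have mf := measurable_Cmodulus f (conj mr mi).
  have lm : memLp p (fun x => Cmodulus (f x)).
    split; first exact: mf.
    by under eq_integral do rewrite (ger0_norm (Cmodulus_ge0 _)).
  split; apply: (memLp_le p _ _ (ltW p0) lm) => // x; rewrite [leRHS]ger0_norm ?Cmodulus_ge0//.
    exact: Re_le_Cmodulus.
  exact: Im_le_Cmodulus.
have cm : Cmeasurable f by split; [exact: lr.1|exact: li.1].
split; first exact: cm.
rewrite LpNormE; apply: poweR_lty.
have ln h : memLp p h -> memLp p (fun x => `|h x|).
  move=> lh; apply: (memLp_le p h _ (ltW p0) lh) => [|x]; last by rewrite normr_id.
  by apply: measurable_fun_normr; exact: lh.1.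
have ls := memLpD p _ _ p0 (ln _ lr) (ln _ li).
have lm := memLp_le p _ (fun x => Cmodulus (f x)) (ltW p0) ls (measurable_Cmodulus f cm).
have [|_] := lm.
  move=> x; rewrite (ger0_norm (Cmodulus_ge0 _)) (ger0_norm (addr_ge0 (normr_ge0 _) (normr_ge0 _))).
  exact: Cmodulus_le.
by under eq_integral do rewrite (ger0_norm (Cmodulus_ge0 _)).
Qed.

(** If [K] is the integral of [u + i v], then [|K|^2] is the integral of the scalar
    product of [K] with [u + i v], which is at most [|K|] times the modulus. *)
Lemma Cmodulus_integral (u v : R -> R) :
  mu.-integrable setT (EFin \o u) -> mu.-integrable setT (EFin \o v) ->
  ((Cmodulus (Complex (\int[mu]_t u t) (\int[mu]_t v t)))%:E <=
   \int[mu]_t (Cmodulus (Complex (u t) (v t)))%:E)%E.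
Proof.
move=> iu iv; set a := \int[mu]_t u t; set b := \int[mu]_t v t.
pose K := Complex a b; pose c := Cmodulus K.
have /integrableP[/measurable_EFinP mu_ _] := iu.
have /integrableP[/measurable_EFinP mv _] := iv.
have mm : measurable_fun [set: R] (fun t => Cmodulus (Complex (u t) (v t))).
  exact: (measurable_Cmodulus (fun t => Complex (u t) (v t))).
have im : mu.-integrable setT (EFin \o (fun t => Cmodulus (Complex (u t) (v t)))).
  have := integrableD measurableT (integrable_abse iu) (integrable_abse iv).
  apply: le_integrable => //; first exact/measurable_EFinP.
  move=> t _ /=; rewrite lee_fin (ger0_norm (Cmodulus_ge0 _)) (ger0_norm (addr_ge0 (normr_ge0 _) (normr_ge0 _))).
  exact: (Cmodulus_le (Complex (u t) (v t))).
have mE : (\int[mu]_t (Cmodulus (Complex (u t) (v t)))%:E)%E =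
    (\int[mu]_t Cmodulus (Complex (u t) (v t)))%:E.
  by rewrite /Rintegral fineK//; exact: integrable_fin_num.
rewrite mE lee_fin -/c.
have [->|c0] := eqVneq c 0; first by apply: Rintegral_ge0 => t _; exact: Cmodulus_ge0.
have cp : 0 < c by rewrite lt0r c0 Cmodulus_ge0.
rewrite -(ler_pM2l cp).
have iau : mu.-integrable setT (fun t => (a * u t)%:E) by exact: (integrableZl measurableT a iu).
have ibv : mu.-integrable setT (fun t => (b * v t)%:E) by exact: (integrableZl measurableT b iv).
have -> : c * c = \int[mu]_t (a * u t + b * v t).
  rewrite RintegralD// !RintegralZl// -/a -/b -expr2 sqr_Cmodulus/=; ring.
rewrite -RintegralZl//; apply: le_Rintegral => //.
- exact: (integrableD measurableT iau ibv).
- exact: (integrableZl measurableT c im).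
- move=> t _; exact: (Cmodulus_dot K (Complex (u t) (v t))).
Qed.

End ComplexLp.

(** * The Hausdorff operator on L^p *)

Section Hausdorff.
Context {R : realType}.
Local Notation mu := (@lebesgue_measure R).
Variables (p : R) (phi : R -> R) (i : R).
Hypothesis p1 : 1 < p.
Hypothesis phi0 : forall t, 0 < t -> 0 <= phi t.
Hypothesis mphi : measurable_fun (`]0, +oo[%classic : set R) phi.

(** The values of [phi] on the negative half-line are arbitrary and must not enter. *)
Definition weight (t : R) : R := if 0 < t then phi t / t else 0.

Lemma weight_ge0 t : 0 <= weight t.
Proof. by rewrite /weight; case: ifPn => // t0; rewrite divr_ge0 ?phi0 ?ltW. Qed.

Lemma weight_neg t : t <= 0 -> weight t = 0.
Proof. by rewrite /weight ltNge => ->. Qed.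

Lemma measurable_weight : measurable_fun [set: R] weight.
Proof.
have -> : weight = (fun t : R => phi t / t) \_ (`]0, +oo[%classic : set R).
  by apply/funext => t; rewrite patchE mem_setE in_itv/= andbT.
have h : measurable_fun (`]0, +oo[%classic : set R) (fun t : R => t^-1).
  by apply: measurable_funTS; exact: measurable_inv.
by apply: (measurable_restrictT _ _).1 => //; exact: measurable_funM mphi h.
Qed.

Lemma integral_weight (h : R -> R) :
  (\int[mu]_(t in `]0%R, +oo[) (h t * (phi t / t))%:E = \int[mu]_t (h t * weight t)%:E)%E.
Proof.
rewrite integral_mkcond/=; apply: eq_integral => t _; rewrite patchE mem_setE in_itv/= andbT.
by rewrite /weight; case: ifP => _ //; rewrite mulr0.
Qed.

Lemma integrable_weight (h : R -> R) :
  mu.-integrable `]0, +oo[ (fun t => (h t * (phi t / t))%:E) <->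
  mu.-integrable setT (fun t => (h t * weight t)%:E).
Proof.
have E : (fun t => (h t * weight t)%:E) =
    (fun t => (h t * (phi t / t))%:E) \_ `]0, +oo[.
  apply/funext => t; rewrite patchE mem_setE in_itv/= andbT.
  by rewrite /weight; case: ifP => _ //; rewrite mulr0.
by rewrite E; exact: integrable_mkcond.
Qed.

Lemma hausdorff_Re f x : complex.Re (hausdorff phi f x) = dil weight (fun y => complex.Re (f y)) x.
Proof.
rewrite /hausdorff /Cintegral/= /dil /Rintegral -integral_weight; congr fine.
by apply: eq_integral => t _; rewrite /hausdorff_integrand Re_mulC.
Qed.

Lemma hausdorff_Im f x : complex.Im (hausdorff phi f x) = dil weight (fun y => complex.Im (f y)) x.
Proof.
rewrite /hausdorff /Cintegral/= /dil /Rintegral -integral_weight; congr fine.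
by apply: eq_integral => t _; rewrite /hausdorff_integrand Im_mulC.
Qed.

Lemma Cintegrable_hausdorff f x : Cintegrable `]0, +oo[ (hausdorff_integrand phi f x) <->
  mu.-integrable setT (fun t => (complex.Re (f (x / t)) * weight t)%:E) /\
  mu.-integrable setT (fun t => (complex.Im (f (x / t)) * weight t)%:E).
Proof.
rewrite /Cintegrable -!integrable_weight.
have -> : (fun t => (complex.Re (hausdorff_integrand phi f x t))%:E) =
    (fun t => (complex.Re (f (x / t)) * (phi t / t))%:E).
  by apply/funext => t; rewrite /hausdorff_integrand Re_mulC.
have -> // : (fun t => (complex.Im (hausdorff_integrand phi f x t))%:E) =
    (fun t => (complex.Im (f (x / t)) * (phi t / t))%:E).
by apply/funext => t; rewrite /hausdorff_integrand Im_mulC.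
Qed.

Lemma moment_weight :
  (\int[mu]_(t in `]0%R, +oo[) (t `^ (p^-1 - 1) * phi t)%:E = \int[mu]_t (t `^ p^-1 * weight t)%:E)%E.
Proof.
rewrite -integral_weight; apply: eq_integral => t /[!inE]/=; rewrite in_itv/= andbT => t0.
congr (_%:E); rewrite mulrCA mulrC; congr (_ * _).
by rewrite powRD ?(lt0r_neq0 t0) ?implybT// powRN powRr1// ltW.
Qed.

Hypothesis i0 : 0 <= i.
Hypothesis wi : (\int[mu]_t (t `^ p^-1 * weight t)%:E = i%:E)%E.

Let p0 : 0 < p. Proof. exact: lt_trans ltr01 p1. Qed.

Lemma Lp_hausdorff_exists f : Lp p f -> hausdorff_exists phi f.
Proof.
move=> /(LpP p f p0)[lr li].
have hr := dil_integrable weight p i p1 measurable_weight weight_ge0 weight_neg i0 wi _ lr.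
have hi := dil_integrable weight p i p1 measurable_weight weight_ge0 weight_neg i0 wi _ li.
apply: (ae_imply2 _ _ _ _ hr hi) => x h1 h2.
exact/Cintegrable_hausdorff.
Qed.

Lemma Lp_hausdorff f : Lp p f -> Lp p (hausdorff phi f).
Proof.
move=> /(LpP p f p0)[lr li]; apply/(LpP p _ p0).
under eq_fun do rewrite hausdorff_Re; under [X in _ /\ memLp p X]eq_fun do rewrite hausdorff_Im.
by split; exact: (memLp_dil weight p i p1 measurable_weight weight_ge0 weight_neg i0 wi).
Qed.

Lemma LpNorm_hausdorff f : Lp p f -> (LpNorm p (hausdorff phi f) <= i%:E * LpNorm p f)%E.
Proof.
move=> lf; have [cf _] := lf; have mC := measurable_Cmodulus f cf.
have [ch _] := Lp_hausdorff f lf.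
have S := dil_strong weight p i p1 measurable_weight weight_ge0 weight_neg i0 wi _ mC
  (fun y => Cmodulus_ge0 (f y)).
have mL := measurable_dil_abs weight measurable_weight _ mC.
have mL' : measurable_fun [set: R] (fun x => \int[mu]_t (Cmodulus (f (x / t)%R) * weight t)%:E)%E.
  move: mL; congr measurable_fun; apply/funext => x; apply: eq_integral => t _.
  by rewrite ger0_norm// mulr_ge0 ?Cmodulus_ge0 ?weight_ge0.
rewrite !LpNormE.
have step : (\int[mu]_x (Cmodulus (hausdorff phi f x) `^ p)%:E <=
   (i `^ p)%:E * \int[mu]_x (Cmodulus (f x) `^ p)%:E)%E.
  apply: le_trans S; apply: ae_ge0_le_integral => //.
  - by move=> x _; rewrite lee_fin powR_ge0.
  - by apply/measurable_EFinP; apply: measurable_fun_powR; exact: measurable_Cmodulus.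
  - by move=> x _; exact: poweR_ge0.
  - exact: (measurableT_comp (measurable_poweR p)).
  - have := Lp_hausdorff_exists f lf.
    apply: ae_imply => x /Cintegrable_hausdorff[h1 h2] _.
    rewrite -poweR_EFin; apply: gt0_ler_poweR.
    + exact: ltW.
    + by rewrite in_itv/= leey andbT lee_fin; exact: Cmodulus_ge0.
    + rewrite in_itv/= leey andbT; apply: integral_ge0 => t _.
      by rewrite lee_fin mulr_ge0 ?Cmodulus_ge0 ?weight_ge0.
    have := Cmodulus_integral _ _ h1 h2.
    have -> : Complex (\int[mu]_t (complex.Re (f (x / t)) * weight t))
        (\int[mu]_t (complex.Im (f (x / t)) * weight t)) = hausdorff phi f x.
      apply/eqP; rewrite eq_complex hausdorff_Re hausdorff_Im.
      by rewrite !eqxx.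
    move=> /le_trans; apply; apply: ge0_le_integral => //.
    + by move=> t _; rewrite lee_fin Cmodulus_ge0.
    + apply/measurable_EFinP; apply: (measurable_Cmodulus (fun t : R => Complex _ _)).
      split.
        exact: (measurable_dil1 weight measurable_weight (fun y => complex.Re (f y)) x cf.1).
      exact: (measurable_dil1 weight measurable_weight (fun y => complex.Im (f y)) x cf.2).
    + apply/measurable_EFinP.
      exact: (measurable_dil1 weight measurable_weight (fun y => Cmodulus (f y)) x mC).
    + move=> t _; rewrite lee_fin.
      have -> : Complex (complex.Re (f (x / t)) * weight t) (complex.Im (f (x / t)) * weight t) =
          (f (x / t) * (weight t)%:C)%C.
        by apply/eqP; rewrite eq_complex Re_mulC Im_mulC !eqxx.
      by rewrite CmodulusZ ger0_norm ?weight_ge0.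
have S2 := @gt0_ler_poweR R p^-1 (ltac:(by rewrite invr_ge0 ltW)) _ _ _ _ step.
apply: (le_trans (S2 _ _)).
- by rewrite in_itv/= leey andbT; apply: integral_ge0 => x _; rewrite lee_fin powR_ge0.
- rewrite in_itv/= leey andbT mule_ge0 ?lee_fin ?powR_ge0//.
  by apply: integral_ge0 => x _; rewrite lee_fin powR_ge0.
rewrite poweRM ?lee_fin ?powR_ge0//; last by apply: integral_ge0 => x _; rewrite lee_fin powR_ge0.
by rewrite poweR_EFin -powRrM mulfV ?gt_eqF// powRr1.
Qed.

Lemma dil_linear (a b : R) (u v h : R -> R) x :
  mu.-integrable setT (fun t => (u (x / t) * weight t)%:E) ->
  mu.-integrable setT (fun t => (v (x / t) * weight t)%:E) ->
  mu.-integrable setT (fun t => (h (x / t) * weight t)%:E) ->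
  dil weight (fun y => a * u y + b * v y + h y) x =
  a * dil weight u x + b * dil weight v x + dil weight h x.
Proof.
move=> iu iv ih; rewrite /dil.
have iau := integrableZl measurableT a iu; have ibv := integrableZl measurableT b iv.
have iuv := integrableD measurableT iau ibv.
rewrite -!RintegralZl// -RintegralD// -RintegralD//.
by apply: eq_Rintegral => t _; ring.
Qed.

Lemma hausdorff_linear (a : R[i]) f g : Lp p f -> Lp p g ->
  hausdorff phi (fun x => a * f x + g x) =
  (fun x => a * hausdorff phi f x + hausdorff phi g x) %[ae mu].
Proof.
move=> lf lg.
have hf := Lp_hausdorff_exists f lf; have hg := Lp_hausdorff_exists g lg.
apply: (ae_imply2 _ _ _ _ hf hg).
move=> x /Cintegrable_hausdorff[f1 f2] /Cintegrable_hausdorff[g1 g2] _.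
case: a => a b; apply/eqP; rewrite eq_complex; apply/andP; split; apply/eqP.
  rewrite hausdorff_Re.
  transitivity (dil weight (fun y => a * complex.Re (f y) + (- b) * complex.Im (f y) + complex.Re (g y)) x).
    congr (dil weight _ x); apply/funext => y.
    by case: (f y) => ? ?; case: (g y) => ? ? /=; ring.
  rewrite dil_linear// -!hausdorff_Re -!hausdorff_Im.
  by case: (hausdorff phi f x) => ? ?; case: (hausdorff phi g x) => ? ? /=; ring.
rewrite hausdorff_Im.
transitivity (dil weight (fun y => b * complex.Re (f y) + a * complex.Im (f y) + complex.Im (g y)) x).
  congr (dil weight _ x); apply/funext => y.
  by case: (f y) => ? ?; case: (g y) => ? ? /=; ring.
rewrite dil_linear// -!hausdorff_Re -!hausdorff_Im.
by case: (hausdorff phi f x) => ? ?; case: (hausdorff phi g x) => ? ? /=; ring.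
Qed.

End Hausdorff.

(** * The Hilbert transform on L^p *)

Section HilbertTransform.
Context {R : realType}.
Local Notation mu := (@lebesgue_measure R).
Implicit Types (f g : R -> R[i]).
Variable p : R.
Hypothesis p1 : 1 < p.

Let p0 : 0 < p. Proof. exact: lt_trans ltr01 p1. Qed.

Lemma Re_divC (z : R[i]) (c : R) : complex.Re (z / c%:C)%C = complex.Re z / c.
Proof.
have -> : (z / c%:C = z * (c^-1)%:C)%C by rewrite fmorphV.
by rewrite Re_mulC.
Qed.

Lemma Im_divC (z : R[i]) (c : R) : complex.Im (z / c%:C)%C = complex.Im z / c.
Proof.
have -> : (z / c%:C = z * (c^-1)%:C)%C by rewrite fmorphV.
by rewrite Im_mulC.
Qed.

Lemma hilbert_truncE f x e : hilbert_trunc f x e =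
  Complex (trunc (fun y => complex.Re (f y)) e x) (trunc (fun y => complex.Im (f y)) e x).
Proof.
rewrite /hilbert_trunc /Cintegral /trunc /hilbert_integrand.
by congr Complex; apply: eq_Rintegral => y _; rewrite (Re_divC, Im_divC).
Qed.

Lemma Cintegrable_hilbert f x e : 0 < e -> Lp p f ->
  Cintegrable [set y | e < `|x - y|] (hilbert_integrand f x).
Proof.
move=> e0 /(LpP p f p0)[lr li].
have mD : measurable [set y : R | e < `|x - y|].
  have h : measurable_fun [set: R] (fun y : R => `|x - y|).
    by apply: measurable_fun_normr; exact: measurable_funB.
  rewrite (_ : [set y | _] = ~` [set y : R | `|x - y| <= e]); last first.
    by apply/seteqP; split=> y /=; rewrite ltNge => /negP.
  by apply: measurableC; apply: measurable_ler.
have key (h : R -> R) : memLp p h ->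
    mu.-integrable [set y : R | e < `|x - y|] (fun y => (h y / (x - y))%:E).
  move=> lh; apply: (@integrable_mkcond _ _ R mu _ (fun y : R => (h y / (x - y))%:E) mD).2.
  have := integrable_truncLp p h e x p1 e0 lh.
  apply: eq_integrable => // y _; rewrite patchE /trunc_kernel.
  case: (boolP (y \in _)) => [/set_mem/= -> //|/negP ny].
  by rewrite ifN ?mulr0//; apply/negP => ey; apply: ny; exact: mem_set.
split.
- have := key _ lr; apply: eq_integrable => // y _; by rewrite /hilbert_integrand Re_divC.
- have := key _ li; apply: eq_integrable => // y _; by rewrite /hilbert_integrand Im_divC.
Qed.

Lemma cvg_complexP (T : Type) (F : set_system T) (FF : ProperFilter F) (u v : T -> R) (a b : R) :
  ((fun t => Complex (u t) (v t) : R[i]^o) @ F --> (Complex a b : R[i]^o)) <->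
  (u @ F --> a) /\ (v @ F --> b).
Proof.
have nE (z : R[i]) : `|z| = (Cmodulus z)%:C%C by [].
split.
  move=> /cvgrPdist_le h; split; apply/cvgrPdist_le => eps eps0.
    have e0 : 0 < eps%:C%C :> R[i] by rewrite ltcR.
    apply: filterS (h _ e0) => t; rewrite nE lecR; apply: le_trans.
    exact: (Re_le_Cmodulus (Complex a b - Complex (u t) (v t))).
  have e0 : 0 < eps%:C%C :> R[i] by rewrite ltcR.
  apply: filterS (h _ e0) => t; rewrite nE lecR; apply: le_trans.
  exact: (Im_le_Cmodulus (Complex a b - Complex (u t) (v t))).
move=> [/cvgrPdist_le hu /cvgrPdist_le hv]; apply/cvgrPdist_le => -[eps d].
rewrite ltcE/= => /andP[/eqP -> eps0].
have e2 : 0 < eps / 2 by rewrite divr_gt0.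
apply: filterS2 (hu _ e2) (hv _ e2) => t h1 h2; rewrite nE lecR.
apply: le_trans (Cmodulus_le _) _ => /=; lra.
Qed.

Definition hilbert_cvg f x := cvg (hilbert_trunc f x e @[e --> 0^'+]).

Lemma hilbert_cvgP f x : hilbert_cvg f x <->
  cvg (trunc (fun y => complex.Re (f y)) e x @[e --> 0^'+]) /\
  cvg (trunc (fun y => complex.Im (f y)) e x @[e --> 0^'+]).
Proof.
rewrite /hilbert_cvg; under eq_fun do rewrite hilbert_truncE.
split.
  move=> /cvg_ex[[a b]] /(cvg_complexP _ _ _ _ _ a b)[h1 h2].
  by split; apply/cvg_ex; eexists; eassumption.
move=> [/cvg_ex[a h1] /cvg_ex[b h2]]; apply/cvg_ex; exists (Complex a b : R[i]^o).
exact/cvg_complexP.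
Qed.

Lemma hilbert_lim f x (a b : R) :
  trunc (fun y => complex.Re (f y)) e x @[e --> 0^'+] --> a ->
  trunc (fun y => complex.Im (f y)) e x @[e --> 0^'+] --> b ->
  hilbert f x = Complex (pi^-1 * a) (pi^-1 * b).
Proof.
move=> h1 h2; rewrite /hilbert.
have h : hilbert_trunc f x e @[e --> 0^'+] --> (Complex a b : R[i]^o).
  by under eq_fun do rewrite hilbert_truncE; apply/cvg_complexP.
rewrite (cvg_lim (@norm_hausdorff _ R[i]^o) h).
by apply/eqP; rewrite eq_complex/= !mul0r subr0 addr0 !eqxx.
Qed.

Lemma Lp_hilbert_exists f : Lp p f -> hilbert_exists f.
Proof.
move=> lf; have /(LpP p f p0)[lr li] := lf.
have cr := trunc_cvg_memLp p _ p1 lr; have ci := trunc_cvg_memLp p _ p1 li.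
apply: (ae_imply2 _ _ _ _ cr ci) => x h1 h2.
split; first by move=> e e0; exact: Cintegrable_hilbert.
exact/hilbert_cvgP.
Qed.

(** By right continuity in the radius, Cauchy's criterion can be tested on rational
    radii. *)
Lemma measurable_cvg_trunc (f : R -> R) : memLp p f ->
  measurable [set x | cvg (trunc f e x @[e --> 0^'+])].
Proof.
move=> lf; have mf := lf.1.
pose q (k : nat) : R := ratr (odflt 0 (unpickle k : option rat)).
pose near0 (k m : nat) := (0 < q k) && (q k < m.+1%:R^-1).
pose A (n m : nat) := \bigcap_k1 \bigcap_k2
  [set x | near0 k1 m && near0 k2 m -> `|trunc f (q k1) x - trunc f (q k2) x| <= n.+1%:R^-1].
have -> : [set x | cvg (trunc f e x @[e --> 0^'+])] = \bigcap_n \bigcup_m A n m.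
  apply/seteqP; split => x /=.
    move=> /cvg_at_right0_cauchy h n _.
    have [|d d0 hd] := h (n.+1%:R^-1); first by rewrite invr_gt0.
    have [m] := ltr_add_invr d0; rewrite add0r => hm; exists m => // k1 _ k2 _ /= /andP[/andP[a1 a2] /andP[b1 b2]].
    by apply: hd => //; exact: lt_trans hm.
  move=> h; apply/cvg_at_right0_cauchy => eta eta0.
  have [n] := ltr_add_invr eta0; rewrite add0r => hn; have [m _ Am] := h n I.
  exists (m.+1%:R^-1); first by rewrite invr_gt0.
  move=> e1 e2 e10 e1m e20 e2m; apply: le_trans (ltW hn).
  apply/ler_addgt0Pr => eps eps0; have eps2 : 0 < eps / 2 by rewrite divr_gt0.
  have [q1 [a1 a2 a3]] := trunc_rat_approx p f e1 _ x _ p1 e10 e1m eps2 lf.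
  have [q2 [b1 b2 b3]] := trunc_rat_approx p f e2 _ x _ p1 e20 e2m eps2 lf.
  have := Am (pickle q1) I (pickle q2) I; rewrite /= /near0 /q !pickleK /= a2 b2.
  rewrite (lt_trans e10 a1) (lt_trans e20 b1) => /(_ isT).
  move: a3 b3; rewrite !ler_norml => /andP[c1 c2] /andP[c3 c4] /andP[c5 c6].
  move: c1 c2 c3 c4 c5 c6; move: (trunc f e1 x) (trunc f e2 x) (trunc f (ratr q1) x).
  move: (trunc f (ratr q2) x) (n.+1%:R^-1 : R) (eps : R) => t1 c eps' t2 t3 t4 *.
  by apply/andP; split; lra.
apply: bigcap_measurable => // n _; apply: bigcup_measurable => m _.
apply: bigcap_measurable => // k1 _; apply: bigcap_measurable => // k2 _.
case: (near0 k1 m && near0 k2 m); last first.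
  by rewrite (_ : [set x | _] = setT)//; apply/seteqP; split.
rewrite (_ : [set x | _] = [set x | `|trunc f (q k1) x - trunc f (q k2) x| <= n.+1%:R^-1]).
  apply: measurable_ler => //; apply: measurable_fun_normr.
  by apply: measurable_funB; exact: measurable_trunc.
by apply/seteqP; split => x /=; [apply|].
Qed.

(** [h] is a pointwise limit of measurable functions and is dominated almost
    everywhere by the maximal truncation. The constant [c] accounts for the default
    value of the limit where the principal value does not exist. *)
Lemma memLp_lim (f h : R -> R) (D : set R) (c : R) : memLp p f -> measurable D ->
  mu.-negligible (~` D) ->
  (forall x, D x -> trunc f e x @[e --> 0^'+] --> h x) ->
  (forall x, ~ D x -> h x = c) -> memLp p h.
Proof.
move=> lf mD nD hD hc; have mf := lf.1.
pose u (n : nat) : R := n.+1%:R^-1.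
have u0 n : 0 < u n by rewrite invr_gt0.
pose hn n x := \1_D x * trunc f (u n) x + (1 - \1_D x) * c.
have mh : measurable_fun [set: R] h.
  apply: (measurable_fun_cvg (h := hn)) => // [n|x _].
    apply: measurable_funD.
      by apply: measurable_funM; [exact: measurable_indic|exact: measurable_trunc].
    by apply: measurable_funM => //; apply: measurable_funB => //; exact: measurable_indic.
  rewrite /hn; have [Dx|Dx] := pselect (D x).
    rewrite indicE mem_set//=; under eq_fun do rewrite mul1r subrr mul0r addr0.
    have /cvg_at_rightP := hD x Dx; apply; split => //.
    exact: cvg_harmonic.
  rewrite indicE memNset//= hc//; under eq_fun do rewrite mul0r add0r subr0 mul1r.
  exact: cvg_cst.
split; first exact: mh.
have [C C0 hC] := @maximal_truncation R p p1.
have [M [mM M0 hM iM]] := hC f lf.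
apply: (@le_lt_trans _ _ (\int[mu]_x M x)%E); last first.
  by apply: le_lt_trans iM _; apply: lte_mul_pinfty; [rewrite lee_fin|by []|exact: lf.2].
apply: ae_ge0_le_integral => //; first exact: measurable_normp.
apply: negligibleS nD => x /= hx Dx; apply: hx => _.
have := M0 x; have := hM ^~ x; case: (M x) => [r| |] // hr; last by move=> _; exact: leey.
rewrite lee_fin => r0; rewrite lee_fin.
have e_le e : 0 < e -> `|trunc f e x| <= r `^ p^-1.
  move=> e0; have := hr e e0; rewrite lee_fin => hn1.
  by rewrite -powR_le_root.
rewrite powR_le_root//; apply/ler_addgt0Pr => eps eps0.
have := hD x Dx; move/cvgrPdist_le => /(_ eps eps0) [d /= d0 hd].
have d2 : 0 < d / 2 by rewrite divr_gt0.
have /hd/(_ d2) : `|0 - d / 2| < d by rewrite sub0r normrN gtr0_norm//; lra.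
have := e_le _ d2; have := ler_normD (h x - trunc f (d / 2) x) (trunc f (d / 2) x).
rewrite subrK; move: (eps : R) => eps' *; lra.
Qed.

Lemma Lp_hilbert f : Lp p f -> Lp p (hilbert f).
Proof.
move=> lf; have /(LpP p f p0)[lr li] := lf.
pose D := [set x | cvg (trunc (fun y => complex.Re (f y)) e x @[e --> 0^'+])] `&`
          [set x | cvg (trunc (fun y => complex.Im (f y)) e x @[e --> 0^'+])].
have mD : measurable D by apply: measurableI; exact: measurable_cvg_trunc.
have nD : mu.-negligible (~` D).
  have := negligibleU (trunc_cvg_memLp p _ p1 lr) (trunc_cvg_memLp p _ p1 li).
  by rewrite -setCI.
(* the value of [hilbert f] where the principal value does not exist *)
pose c : R[i] := (pi^-1)%:C%C * (point : R[i]^o).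
have hn x : ~ D x -> hilbert f x = c.
  move=> nDx; rewrite /hilbert dvgP//.
  by move=> /hilbert_cvgP.
have pi0 : (pi : R) != 0 by rewrite gt_eqF// pi_gt0.
have half (k : R -> R) (g : R -> R) (c0 : R) : memLp p k ->
   (forall x, D x -> trunc k e x @[e --> 0^'+] --> pi * g x) ->
   (forall x, ~ D x -> g x = c0) -> memLp p g.
  move=> lk h1 h2.
  have -> : g = (fun x => pi^-1 * (pi * g x)) by apply/funext => x; rewrite mulrA mulVf// mul1r.
  apply: (memLpZ p _ _ (ltW p0)).
  by apply: (memLp_lim k (fun x => pi * g x) D (pi * c0) lk mD nD h1) => x /h2 ->.
apply/(LpP p _ p0); split.
  apply: (half _ _ (complex.Re c) lr) => [x [/cvg_ex[a ha] /cvg_ex[b hb]]|x /hn -> //].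
  by rewrite (hilbert_lim f x a b ha hb) /= mulrA mulfV// mul1r.
apply: (half _ _ (complex.Im c) li) => [x [/cvg_ex[a ha] /cvg_ex[b hb]]|x /hn -> //].
by rewrite (hilbert_lim f x a b ha hb) /= mulrA mulfV// mul1r.
Qed.

End HilbertTransform.

(** * Commutation of the two operators *)

Section HausdorffHilbert.
Context {R : realType}.
Local Notation mu := (@lebesgue_measure R).
Variables (p : R) (phi : R -> R) (i : R).
Hypothesis p1 : 1 < p.
Hypothesis phi0 : forall t, 0 < t -> 0 <= phi t.
Hypothesis mphi : measurable_fun (`]0, +oo[%classic : set R) phi.
Hypothesis i0 : 0 <= i.
Hypothesis wi : (\int[mu]_t (t `^ p^-1 * weight phi t)%:E = i%:E)%E.

Let p0 : 0 < p. Proof. exact: lt_trans ltr01 p1. Qed.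
Let w := weight phi.
Let mw : measurable_fun [set: R] w := measurable_weight phi mphi.
Let w0 : forall t, 0 <= w t := weight_ge0 phi phi0.
Let wneg : forall t, t <= 0 -> w t = 0 := weight_neg phi.

Lemma hausdorff_boundedW : hausdorff_bounded p phi.
Proof.
split; first by move=> f; exact: (Lp_hausdorff_exists p phi i p1 phi0 mphi i0 wi).
split.
- by move=> f; exact: (Lp_hausdorff p phi i p1 phi0 mphi i0 wi).
- by move=> a f g; exact: (hausdorff_linear p phi i p1 phi0 mphi i0 wi).
- by exists i => f; exact: (LpNorm_hausdorff p phi i p1 phi0 mphi i0 wi).
Qed.

Lemma dil_commute_hilbert (k g : R -> R) : memLp p k -> memLp p g ->
  {ae mu, forall x, trunc k e x @[e --> 0^'+] --> pi * g x} ->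
  {ae mu, forall x, trunc (dil w k) e x @[e --> 0^'+] --> pi * dil w g x}.
Proof.
move=> lk lg kg.
have lpg := memLpZ p pi g (ltW p0) lg.
have C := dil_commute w p i p1 mw w0 wneg i0 wi k _ lk lpg kg.
have ig := dil_integrable w p i p1 mw w0 wneg i0 wi g lg.
apply: (ae_imply2 _ _ _ _ C ig) => x + igx.
congr (_ --> _); rewrite /dil -RintegralZl//; apply: eq_Rintegral => t _.
by rewrite mulrA.
Qed.

Lemma hausdorff_hilbertE : hausdorff_hilbert_commute p phi.
Proof.
move=> f lf; have lH := Lp_hilbert p p1 f lf.
have lT := Lp_hausdorff p phi i p1 phi0 mphi i0 wi f lf.
have eH := Lp_hilbert_exists p p1 f lf.
split.
- by split.
- exact: (Lp_hausdorff_exists p phi i p1 phi0 mphi i0 wi).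
- by split=> //; exact: (Lp_hausdorff_exists p phi i p1 phi0 mphi i0 wi).
- exact: (Lp_hilbert_exists p p1).
have /(LpP p f p0)[lr li] := lf; have /(LpP p _ p0)[hr hi] := lH.
have pi0 : (pi : R) != 0 by rewrite gt_eqF// pi_gt0.
have cr : {ae mu, forall x, trunc (fun y => complex.Re (f y)) e x @[e --> 0^'+] -->
    pi * complex.Re (hilbert f x)}.
  apply: (ae_imply _ _ _ eH) => x [_ /hilbert_cvgP].
  move=> [/cvg_ex[a ha] /cvg_ex[b hb]].
  by rewrite (hilbert_lim f x a b ha hb) /= mulrA mulfV// mul1r.
have ci : {ae mu, forall x, trunc (fun y => complex.Im (f y)) e x @[e --> 0^'+] -->
    pi * complex.Im (hilbert f x)}.
  apply: (ae_imply _ _ _ eH) => x [_ /hilbert_cvgP].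
  move=> [/cvg_ex[a ha] /cvg_ex[b hb]].
  by rewrite (hilbert_lim f x a b ha hb) /= mulrA mulfV// mul1r.
have Cr := dil_commute_hilbert _ _ lr hr cr; have Ci := dil_commute_hilbert _ _ li hi ci.
apply: (ae_imply2 _ _ _ _ Cr Ci) => x xr xi _.
rewrite (hilbert_lim (hausdorff phi f) x (pi * dil w (fun y => complex.Re (hilbert f y)) x)
   (pi * dil w (fun y => complex.Im (hilbert f y)) x)).
- apply/eqP; rewrite eq_complex hausdorff_Re hausdorff_Im/= !mulrA mulVf// !mul1r.
  by rewrite !eqxx.
- by under eq_fun do under eq_fun do rewrite hausdorff_Re.
- by under eq_fun do under eq_fun do rewrite hausdorff_Im.
Qed.

End HausdorffHilbert.

(** * Sharpness of the constant *)

Section LowerBound.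
Context {R : realType}.
Local Notation mu := (@lebesgue_measure R).
Variables (p : R) (phi : R -> R).
Hypothesis p1 : 1 < p.
Hypothesis phi0 : forall t, 0 < t -> 0 <= phi t.
Hypothesis mphi : measurable_fun (`]0, +oo[%classic : set R) phi.

Let p0 : 0 < p. Proof. exact: lt_trans ltr01 p1. Qed.
Let w := weight phi.
Let mw : measurable_fun [set: R] w := measurable_weight phi mphi.
Let w0 : forall t, 0 <= w t := weight_ge0 phi phi0.
Let wneg : forall t, t <= 0 -> w t = 0 := weight_neg phi.

(** A function of norm 1 that is almost an eigenfunction of all dilations when [d] is
    small. *)
Definition power_tail (d : R) (x : R) : R :=
  (d * p) `^ p^-1 * (\1_`[1, +oo[ x * x `^ (- (p^-1 + d))).

Lemma power_tail_ge0 d x : 0 <= power_tail d x.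
Proof. by rewrite /power_tail !mulr_ge0 ?powR_ge0// indicE. Qed.

Lemma measurable_power_tail d : measurable_fun [set: R] (power_tail d).
Proof.
apply: measurable_funM => //; apply: measurable_funM; last exact: measurable_fun_powR.
exact: measurable_indic.
Qed.

Lemma integral_tail_powR (c N d : R) : 0 <= c -> 0 < N -> 0 < d ->
  (\int[mu]_x ((c * (\1_`[N, +oo[ x * x `^ (- (p^-1 + d)))) `^ p)%:E =
   (c `^ p * (N `^ (- (d * p)) / (d * p)))%:E)%E.
Proof.
move=> c0 N0 d0.
have E x : (c * (\1_`[N, +oo[ x * x `^ (- (p^-1 + d)))) `^ p =
    c `^ p * (\1_`[N, +oo[ x * x `^ (- (d * p) - 1)).
  rewrite powRM// ?mulr_ge0 ?powR_ge0 ?indicE//; congr (_ * _).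
  case: (x \in _); last by rewrite !mul0r powR0// gt_eqF.
  rewrite !mul1r -powRrM; congr (_ `^ _); field; exact: lt0r_neq0.
under eq_integral do rewrite E EFinM.
rewrite ge0_integralZl//; last 3 first.
- apply/measurable_EFinP; apply: measurable_funM; last exact: measurable_fun_powR.
  exact: measurable_indic.
- by move=> x _; rewrite lee_fin mulr_ge0 ?powR_ge0// indicE.
- by rewrite lee_fin powR_ge0.
rewrite EFinM -integral_powR_tail//; last exact: mulr_gt0.
congr (_ * _)%E; rewrite [RHS]integral_mkcond/=; apply: eq_integral => x _.
by rewrite patchE indicE; case: (x \in _); rewrite ?mul1r ?mul0r.
Qed.

Let test d (x : R) : R[i] := (power_tail d x)%:C%C.

Lemma Cmodulus_test d x : Cmodulus (test d x) = power_tail d x.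
Proof. by rewrite CmodulusE/= expr0n/= addr0 sqrtr_sqr ger0_norm// power_tail_ge0. Qed.

Lemma LpNorm_test d : 0 < d -> LpNorm p (test d) = 1%E.
Proof.
move=> d0; have dp0 : 0 < d * p by exact: mulr_gt0.
rewrite LpNormE; under eq_integral do rewrite Cmodulus_test.
rewrite integral_tail_powR// ?powR_ge0// powR1 -powRrM mulVf ?gt_eqF// powRr1 ?(ltW dp0)//.
by rewrite mulrA mulr1 mulfV ?gt_eqF// poweR1r.
Qed.

Lemma Lp_test d : 0 < d -> Lp p (test d).
Proof.
move=> d0; split; last by rewrite LpNorm_test// ltry.
by split; [exact: measurable_power_tail|exact: measurable_cst].
Qed.

Definition moment_cut (N : R) : \bar R :=
  (\int[mu]_t (\1_`[N^-1, N] t * (t `^ p^-1 * w t))%:E)%E.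

(** For [x >= N] and [t] in [[N^-1, N]] the point [x / t] is still at least 1, and
    [(x / t) `^ (- (p^-1 + d))] is [x `^ (- (p^-1 + d)) * t `^ p^-1] up to the factor
    [t `^ d >= N `^ (- d)]. *)
Lemma dil_power_tail (N d x r : R) : 1 < N -> 0 < d -> N <= x -> (r%:E <= moment_cut N)%E ->
  mu.-integrable setT (fun t => (power_tail d (x / t) * w t)%:E) ->
  (d * p) `^ p^-1 * x `^ (- (p^-1 + d)) * N `^ (- d) * r <= dil w (power_tail d) x.
Proof.
move=> N1 d0 Nx hr ix; have N0 : 0 < N by exact: lt_trans ltr01 N1.
have x0 : 0 < x by exact: lt_le_trans Nx.
set K := (d * p) `^ p^-1 * x `^ (- (p^-1 + d)) * N `^ (- d).
have K0 : 0 <= K by rewrite !mulr_ge0 ?powR_ge0.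
have mJ : measurable_fun [set: R] (fun t => \1_`[N^-1, N] t * (t `^ p^-1 * w t)).
  apply: measurable_funM; first exact: measurable_indic.
  by apply: measurable_funM; [exact: measurable_fun_powR|exact: mw].
have J0 t : 0 <= \1_`[N^-1, N] t * (t `^ p^-1 * w t) by rewrite !mulr_ge0 ?powR_ge0// indicE.
have -> : dil w (power_tail d) x = fine (\int[mu]_t (power_tail d (x / t) * w t)%:E)%E by [].
rewrite -lee_fin fineK; last exact: integrable_fin_num.
rewrite EFinM; apply: (@le_trans _ _ (K%:E * moment_cut N)%E).
  by apply: lee_wpmul2l; rewrite ?lee_fin.
rewrite /moment_cut -ge0_integralZl//; last 2 first.
- exact/measurable_EFinP.
- by move=> t _; rewrite lee_fin.
apply: ge0_le_integral => //.
- by move=> t _; rewrite -EFinM lee_fin mulr_ge0.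
- by apply: measurable_funeM; exact/measurable_EFinP.
- by have /integrableP[] := ix.
move=> t _; rewrite -EFinM lee_fin indicE mem_setE in_itv/=.
case: (boolP (N^-1 <= t <= N)) => [/andP[t1 t2]|_]; last first.
  by rewrite mul0r mulr0 mulr_ge0 ?power_tail_ge0.
have t0 : 0 < t by apply: lt_le_trans t1; rewrite invr_gt0.
rewrite mul1r mulrA; apply: ler_wpM2r => //.
rewrite /power_tail indicE mem_setE in_itv/= andbT ler_pdivlMr// mul1r (le_trans t2 Nx) mul1r.
rewrite /K -!mulrA; apply: ler_wpM2l; first exact: powR_ge0.
rewrite powRM ?invr_ge0 ?(ltW x0) ?(ltW t0)//; apply: ler_wpM2l; first exact: powR_ge0.
rewrite powRV ?(ltW t0)// -powRN opprK powRD ?(lt0r_neq0 t0) ?implybT// mulrC.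
apply: ler_wpM2l; first exact: powR_ge0.
rewrite powRN -powRV ?(ltW N0)//; apply: ge0_ler_powR; rewrite ?nnegrE ?invr_ge0 ?(ltW N0) ?(ltW d0) ?(ltW t0)//.
Qed.

(** One factor [N `^ (- d)] comes from [dil_power_tail], the other from cutting the
    norm of [power_tail d] at [N]. *)
Lemma LpNorm_hausdorff_test (N d r : R) : 1 < N -> 0 < d -> 0 <= r ->
  (r%:E <= moment_cut N)%E -> hausdorff_exists phi (test d) ->
  ((N `^ (- (2 * d)) * r)%:E <= LpNorm p (hausdorff phi (test d)))%E.
Proof.
move=> N1 d0 r0 hr ex; have N0 : 0 < N by exact: lt_trans ltr01 N1.
have dp0 : 0 < d * p by exact: mulr_gt0.
pose c := (d * p) `^ p^-1 * N `^ (- d) * r.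
have c0 : 0 <= c by rewrite !mulr_ge0 ?powR_ge0.
have cm : Cmeasurable (hausdorff phi (test d)).
  split.
    under eq_fun do rewrite hausdorff_Re; apply: (measurable_dil w mw (fun y => complex.Re (test d y))).
    exact: measurable_power_tail.
  under eq_fun do rewrite hausdorff_Im; apply: (measurable_dil w mw (fun y => complex.Im (test d y))).
  exact: measurable_cst.
have low : (\int[mu]_x ((c * (\1_`[N, +oo[ x * x `^ (- (p^-1 + d)))) `^ p)%:E <=
    \int[mu]_x (Cmodulus (hausdorff phi (test d) x) `^ p)%:E)%E.
  apply: ae_ge0_le_integral => //.
  - by move=> x _; rewrite lee_fin powR_ge0.
  - apply/measurable_EFinP; apply: measurable_fun_powR; apply: measurable_funM => //.
    by apply: measurable_funM; [exact: measurable_indic|exact: measurable_fun_powR].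
  - by move=> x _; rewrite lee_fin powR_ge0.
  - by apply/measurable_EFinP; apply: measurable_fun_powR; exact: measurable_Cmodulus.
  apply: (ae_imply _ _ _ ex) => x /Cintegrable_hausdorff[ix _] _.
  rewrite lee_fin; apply: ge0_ler_powR; rewrite ?nnegrE ?(ltW p0) ?Cmodulus_ge0//.
    by rewrite !mulr_ge0 ?powR_ge0// indicE.
  rewrite indicE mem_setE in_itv/= andbT; have [Nx|_] := leP N x; last first.
    by rewrite mul0r mulr0; exact: Cmodulus_ge0.
  rewrite mul1r; apply: le_trans (Re_le_Cmodulus _); apply: le_trans (ler_norm _).
  rewrite hausdorff_Re; apply: le_trans (dil_power_tail N d x r N1 d0 Nx hr ix).
  rewrite (_ : c * x `^ (- (p^-1 + d)) = (d * p) `^ p^-1 * x `^ (- (p^-1 + d)) * N `^ (- d) * r)//.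
  by rewrite /c mulrAC; congr (_ * _); rewrite mulrAC.
rewrite integral_tail_powR// in low.
rewrite LpNormE.
have -> : N `^ (- (2 * d)) * r = (c `^ p * (N `^ (- (d * p)) / (d * p))) `^ p^-1.
  have cp : c `^ p = d * p * N `^ (- (d * p)) * r `^ p.
    rewrite /c powRM ?mulr_ge0 ?powR_ge0// powRM ?powR_ge0//.
    by rewrite -!powRrM mulVf ?gt_eqF// powRr1 ?(ltW dp0)// mulNr.
  have -> : c `^ p * (N `^ (- (d * p)) / (d * p)) = (N `^ (- (2 * d)) * r) `^ p.
    rewrite cp powRM ?powR_ge0// -powRrM (_ : - (2 * d) * p = - (d * p) + - (d * p)); last by ring.
    rewrite powRD ?(lt0r_neq0 N0) ?implybT//.
    by move: (d * p) dp0 => D D0; field; exact: lt0r_neq0 D0.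
  by rewrite -powRrM mulfV ?gt_eqF// powRr1// mulr_ge0 ?powR_ge0.
rewrite -poweR_EFin; apply: gt0_ler_poweR => //.
- by rewrite invr_ge0 ltW.
- by rewrite in_itv/= leey andbT lee_fin !mulr_ge0 ?powR_ge0// invr_ge0 ltW.
- by rewrite in_itv/= leey andbT; apply: integral_ge0 => x _; rewrite lee_fin powR_ge0.
Qed.

(** With [d = y / (2 * ln N)] the loss [N `^ (- (2 * d))] is [expR (- y) >= 1 - y], and
    [y] is arbitrarily small. *)
Lemma moment_cut_le (K : \bar R) (N : R) : 1 < N ->
  (forall f, Lp p f -> LpNorm p f = 1%E ->
     hausdorff_exists phi f /\ (LpNorm p (hausdorff phi f) <= K)%E) ->
  (moment_cut N <= K)%E.
Proof.
move=> N1 H; have N0 : 0 < N by exact: lt_trans ltr01 N1.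
have lnN : 0 < ln N by rewrite ln_gt0.
have K0 : (0 <= K)%E.
  have [_] := H (test 1) (Lp_test 1 ltr01) (LpNorm_test 1 ltr01).
  by apply: le_trans; rewrite LpNormE poweR_ge0.
have key (r : R) : 0 <= r -> (r%:E <= moment_cut N)%E -> (r%:E <= K)%E.
  move=> r0 hr; have step (y : R) : 0 < y -> (((1 - y) * r)%:E <= K)%E.
    move=> y0; pose d := y / (2 * ln N).
    have d0 : 0 < d by rewrite divr_gt0// mulr_gt0.
    have [ex hK] := H (test d) (Lp_test d d0) (LpNorm_test d d0).
    apply: le_trans hK; apply: le_trans (LpNorm_hausdorff_test N d r N1 d0 r0 hr ex).
    rewrite lee_fin; apply: ler_wpM2r => //.
    have -> : N `^ (- (2 * d)) = expR (- y).
      by rewrite /powR gt_eqF//; congr expR; rewrite /d; field; exact: lt0r_neq0.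
    exact: expR_ge1Dx.
  move: K0 step; case: K {H} => [k| |]// k0 step; last by rewrite leey.
  rewrite lee_fin; apply/ler_addgt0Pr => eps eps0.
  have [->|rn] := eqVneq r 0; first by rewrite addr_ge0// ltW.
  have rp : 0 < r by rewrite lt0r rn.
  have := step (eps / r) (divr_gt0 eps0 rp); rewrite lee_fin mulrBl mul1r divfK//.
  by rewrite lerBlDr.
have M0 : (0 <= moment_cut N)%E.
  by apply: integral_ge0 => t _; rewrite lee_fin !mulr_ge0 ?powR_ge0// indicE.
move: key M0; case: (moment_cut N) => [m| |] // key m0; first exact: key.
move: K0 key; case: K {H} => [k| |]// k0 key.
have := key (k + 1) _ (leey _); rewrite lee_fin addr_ge0// => /(_ isT).
by rewrite gerDl ler10.
Qed.

Lemma moment_le (K : \bar R) :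
  (forall f, Lp p f -> LpNorm p f = 1%E ->
     hausdorff_exists phi f /\ (LpNorm p (hausdorff phi f) <= K)%E) ->
  (\int[mu]_t (t `^ p^-1 * w t)%:E <= K)%E.
Proof.
move=> H.
pose G (n : nat) t := (\1_`[n.+2%:R^-1, n.+2%:R] t * (t `^ p^-1 * w t))%:E.
have mG n : measurable_fun [set: R] (G n).
  apply/measurable_EFinP; apply: measurable_funM; first exact: measurable_indic.
  by apply: measurable_funM; [exact: measurable_fun_powR|exact: mw].
have G0 n t : (0 <= G n t)%E by rewrite lee_fin !mulr_ge0 ?powR_ge0// indicE.
have ndG t : {homo G^~ t : n m / (n <= m)%N >-> (n <= m)%E}.
  move=> n m nm; rewrite lee_fin; apply: ler_wpM2r; first by rewrite mulr_ge0 ?powR_ge0.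
  rewrite !indicE !mem_setE !in_itv/= ler_nat.
  case: (boolP (_ <= t <= n.+2%:R)) => // /andP[t1 t2].
  rewrite (le_trans t2) ?ler_nat// andbT (le_trans _ t1)// lef_pV2 ?posrE// ler_nat//.
have limG t : (limn (G^~ t) = (t `^ p^-1 * w t)%:E)%E.
  have [t0|t0] := ltP 0 t; last first.
    by rewrite /G wneg// !mulr0; under eq_fun do rewrite mulr0; exact: lim_cst.
  apply: lim_near_cst; first exact: ereal_hausdorff.
  near=> n; rewrite /G indicE mem_setE in_itv/=.
  have h1 : t <= n.+2%:R.
    apply: (@le_trans _ _ n%:R); last by rewrite ler_nat ltnW.
    by near: n; exact: nbhs_infty_ger.
  have h2 : t^-1 <= n.+2%:R.
    apply: (@le_trans _ _ n%:R); last by rewrite ler_nat ltnW.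
    by near: n; exact: nbhs_infty_ger.
  by rewrite h1 andbT -[t in X in X%:R]invrK lef_pV2 ?posrE ?invr_gt0// h2 mul1r.
have -> : (\int[mu]_t (t `^ p^-1 * w t)%:E = \int[mu]_t limn (G^~ t))%E.
  by apply: eq_integral => t _; rewrite limG.
rewrite monotone_convergence//.
apply: lime_le.
  apply: ereal_nondecreasing_is_cvgn => n m nm; apply: ge0_le_integral => //; try exact: mG.
  by move=> t _; exact: ndG.
apply: nearW => n; apply: moment_cut_le => //.
by rewrite ltr1n.
Unshelve. all: by end_near. Qed.

End LowerBound.

(** * Boundedness, norm and commutation *)

Theorem corollary1p2 (R : realType) (p : R) (phi : R -> R)
  (p_gt1 : 1 < p)
  (phi_ge0 : forall t : R, 0 < t -> 0 <= phi t)
  (phi_loc : locally_integrable `]0, +oo[ phi) :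
  let I : \bar R :=
    (\int[@lebesgue_measure R]_(t in [set` `]0%R, +oo[%R])
        (t `^ (p^-1 - 1) * phi t)%:E)%E in
  (hausdorff_bounded p phi <-> (I < +oo)%E) /\
  ((I < +oo)%E ->
     opnorm_Lp p (hausdorff phi) = I /\ hausdorff_hilbert_commute p phi).
Proof.
move=> I; have [mphi _ _] := phi_loc.
have p0 : 0 < p by exact: lt_trans ltr01 p_gt1.
have IE : I = (\int[@lebesgue_measure R]_t (t `^ p^-1 * weight phi t)%:E)%E.
  exact: moment_weight.
have I0 : (0 <= I)%E.
  by rewrite IE; apply: integral_ge0 => t _; rewrite lee_fin mulr_ge0 ?powR_ge0 ?weight_ge0.
have lower (K : \bar R) : (forall f, Lp p f -> LpNorm p f = 1%E ->
     hausdorff_exists phi f /\ (LpNorm p (hausdorff phi f) <= K)%E) -> (I <= K)%E.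
  by move=> H; rewrite IE; exact: moment_le.
have fin : (I < +oo)%E -> exists2 i : R, 0 <= i & I = i%:E.
  by move: I0; clear; case: I => [i| |]// i0 _; exists i.
split.
  split=> [[ex [_ _ [C hC]]]|/fin[i i0 Ii]].
    apply: (@le_lt_trans _ _ C%:E); last exact: ltry.
    apply: lower => f lf f1; split; first exact: ex.
    by have := hC f lf; rewrite f1 mule1.
  by apply: (hausdorff_boundedW p phi i) => //; rewrite -IE.
move=> /fin[i i0 Ii]; have wi : (\int[@lebesgue_measure R]_t (t `^ p^-1 * weight phi t)%:E = i%:E)%E.
  by rewrite -IE.
split; last exact: (hausdorff_hilbertE p phi i).
apply/eqP; rewrite eq_le; apply/andP; split.
  apply: ge_ereal_sup => _ [f [lf f1] <-].
  apply: le_trans (LpNorm_hausdorff p phi i p_gt1 phi_ge0 mphi i0 wi f lf) _.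
  by rewrite Ii -[leRHS]mule1; apply: lee_wpmul2l; rewrite ?lee_fin.
apply: lower => f lf f1; split.
  exact: (Lp_hausdorff_exists p phi i p_gt1 phi_ge0 mphi i0 wi).
by apply: ereal_sup_ubound; exists f => //; rewrite /= f1.
Qed.
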